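(* Let $\mathfrak a$ be a Cartan subspace of $\mathfrak q$. Then $$\Delta_{\mathfrak a}(\partial(Q))=\delta^{-1}\circ(L_{\alpha_1}+L_{\alpha_2})\circ\delta=(\beta_1\beta_2)^{-1}\circ(L_{\alpha_1}+L_{\alpha_2})\circ(\beta_1\beta_2),$$ $$\Delta_{\mathfrak a}(\partial(S))=\delta^{-1}\circ(L_{\alpha_1}L_{\alpha_2})\circ\delta=(\beta_1\beta_2)^{-1}\circ(L_{\alpha_1}L_{\alpha_2})\circ(\beta_1\beta_2).$$
   Context: $\mathfrak g=\mathfrak{gl}(4,\mathbb R)$; $H=\{\mathrm{diag}(A,B):A,B\in GL(2,\mathbb R)\}$ (block diagonal) acts by conjugation on $\mathfrak q=\{X=\begin{pmatrix}0&U\\ V&0\end{pmatrix}:U,V\in M_2(\mathbb R)\}$. Put $Q(X)=\frac12\mathrm{tr}(X^2)$, $S(X)=\det X$, $S_0=Q^2-4S$; $\delta=\sqrt{S_0}$ if $S_0\ge0$, $\delta=i\sqrt{|S_0|}$ if $S_0<0$; $\mathfrak q^{reg}=\{X\in\mathfrak q:SS_0\neq0\}$. Let $\omega(X,X')=\frac12\mathrm{tr}(XX')$. For $P\in\mathbb C[\mathfrak q]$, $\partial(P)$ is the constant coefficient differential operator on $\mathfrak q$ corresponding to $P$ under $\mathfrak q\simeq\mathfrak q^*$ via $\omega$ (the linear form $\omega(A,\cdot)$ is sent to the derivative in direction $A$). A Cartan subspace $\mathfrak a\subset\mathfrak q$ is an abelian subspace of semisimple elements, maximal for these properties; $\mathfrak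 a^{reg}=\mathfrak a\cap\mathfrak q^{reg}$. The roots $\Delta(\mathfrak g_{\mathbb C},\mathfrak a_{\mathbb C})$ have a positive system $\{\alpha_1,\alpha_2,\beta_1,\beta_2\}$ with $\alpha_1,\alpha_2$ of multiplicity one and $\beta_1=\frac{\alpha_1-\alpha_2}2$, $\beta_2=\frac{\alpha_1+\alpha_2}2$ of multiplicity two. For a root $\alpha$, $h_\alpha\in\mathfrak a_{\mathbb C}$ is defined by $\omega(h_\alpha,X)=\alpha(X)$ for $X\in\mathfrak a$, $\partial h_\alpha$ is the derivative in direction $h_\alpha$, and $$L_\alpha=\frac1{4\alpha}\,\partial h_\alpha\big(\alpha\,\partial h_\alpha\big)=\frac14(\partial h_\alpha)^2+\frac1\alpha\,\partial h_\alpha .$$ The radial part $\Delta_{\mathfrak a}(D)$ of an $H$-invariant differential operator $D$ is the differential operator on $\mathfrak a^{reg}$ such that $\Delta_{\mathfrak a}(D)(f|_{\mathfrak a^{reg}})=(Df)|_{\mathfrak a^{reg}}$ for every $H$-invariant $f\in C^\infty(\mathfrak q)$. Functions such as $\delta$ and $\beta_1\beta_2$ denote here the operators of multiplication by their restrictions to $\mathfrak a^{reg}$. (In the paper $\beta_1\beta_2$ is written $I(k-\frac12)=\prod_{\alpha>0}\alpha^{m_\alpha-1}$, $m_\alpha$ the multiplicities.) *)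

(* Defs.v *)
From HB Require Import structures.
From mathcomp Require Export all_boot all_order all_algebra.
From mathcomp Require Export complex.
From mathcomp Require Export all_classical all_reals all_analysis.
From mathcomp Require mpoly.
(* The notations of mpoly are incompatible with those of MathComp-Analysis. *)
Export -(notations) mpoly.
Export numFieldNormedType.Exports.

Set Implicit Arguments.
Unset Strict Implicit.
Unset Printing Implicit Defensive.

Import Order.TTheory GRing.Theory Num.Theory.
Local Open Scope classical_set_scope.
Local Open Scope ring_scope.

Section InvariantForms.
Variable K : comUnitRingType.
Implicit Types X Y : 'M[K]_(2 + 2).

Definition omega X Y : K := 2^-1 * \tr (X *m Y).
Definition Qf X : K := 2^-1 * \tr (X *m X).
Definition Sf X : K := \det X.
Definition S0f X : K := Qf X ^+ 2 - 4 * Sf X.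

End InvariantForms.

Section SymmetricPair.
Variable R : realType.
Local Notation C := R[i].
Local Notation V := 'M[R]_(2 + 2).
Implicit Types (f g phi gamma : V -> C) (X Y v : V) (T D : (V -> C) -> V -> C).
Implicit Type a : {vspace V}.

Definition qset : set V := [set X | ulsubmx X = 0 /\ drsubmx X = 0].

Definition qreg : set V := [set X | qset X /\ Sf X * S0f X != 0].

Definition H_invariant f : Prop :=
  forall A B : 'M[R]_2, A \in unitmx -> B \in unitmx ->
  forall X, qset X ->
    f (block_mx A 0 0 B *m X *m invmx (block_mx A 0 0 B)) = f X.

Definition delta X : C :=
  if 0 <= S0f X then (Num.sqrt (S0f X))%:C%C
  else (0 +i* Num.sqrt `|S0f X|)%C.

(* Functions on q or on an open subset of a subspace of q are represented by
   functions on V; only their values on that subset are ever used.  R[i] is not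
   a normed module over R in the library, so derivatives of complex-valued
   functions are taken componentwise. *)
Definition dder v f : V -> C := fun X =>
  ('D_v (fun Y => complex.Re (f Y)) X +i* 'D_v (fun Y => complex.Im (f Y)) X)%C.

Definition iter_dder (vs : seq V) f : V -> C := foldr dder f vs.

(* f is C^oo on Omega, for E a linear subspace of V and Omega a relatively open
   subset of E: only directions in E occur, so this depends only on the
   restriction of f to Omega. *)
Definition smooth_on (E Omega : set V) f : Prop :=
  forall vs : seq V, (forall v, v \in vs -> E v) ->
  let g := iter_dder vs f in
  [/\ {within Omega, continuous (fun X => complex.Re (g X))},
      {within Omega, continuous (fun X => complex.Im (g X))} &
      forall X v, Omega X -> E v ->
        derivable (fun Y => complex.Re (g Y)) X v /\
        derivable (fun Y => complex.Im (g Y)) X v].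

(* C[q] is {mpoly C[8]}: the first four variables are the entries of U and the
   last four the entries of V, each block being read in row-major order. *)
Definition nq : nat := (2 * 2 + 2 * 2)%N.

Definition coordq X (k : 'I_nq) : R :=
  match fintype.split k with
  | inl p => mxvec (ursubmx X) 0 p
  | inr p => mxvec (dlsubmx X) 0 p
  end.

Definition generic_q : 'M[mpoly nq C]_(2 + 2) :=
  block_mx 0 (vec_mx (\row_p mpolyX C (mnm1 (lshift (2 * 2) p))))
           (vec_mx (\row_p mpolyX C (mnm1 (rshift (2 * 2) p)))) 0.

(* The vector representing the k-th coordinate through omega; see
   omega_coord_dir. *)
Definition coord_dir (k : 'I_nq) : V :=
  match fintype.split k with
  | inl p => block_mx 0 0 (2 *: (vec_mx (delta_mx 0 p))^T) 0
  | inr p => block_mx 0 (2 *: (vec_mx (delta_mx 0 p))^T) 0 0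
  end.

Definition dpoly (P : mpoly nq C) f : V -> C := fun X =>
  \sum_(m <- msupp P) mcoeff m P *
    iter_dder (flatten [seq nseq (m k) (coord_dir k) | k <- enum 'I_nq]) f X.

Definition cmx X : 'M[C]_(2 + 2) := map_mx (real_complex R) X.

Definition rmx (h : 'M[C]_(2 + 2)) : V := map_mx (@complex.Re R) h.
Definition imx (h : 'M[C]_(2 + 2)) : V := map_mx (@complex.Im R) h.

Definition abelian_semisimple a : Prop :=
  [/\ [set` a] `<=` qset,
      forall X Y, X \in a -> Y \in a -> X *m Y = Y *m X &
      forall X, X \in a -> diagonalizable (cmx X)].

Definition cartan_subspace a : Prop :=
  abelian_semisimple a /\
  forall b : {vspace V}, abelian_semisimple b -> (a <= b)%VS -> b = a.

Definition areg a : set V := [set` a] `&` qreg.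

(* A linear form on the complexification of a is represented by its restriction
   to a.  The existence of a nonzero Z forces gamma to be R-linear on a. *)
Definition root_vector a gamma (Z : 'M[C]_(2 + 2)) : Prop :=
  forall X, X \in a -> cmx X *m Z - Z *m cmx X = gamma X *: Z.

Definition is_root a gamma : Prop :=
  (exists2 X, X \in a & gamma X != 0) /\
  (exists2 Z, Z != 0 & root_vector a gamma Z).

Definition has_multiplicity a gamma (m : nat) : Prop :=
  exists2 W : {vspace 'M[C]_(2 + 2)},
    (forall Z, Z \in W <-> root_vector a gamma Z) & \dim W = m.

Definition mem_on a (P : set (V -> C)) gamma : Prop :=
  exists2 g, P g & {in a, gamma =1 g}.

Definition positive_system a (P : set (V -> C)) : Prop :=
  [/\ forall gamma, P gamma -> is_root a gamma,
      forall gamma, is_root a gamma ->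
        mem_on a P gamma \/ mem_on a P (fun X => - gamma X),
      forall gamma, ~ (mem_on a P gamma /\ mem_on a P (fun X => - gamma X)) &
      forall gamma1 gamma2, P gamma1 -> P gamma2 ->
        is_root a (fun X => gamma1 X + gamma2 X) ->
        mem_on a P (fun X => gamma1 X + gamma2 X)].

Definition beta1 (alpha1 alpha2 : V -> C) : V -> C :=
  fun X => (alpha1 X - alpha2 X) / 2.
Definition beta2 (alpha1 alpha2 : V -> C) : V -> C :=
  fun X => (alpha1 X + alpha2 X) / 2.

Definition positive_roots a (alpha1 alpha2 : V -> C) : Prop :=
  [/\ positive_system a
        [set alpha1; alpha2; beta1 alpha1 alpha2; beta2 alpha1 alpha2],
      has_multiplicity a alpha1 1 /\ has_multiplicity a alpha2 1 &
      has_multiplicity a (beta1 alpha1 alpha2) 2 /\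
      has_multiplicity a (beta2 alpha1 alpha2) 2].

Definition coroot a (alpha : V -> C) : 'M[C]_(2 + 2) :=
  xget 0 [set h | [/\ rmx h \in a, imx h \in a &
                      forall X, X \in a -> omega h (cmx X) = alpha X]].

Definition cdder (h : 'M[C]_(2 + 2)) f : V -> C := fun X =>
  dder (rmx h) f X + 'i%C * dder (imx h) f X.

Definition Lop a (alpha : V -> C) : (V -> C) -> V -> C := fun phi X =>
  (4 * alpha X)^-1 *
    cdder (coroot a alpha) (fun Y => alpha Y * cdder (coroot a alpha) phi Y) X.

Definition mul_op f : (V -> C) -> V -> C := fun phi X => f X * phi X.

Definition add_op T D : (V -> C) -> V -> C := fun phi X => T phi X + D phi X.

Definition conj_op f T : (V -> C) -> V -> C :=
  mul_op (fun X => (f X)^-1) \o T \o mul_op f.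

Definition diff_op a T : Prop :=
  exists (n : nat) (c : 'I_n -> V -> C) (vs : 'I_n -> seq V),
    [/\ forall i, smooth_on [set` a] (areg a) (c i),
        forall i v, v \in vs i -> v \in a &
        forall phi, smooth_on [set` a] (areg a) phi ->
        forall X, areg a X ->
          T phi X = \sum_(i < n) c i X * iter_dder (vs i) phi X].

Definition eq_op_on a T1 T2 : Prop :=
  forall phi, smooth_on [set` a] (areg a) phi ->
  forall X, areg a X -> T1 phi X = T2 phi X.

Definition satisfies_radial a D T : Prop :=
  diff_op a T /\
  forall f, smooth_on qset qset f -> H_invariant f ->
  forall X, areg a X -> T f X = D f X.

(* T is the radial part of D on a: uniqueness is part of the assertion. *)
Definition radial_part a D T : Prop :=
  satisfies_radial a D T /\
  forall T', satisfies_radial a D T' -> eq_op_on a T' T.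

Lemma omega_coord_dir (k : 'I_nq) X : qset X -> omega (coord_dir k) X = coordq X k.
Proof.
move=> [ul dr]; rewrite -(submxK X) ul dr /omega /coordq /coord_dir.
have tr_delta (W : 'M[R]_2) (p : 'I_(2 * 2)) :
    \tr ((vec_mx (delta_mx 0 p))^T *m W) = mxvec W 0 p.
  have [i j] := mxvec_indexP p; rewrite vec_mx_delta trmx_delta mxvecE /mxtrace.
  rewrite (bigD1 j) //= big1 ?addr0 => [|l ljN]; rewrite !mxE.
    rewrite (bigD1 i) //= big1 ?addr0 => [|l liN]; rewrite !mxE ?eqxx ?mul1r//.
    by rewrite (negPf liN) andbF mul0r.
  by apply: big1 => l' _; rewrite !mxE (negPf ljN) mul0r.
case: fintype.splitP => p _.
  rewrite mulmx_block !mul0mx !addr0 mxtrace_block mxtrace0 add0r.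
  by rewrite -scalemxAl mxtraceZ mulrA mulVf ?pnatr_eq0 // mul1r tr_delta block_mxKur.
rewrite mulmx_block !mul0mx !mulmx0 !add0r mxtrace_block mxtrace0 addr0.
by rewrite -scalemxAl mxtraceZ mulrA mulVf ?pnatr_eq0 // mul1r tr_delta block_mxKdl.
Qed.

Lemma meval_generic_q X : qset X ->
  map_mx (meval (fun k => (coordq X k)%:C%C)) generic_q = cmx X.
Proof.
move=> [ul dr]; rewrite /generic_q map_block_mx !raddf0 /cmx.
rewrite -[X in RHS]submxK ul dr map_block_mx !raddf0; congr block_mx.
  apply/matrixP => i j; rewrite !mxE mevalXU /coordq.
  by rewrite -[lshift _ _]/(unsplit (inl _)) unsplitK mxvecE !mxE.
apply/matrixP => i j; rewrite !mxE mevalXU /coordq.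
by rewrite -[rshift _ _]/(unsplit (inr _)) unsplitK mxvecE !mxE.
Qed.

End SymmetricPair.

(* Main.v *)
(** An H-invariant function f is a function of the two invariants (Q, S) on
    [qreg], because X = (0 U; W 0) with S S0 <> 0 is H-conjugate to the element
    with W = 1 and U the companion matrix of T^2 - Q T + S.  Applying d(Q) and
    d(S) = 16 det(d_W) det(d_U) to such a function expresses d(Q) f and d(S) f
    through the derivatives of f with respect to Q and S.  On a Cartan subspace,
    Q = u_1 + u_2 and S = u_1 u_2 with u_i = alpha_i^2 / 4, while
    L_{alpha_i} = 4 (u_i d_i^2 + d_i) and beta_1 beta_2 = u_1 - u_2, so that both
    formulas become polynomial identities.  The square of beta_1 beta_2 is S0,
    hence delta is beta_1 beta_2 up to a locally constant sign.

    For uniqueness, Q - Q(X0) and S - S(X0) are local coordinates on the Cartan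
    subspace at a regular point X0.  A differential operator that kills all
    powers of their linear combinations has vanishing top-order symbol at X0,
    hence, by induction on the order, vanishes there. *)
From mathcomp Require Import ring perm.
Require Import Defs.
Set Implicit Arguments.
Unset Strict Implicit.
Unset Printing Implicit Defensive.
Import Order.TTheory GRing.Theory Num.Theory.
Local Open Scope classical_set_scope.
Local Open Scope ring_scope.

(** * Partial derivatives in two variables *)

(** Smoothness on a relatively open part of a subspace is recorded only through iterated directional
    derivatives, so linearity in the direction and symmetry of second derivatives have to be
    recovered from mean value arguments on affine planes. Functions of (Q, S) never live on a
    parameter plane: they are double families [F i j] of functions on matrices that obey the chain
    rule, and the jets of an invariant f along the slice form such a family. Since det(d_U) turns a
    function of the invariants into det W times another one, d(S) is handled in two stages. The
    constants 4 and 16 stem from the factor 1/2 in [omega]: the vector dual to a coordinate is twice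
    a matrix unit, and d(Q), d(S) have orders 2 and 4. Maximality puts X^3 into the Cartan subspace
    of X, and for regular X the pair X, X^3 is a basis; it serves the coroots and the uniqueness
    alike. As [delta] is defined by cases, every computation is made with beta_1 beta_2 and then
    transported. *)

Section TwoVariables.
Variable R : realType.

Definition near2 (x y : R) (P : R -> R -> Prop) :=
  exists2 r : R, 0 < r & forall s t, `|s - x| < r -> `|t - y| < r -> P s t.

Definition cts2 (G : R -> R -> R) (x y : R) :=
  forall e : R, 0 < e -> near2 x y (fun s t => `|G s t - G x y| < e).

Lemma MVT_itv (f df : R -> R) (a b : R) : a < b ->
  (forall x, a <= x <= b -> is_derive x 1 f (df x)) ->
  exists2 c, a <= c <= b & f b - f a = df c * (b - a).
Proof.
move=> ab Hx.
have H1 x : x \in `]a, b[%R -> is_derive x 1 f (df x).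
  by rewrite in_itv /= => /andP[/ltW ax /ltW xb]; apply: Hx; rewrite ax.
have H2 : {in `[a, b]%R, forall x, derivable f x 1}.
  by move=> x; rewrite in_itv /= => /Hx [].
have [c cab E] := @MVT R f df a b ab H1 (derivable_within_continuous H2).
by exists c => //; move: cab; rewrite in_itv /= => /andP[/ltW -> /ltW ->].
Qed.

(** The endpoints come in either order because the increments to which this is applied have no
    definite sign; when they coincide, [c = a] works for any slope. *)
Lemma MVT_abs (f df : R -> R) (a b : R) :
  (forall x, `|x - a| <= `|b - a| -> is_derive x 1 f (df x)) ->
  exists2 c, `|c - a| <= `|b - a| & f b - f a = df c * (b - a).
Proof.
move=> H; have [ab|ba|ab] := ltgtP a b; last first.
- by exists a; rewrite ab !subrr ?mulr0.
- have Hx x : b <= x <= a -> `|x - a| <= `|b - a|.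
    by case/andP=> bx xa; rewrite !ler0_norm ?subr_le0 ?lerN2 ?lerB // (le_trans bx).
  have [c cab E] := MVT_itv ba (fun x h => H x (Hx x h)).
  exists c; first exact: Hx.
  by rewrite -opprB E -mulrN opprB.
- have Hx x : a <= x <= b -> `|x - a| <= `|b - a|.
    by case/andP=> bx xa; rewrite !ger0_norm ?subr_ge0 ?lerB // (le_trans bx).
  have [c cab E] := MVT_itv ab (fun x h => H x (Hx x h)).
  by exists c => //; exact: Hx.
Qed.

Lemma is_derive_cvg (f : R -> R) (x l : R) : is_derive x 1 f l ->
  (fun h => h^-1 * (f (h + x) - f x)) @ 0^' --> l.
Proof.
move=> [df <-]; move: df; rewrite /derivable /derive.
set g := fun h => _; set g' := fun h => _.
have -> : g = g'.
  by apply/funext => h; rewrite /g /g' /= [_%:A]mulr1.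
by [].
Qed.

Lemma cvg_is_derive (f : R -> R) (x l : R) :
  (fun h => h^-1 * (f (h + x) - f x)) @ 0^' --> l -> is_derive x 1 f l.
Proof.
set g' := fun h => _ => Hc.
have E : (fun h => h^-1 *: ((f \o shift x) (h *: 1) - f x)) = g'.
  by apply/funext => h; rewrite /g' /= [_%:A]mulr1.
apply: DeriveDef; first by rewrite /derivable E; apply/cvg_ex; exists l.
by rewrite /derive E; apply/cvg_lim.
Qed.

Lemma is_derive_comp1 (f g : R -> R) (x df dg : R) :
  is_derive (g x) 1 f df -> is_derive x 1 g dg ->
  is_derive x 1 (f \o g) (df * dg).
Proof.
move=> [fd fe] [gd ge]; apply: DeriveDef.
  have Dg : differentiable g x by apply/derivable1_diffP; exact: gd.
  have Df : differentiable f (g x) by apply/derivable1_diffP; exact: fd.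
  by apply/derivable1_diffP; exact: (differentiable_comp Dg Df).
by rewrite -derive1E (derive1_comp gd fd) !derive1E fe ge.
Qed.

(** The increment is split at [G (x t0) (y t)]. The part in the first variable goes through the mean
    value theorem, hence asks for [G1] nearby and continuous at the point; the part in the second is
    a one-variable chain rule and asks only for a derivative at the point. *)
Lemma chain2 (G G1 : R -> R -> R) (g2 : R) (x y : R -> R) (x' y' t0 : R) :
  near2 (x t0) (y t0) (fun s t => is_derive s 1 (G^~ t) (G1 s t)) ->
  cts2 G1 (x t0) (y t0) ->
  is_derive (y t0) 1 (G (x t0)) g2 ->
  is_derive t0 1 x x' -> is_derive t0 1 y y' ->
  is_derive t0 1 (fun t => G (x t) (y t)) (G1 (x t0) (y t0) * x' + g2 * y').
Proof.
move=> [r r0 H1] c1 H2 Hx Hy.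
have cx : {for t0, continuous x}.
  by apply: differentiable_continuous; apply/derivable1_diffP; case: Hx.
have cy : {for t0, continuous y}.
  by apply: differentiable_continuous; apply/derivable1_diffP; case: Hy.
have shc (z : R -> R) : {for t0, continuous z} -> forall e : R, 0 < e ->
    \forall h \near 0^', `|z (h + t0) - z t0| < e.
  move=> cz e e0; apply: nbhs_dnbhs.
  have : (fun h => z (h + t0)) @ (0 : R) --> z t0.
    have sh : (fun h : R => h + t0) @ (0 : R) --> 0 + t0.
      by apply: cvgD; [exact: cvg_id|exact: cvg_cst].
    rewrite add0r in sh; exact: (cvg_comp (fun h => h + t0) z sh cz).
  by move/cvgrPdist_lt/(_ e e0); apply: filterS => h; rewrite distrC.
have HG2 : is_derive t0 1 (fun t => G (x t0) (y t)) (g2 * y').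
  exact: is_derive_comp1.
apply: cvg_is_derive.
have -> : (fun h => h^-1 * (G (x (h + t0)) (y (h + t0)) - G (x t0) (y t0))) =
  (fun h => h^-1 * (G (x (h + t0)) (y (h + t0)) - G (x t0) (y (h + t0))) +
   h^-1 * (G (x t0) (y (h + t0)) - G (x t0) (y t0))).
  by apply/funext => h; rewrite -mulrDr addrA subrK.
apply: cvgD; last exact: (is_derive_cvg HG2).
have Hq := is_derive_cvg Hx.
(* [k] is the difference quotient in the first variable, given its limit as default value where the
   increment of [x] vanishes, so that the factorisation below holds for every h. *)
pose k h := if h == 0 then G1 (x t0) (y t0) else
  (if x (h + t0) == x t0 then G1 (x t0) (y t0) else
  (G (x (h + t0)) (y (h + t0)) - G (x t0) (y (h + t0))) / (x (h + t0) - x t0)).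
have -> : (fun h => h^-1 * (G (x (h + t0)) (y (h + t0)) - G (x t0) (y (h + t0)))) =
   (fun h => k h * (h^-1 * (x (h + t0) - x t0))).
  apply/funext => h; rewrite /k; case: (eqVneq h 0) => [->|h0].
    by rewrite invr0 !mul0r mulr0.
  case: eqVneq => [->|xh]; first by rewrite !subrr !mulr0.
  by rewrite mulrCA divfK // subr_eq0.
apply: cvgM => //.
apply/cvgrPdist_lt => e e0; have [d d0 Hd] := c1 e e0.
near=> h.
rewrite distrC /k; case: ifP => [_|_]; first by rewrite subrr normr0.
case: ifP => [_|/negbT xh]; first by rewrite subrr normr0.
have [|c cx' /= ->] := @MVT_abs (G^~ (y (h + t0))) (G1^~ (y (h + t0))) (x t0) (x (h + t0)).
- move=> z Hz; apply: H1.
    by apply: (le_lt_trans Hz); near: h; apply: shc.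
  by near: h; apply: shc.
rewrite mulfK ?subr_eq0 //; apply: Hd.
  by apply: (le_lt_trans cx'); near: h; apply: shc.
by near: h; apply: shc.
Unshelve. all: by end_near.
Qed.

(** The mean value theorem is used twice: for the function [G s (y + h) - G s y] of s, then for
    [G1 c] in the second variable. *)
Lemma mixed_difference (G G1 G12 : R -> R -> R) (x y r h : R) :
  0 < h -> h < r ->
  (forall s t, `|s - x| < r -> `|t - y| < r ->
     is_derive s 1 (G^~ t) (G1 s t) /\ is_derive t 1 (G1 s) (G12 s t)) ->
  exists c d, [/\ `|c - x| <= h, `|d - y| <= h &
    G (x + h) (y + h) - G (x + h) y - G x (y + h) + G x y = G12 c d * h ^+ 2].
Proof.
move=> h0 hr H.
have nh : `|h| = h by rewrite ger0_norm // ltW.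
have r0 : 0 < r by apply: lt_trans hr.
have Hh z : `|z + h - z| = h by rewrite addrAC subrr add0r.
have [c Hc E1] : exists2 c, `|c - x| <= `|x + h - x| &
   (G (x + h) (y + h) - G (x + h) y) - (G x (y + h) - G x y)
   = (G1 c (y + h) - G1 c y) * (x + h - x).
  apply: (@MVT_abs (fun s => G s (y + h) - G s y) (fun s => G1 s (y + h) - G1 s y)).
  move=> z; rewrite Hh => zh; have zr := le_lt_trans zh hr.
  have [D1 _] := H z (y + h) zr ltac:(by rewrite Hh).
  have [D2 _] := H z y zr ltac:(by rewrite subrr normr0).
  exact: (is_deriveB D1 D2).
rewrite Hh in Hc.
have [d Hd E2] : exists2 d, `|d - y| <= `|y + h - y| &
   G1 c (y + h) - G1 c y = G12 c d * (y + h - y).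
  apply: MVT_abs => z; rewrite Hh => zh.
  by case: (H c z (le_lt_trans Hc hr) (le_lt_trans zh hr)).
rewrite Hh in Hd; exists c, d; split => //.
move: E1; rewrite E2 !(addrAC _ h) !subrr !add0r -mulrA -expr2 => <-.
by rewrite opprB addrA addrAC.
Qed.

(** The second difference is symmetric in the two variables, so a value of [G12] equals a value of
    [G21] at points as close to (x, y) as desired; continuity at (x, y) concludes. *)
Lemma mixed_partials (G G1 G2 G12 G21 : R -> R -> R) (x y : R) :
  near2 x y (fun s t =>
     is_derive s 1 (G^~ t) (G1 s t) /\ is_derive t 1 (G1 s) (G12 s t)) ->
  near2 x y (fun s t =>
     is_derive t 1 (G s) (G2 s t) /\ is_derive s 1 (G2^~ t) (G21 s t)) ->
  cts2 G12 x y -> cts2 G21 x y -> G12 x y = G21 x y.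
Proof.
move=> [r1 r10 H1] [r2 r20 H2] c12 c21.
apply/eqP; rewrite -subr_eq0 -normr_le0; apply/ler_addgt0Pl => e e0.
have e20 : 0 < e / 2 by rewrite divr_gt0.
have [d1 d10 Hd1] := c12 _ e20; have [d2 d20 Hd2] := c21 _ e20.
pose m := Num.min (Num.min r1 r2) (Num.min d1 d2).
have m0 : 0 < m by rewrite !lt_min r10 r20 d10 d20.
have h0 : 0 < m / 2 by rewrite divr_gt0.
have hm : m / 2 < m by rewrite ltr_pdivrMr // ltr_pMr // ltrDl.
have [hr1 hr2 hd1 hd2] : [/\ m / 2 < r1, m / 2 < r2, m / 2 < d1 & m / 2 < d2].
  have : m <= m by [].
  rewrite {2}/m !le_min => /andP[/andP[? ?] /andP[? ?]].
  by split; apply: (lt_le_trans hm).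
have [c [d [Hc Hd E1]]] := mixed_difference h0 hr1 H1.
have [d' [c' [Hd' Hc' E2]]] : exists d' c', [/\ `|d' - y| <= m / 2, `|c' - x| <= m / 2 &
   G (x + m / 2) (y + m / 2) - G x (y + m / 2) - G (x + m / 2) y + G x y =
   G21 c' d' * (m / 2) ^+ 2].
  apply: (@mixed_difference (fun t s => G s t) (fun t s => G2 s t)
     (fun t s => G21 s t) y x r2 (m / 2) h0 hr2) => s t Hs Ht.
  exact: H2.
have EE : G12 c d = G21 c' d'.
  apply: (mulIf (lt0r_neq0 (exprn_gt0 2 h0))).
  by rewrite -E1 -E2 [X in X + _ = _]addrAC.
have -> : G12 x y - G21 x y = (G21 c' d' - G21 x y) - (G12 c d - G12 x y).
  by rewrite EE; ring.
rewrite (le_trans (ler_normB _ _)) // addr0 [e]splitr lerD //; apply/ltW.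
  apply: Hd2; [exact: (le_lt_trans Hc')|exact: (le_lt_trans Hd')].
apply: Hd1; [exact: (le_lt_trans Hc)|exact: (le_lt_trans Hd)].
Qed.

End TwoVariables.

(** * Smooth functions on open subsets of a subspace *)

Section ComplexDerivative.
Variable R : realType.
Local Notation C := R[i].

Lemma cReD (x y : C) : complex.Re (x + y) = complex.Re x + complex.Re y.
Proof. by case: x y => [? ?] [? ?]. Qed.
Lemma cImD (x y : C) : complex.Im (x + y) = complex.Im x + complex.Im y.
Proof. by case: x y => [? ?] [? ?]. Qed.
Lemma cReM (x y : C) :
  complex.Re (x * y) = complex.Re x * complex.Re y - complex.Im x * complex.Im y.
Proof. by case: x y => [? ?] [? ?]. Qed.
Lemma cImM (x y : C) :
  complex.Im (x * y) = complex.Re x * complex.Im y + complex.Im x * complex.Re y.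
Proof. by case: x y => [? ?] [? ?]. Qed.
Lemma complex_eqP (x y : C) :
  complex.Re x = complex.Re y -> complex.Im x = complex.Im y -> x = y.
Proof. by case: x y => [? ?] [? ?] /= -> ->. Qed.

Section Generic.
Variable W : normedModType R.
Implicit Types (f g : W -> C) (X v : W) (l m : C).

Definition is_cder f X v l :=
  is_derive X v (fun Y => complex.Re (f Y)) (complex.Re l) /\
  is_derive X v (fun Y => complex.Im (f Y)) (complex.Im l).

Lemma cder_cst c X v : is_cder (fun=> c) X v 0.
Proof. by split; exact: is_derive_cst. Qed.

Lemma cderD f g X v l m : is_cder f X v l -> is_cder g X v m ->
  is_cder (fun Y => f Y + g Y) X v (l + m).
Proof.
move=> [f1 f2] [g1 g2]; split.
  rewrite cReD (_ : (fun Y => _) = (fun Y => complex.Re (f Y)) + (fun Y => complex.Re (g Y))).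
    exact: is_deriveD.
  by apply/funext => Y; rewrite cReD.
rewrite cImD (_ : (fun Y => _) = (fun Y => complex.Im (f Y)) + (fun Y => complex.Im (g Y))).
  exact: is_deriveD.
by apply/funext => Y; rewrite cImD.
Qed.

Lemma cderM f g X v l m : is_cder f X v l -> is_cder g X v m ->
  is_cder (fun Y => f Y * g Y) X v (l * g X + f X * m).
Proof.
move=> [f1 f2] [g1 g2]; split.
  rewrite (_ : (fun Y => _) = (fun Y => complex.Re (f Y)) * (fun Y => complex.Re (g Y))
     - (fun Y => complex.Im (f Y)) * (fun Y => complex.Im (g Y))).
    apply: is_derive_eq (is_deriveB (is_deriveM f1 g1) (is_deriveM f2 g2)) _.
    by rewrite cReD !cReM /GRing.scale /=; ring.
  by apply/funext => Y; rewrite cReM.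
rewrite (_ : (fun Y => _) = (fun Y => complex.Re (f Y)) * (fun Y => complex.Im (g Y))
     + (fun Y => complex.Im (f Y)) * (fun Y => complex.Re (g Y))).
  apply: is_derive_eq (is_deriveD (is_deriveM f1 g2) (is_deriveM f2 g1)) _.
  by rewrite cImD !cImM /GRing.scale /=; ring.
by apply/funext => Y; rewrite cImM.
Qed.

Lemma cderZ c f X v l : is_cder f X v l -> is_cder (fun Y => c * f Y) X v (c * l).
Proof. by move=> /(cderM (cder_cst c X v)); rewrite mul0r add0r. Qed.

Lemma cderB f g X v l m : is_cder f X v l -> is_cder g X v m ->
  is_cder (fun Y => f Y - g Y) X v (l - m).
Proof.
move=> hf hg; have := cderD hf (cderZ (-1) hg).
by rewrite mulN1r; under eq_fun do rewrite mulN1r.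
Qed.

Lemma cder_eq f X v l m : is_cder f X v l -> l = m -> is_cder f X v m.
Proof. by move=> h <-. Qed.

Lemma cder_real (g : W -> R) X v (l : R) : is_derive X v g l ->
  is_cder (fun Y => (g Y)%:C%C) X v l%:C%C.
Proof. by move=> h; split => //=; exact: is_derive_cst. Qed.

Lemma cder_conj f X v l : is_cder f X v l ->
  is_cder (fun Y => (f Y)^*%C) X v l^*%C.
Proof.
move=> [f1 f2]; split; first by case: l f1 f2 => a b /= f1 f2;
  rewrite (_ : (fun Y => _) = (fun Y => complex.Re (f Y))) //; apply/funext => Y; case: (f Y).
rewrite (_ : (fun Y => _) = - (fun Y => complex.Im (f Y))).
  by apply: is_derive_eq (is_deriveN f2) _; case: l {f1 f2}.
by apply/funext => Y; rewrite [RHS]/GRing.opp /=; case: (f Y).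
Qed.

(** The inverse is the conjugate of f divided by the real function [N], the squared modulus, so only
    a real inverse is differentiated; the conjugate of l cancels at the end. *)
Lemma cderV f X v l : f X != 0 -> is_cder f X v l ->
  is_cder (fun Y => (f Y)^-1) X v (- l * (f X)^-1 * (f X)^-1).
Proof.
move=> fX0 hf.
pose N Y : R := complex.Re (f Y) ^+ 2 + complex.Im (f Y) ^+ 2.
have NE Y : (N Y)%:C%C = f Y * (f Y)^*%C.
  rewrite /N; case: (f Y) => a b /=; apply: complex_eqP; rewrite ?cReM ?cImM /=; ring.
have NX0 : N X != 0.
  apply: contra fX0 => /eqP N0; have := NE X; rewrite N0 => /esym/eqP.
  by rewrite mulf_eq0 conjc_eq0 orbb.
have [f1 f2] := hf.
have dN : is_derive X v N (2 * (complex.Re (f X) * complex.Re l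
   + complex.Im (f X) * complex.Im l)).
  rewrite (_ : N = (fun Y => complex.Re (f Y)) * (fun Y => complex.Re (f Y))
     + (fun Y => complex.Im (f Y)) * (fun Y => complex.Im (f Y))).
    apply: is_derive_eq (is_deriveD (is_deriveM f1 f1) (is_deriveM f2 f2)) _.
    by rewrite /GRing.scale /=; ring.
  by apply/funext => Y; rewrite /N !expr2.
have dV : is_derive X v (fun Y => (N Y)^-1) (- (N X) ^- 2 *
   (2 * (complex.Re (f X) * complex.Re l + complex.Im (f X) * complex.Im l))).
  have [d1 d2] := dN; apply: DeriveDef; first exact: derivableV.
  by rewrite deriveV // d2.
have E : (fun Y => (f Y)^-1) = (fun Y => (f Y)^*%C * ((N Y)^-1)%:C%C).
  apply/funext => Y; have [f0|f0] := eqVneq (f Y) 0.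
    by rewrite f0 invr0 rmorph0 mul0r.
  by rewrite fmorphV /= NE invfM mulrCA mulfV ?mulr1 // conjc_eq0.
rewrite E; have := cderM (cder_conj hf) (cder_real dV).
congr (is_cder _ _ _ _).
have -> : (- (N X) ^- 2 * (2 * (complex.Re (f X) * complex.Re l
   + complex.Im (f X) * complex.Im l)))%:C%C =
   - (l * (f X)^*%C + f X * l^*%C) / (f X * (f X)^*%C) ^+ 2.
  rewrite rmorphM rmorphN fmorphV rmorphXn /= NE mulNr mulrC -mulNr; congr (- _ / _).
  by case: (f X) l {f1 f2 dN dV hf} => a b [c d];
     apply: complex_eqP; rewrite ?cReD ?cImD ?cReM ?cImM /=; ring.
rewrite fmorphV /= NE; have : (f X)^*%C != 0 by rewrite conjc_eq0.
by move: (f X)^*%C (l^*%C) => fc lc fc0; field; rewrite fX0 fc0.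
Qed.

(** A directional derivative sees only the values on one line. This is what allows functions that
    are meaningful only on a subspace to be differentiated as functions on all matrices. *)
Lemma cder_line f X v l :
  is_cder f X v l <-> is_derive (0 : R) 1 (fun t : R => complex.Re (f (t *: v + X))) (complex.Re l)
   /\ is_derive (0 : R) 1 (fun t : R => complex.Im (f (t *: v + X))) (complex.Im l).
Proof.
have line (g : W -> R) (m : R) :
    is_derive X v g m <-> is_derive (0 : R) 1 (fun t : R => g (t *: v + X)) m.
  have D : 'D_v g X = 'D_1 (fun t : R => g (t *: v + X)) 0.
    rewrite /derive; set g1 := fun h => h^-1 *: _; set g2 := fun h => h^-1 *: _.
    suff -> : g1 = g2 by [].
    by rewrite funeqE /g1 /g2 => h /=; rewrite addr0 scale0r add0r [_%:A]mulr1.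
  have P := derivable1P g X v.
  split=> -[d e]; split; [exact: (P.1 d)|by rewrite -D|exact: (P.2 d)|by rewrite D].
split=> -[h1 h2]; split.
- exact: ((line _ _).1 h1).
- exact: ((line _ _).1 h2).
- exact: ((line _ _).2 h1).
- exact: ((line _ _).2 h2).
Qed.

Lemma cder_ext f g X v l :
  (\forall t \near (0 : R), f (t *: v + X) = g (t *: v + X)) ->
  is_cder f X v l -> is_cder g X v l.
Proof.
move=> fg /cder_line[h1 h2]; apply/cder_line; split.
  by apply: near_eq_is_derive h1; apply: filterS fg => t ->.
by apply: near_eq_is_derive h2; apply: filterS fg => t ->.
Qed.

Lemma is_derive_uniq (g : W -> R) X v (a b : R) :
  is_derive X v g a -> is_derive X v g b -> a = b.
Proof. by move=> [_ <-] [_ <-]. Qed.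

Lemma cder_uniq f X v l m : is_cder f X v l -> is_cder f X v m -> l = m.
Proof. by move=> [a b] [c d]; apply: complex_eqP; apply: is_derive_uniq. Qed.

End Generic.
End ComplexDerivative.

Section Planes.
Variables (R : realType) (W : normedModType R).
Implicit Types (E Omega : set W) (X v w B : W).

Definition linear_set E := forall (c : R) u v, E u -> E v -> E (c *: u + v).

Definition plane_open E Omega :=
  linear_set E /\ exists2 U, open U & Omega = E `&` U.

Lemma near2_nbhs (N : set W) (x y : R) v w B :
  nbhs (x *: v + y *: w + B) N -> near2 x y (fun s t => N (s *: v + t *: w + B)).
Proof.
move=> /nbhs_ballP[e /= e0 Ne].
(* The summand 1 keeps [M] positive when both directions vanish. *)
pose M := `|v| + `|w| + 1.
have M0 : 0 < M by rewrite ltr_pwDr // addr_ge0.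
exists (e / M) => [|s t hs ht]; first exact: divr_gt0.
apply: Ne; rewrite -ball_normE /= opprD addrACA subrr addr0 opprD addrACA -!scalerBl.
rewrite (le_lt_trans (ler_normD _ _)) // !normrZ distrC [`|y - t|]distrC.
apply: (@le_lt_trans _ _ (e / M * `|v| + e / M * `|w|)).
  by apply: lerD; apply: ler_wpM2r => //; exact: ltW.
rewrite -mulrDr mulrAC ltr_pdivrMr // ltr_pM2l // /M.
by rewrite ltrDl.
Qed.

Lemma near2_plane E Omega (x y : R) v w B : plane_open E Omega -> E v -> E w ->
  Omega (x *: v + y *: w + B) -> near2 x y (fun s t => Omega (s *: v + t *: w + B)).
Proof.
move=> [linE [U oU ->]] Ev Ew [EX UX].
have [r r0 H] := near2_nbhs (open_nbhs_nbhs (conj oU UX)).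
exists r => // s t hs ht; split; last exact: H.
have -> : s *: v + t *: w + B = (s - x) *: v + ((t - y) *: w + (x *: v + y *: w + B)).
  by rewrite !scalerBl addrA [X in _ = X + _]addrACA -opprD addrA addrNK.
exact: (linE _ _ _ Ev (linE _ _ _ Ew EX)).
Qed.

Lemma near_line E Omega X v : plane_open E Omega -> E v -> Omega X ->
  \forall t \near (0 : R), Omega (t *: v + X).
Proof.
move=> po Ev OX; have /(near2_plane po Ev Ev)[r r0 H] :
    Omega ((0 : R) *: v + (0 : R) *: v + X) by rewrite !scale0r !add0r.
have : nbhs (0 : R) (ball (0 : R) r) by apply: nbhsx_ballx.
apply: filterS => t; rewrite -ball_normE /= sub0r normrN => tr.
by have := H t 0; rewrite !subr0 normr0 scale0r addr0; apply.
Qed.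

Lemma within_eps (Omega : set W) (g : W -> R) X e : {within Omega, continuous g} ->
  Omega X -> 0 < e -> nbhs X (fun Y => Omega Y -> `|g Y - g X| < e).
Proof.
move=> cg OX e0; have := cg X; rewrite /= => /cvgrPdist_lt/(_ e e0).
move=> h; have : within Omega (nbhs X) (fun Y => `|g X - g Y| < e).
  by rewrite (nbhs_subspace_in OX); exact: h.
by rewrite /within; apply: (@filterS _ (nbhs X)) => Y; rewrite distrC.
Qed.

Lemma is_derive_line (g : W -> R) (s l : R) v B : is_derive (s *: v + B) v g l ->
  is_derive s 1 (fun u : R => g (u *: v + B)) l.
Proof.
have P : (fun h : R => h^-1 *: (((fun u : R => g (u *: v + B)) \o shift s) (h *: 1)
   - g (s *: v + B))) = (fun h => h^-1 *: ((g \o shift (s *: v + B)) (h *: v) - g (s *: v + B))).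
  by apply/funext => h /=; rewrite [_%:A]mulr1 scalerDl addrA.
move=> [d e]; split; first by rewrite /derivable P.
by rewrite /derive P.
Qed.

End Planes.

Section SmoothFunctions.
Variable R : realType.
Local Notation C := R[i].
Local Notation V := 'M[R]_(2 + 2).
Implicit Types (f g : V -> C) (X v w B : V) (E Omega : set V).

Lemma cder_dder f X v l : is_cder f X v l -> dder v f X = l.
Proof. by move=> [[_ h1] [_ h2]]; rewrite /dder h1 h2; case: l {h1 h2}. Qed.

Lemma smooth_cder E Omega f X v : smooth_on E Omega f -> E v -> Omega X ->
  is_cder f X v (dder v f X).
Proof.
move=> /(_ [::]) /= []// _ _ h Ev OX; have [h1 h2] := h X v OX Ev.
by split; [exact: (derivableP h1)|exact: (derivableP h2)].
Qed.

Lemma smooth_dder E Omega f v : smooth_on E Omega f -> E v ->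
  smooth_on E Omega (dder v f).
Proof.
move=> sf Ev vs Evs /=.
have -> : iter_dder vs (dder v f) = iter_dder (rcons vs v) f.
  by rewrite /iter_dder foldr_rcons.
by apply: sf => u; rewrite mem_rcons inE => /orP[/eqP ->|/Evs].
Qed.

Lemma smooth_iter E Omega f vs : smooth_on E Omega f ->
  (forall v, v \in vs -> E v) -> smooth_on E Omega (iter_dder vs f).
Proof.
move=> sf; elim: vs => [_|v vs IH Evs]; first exact: sf.
apply: (@smooth_dder _ _ (iter_dder vs f) v); last by apply: Evs; rewrite mem_head.
by apply: IH => u uvs; apply: Evs; rewrite inE uvs orbT.
Qed.

Lemma smooth_sub E Omega E' Omega' f : E' `<=` E -> Omega' `<=` Omega ->
  smooth_on E Omega f -> smooth_on E' Omega' f.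
Proof.
move=> sE sO sf vs Evs /=; have [c1 c2 d] := sf vs (fun v h => sE _ (Evs v h)).
split; [exact: continuous_subspaceW c1|exact: continuous_subspaceW c2|].
by move=> X v OX Ev; apply: d; [apply: sO|apply: sE].
Qed.

Lemma smooth_eps E Omega f X e : smooth_on E Omega f -> Omega X -> 0 < e ->
  nbhs X (fun Y => Omega Y -> `|complex.Re (f Y) - complex.Re (f X)| < e
                       /\ `|complex.Im (f Y) - complex.Im (f X)| < e).
Proof.
move=> /(_ [::]) /= []// c1 c2 _ OX e0.
apply: filterS2 (within_eps c1 OX e0) (within_eps c2 OX e0) => Y h1 h2 OY.
by split; [exact: h1|exact: h2].
Qed.

(** Chain rule along a curve in the affine plane through B spanned by v and w: [chain2] for the real
    and the imaginary part. It yields both linearity in the direction and differentiation along the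
    slice. *)
Lemma cder_plane E Omega f v w B (x y : R -> R) (x' y' t0 : R) :
  plane_open E Omega -> smooth_on E Omega f -> E v -> E w ->
  Omega (x t0 *: v + y t0 *: w + B) ->
  is_derive t0 1 x x' -> is_derive t0 1 y y' ->
  is_cder (fun t : R => f (x t *: v + y t *: w + B)) t0 1
    (dder v f (x t0 *: v + y t0 *: w + B) * x'%:C%C +
     dder w f (x t0 *: v + y t0 *: w + B) * y'%:C%C).
Proof.
move=> po sf Ev Ew OX hx hy.
have [r r0 Hr] := near2_plane po Ev Ew OX.
have D1 s t : `|s - x t0| < r -> `|t - y t0| < r ->
    is_cder f (s *: v + t *: w + B) v (dder v f (s *: v + t *: w + B)).
  by move=> hs ht; apply: (smooth_cder sf Ev); exact: Hr.
have D2 : is_cder f (x t0 *: v + y t0 *: w + B) w (dder w f (x t0 *: v + y t0 *: w + B)).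
  exact: (smooth_cder sf Ew).
have reorder s t : s *: v + t *: w + B = t *: w + (s *: v + B).
  by rewrite addrAC addrC.
have ctsd e : 0 < e -> near2 (x t0) (y t0) (fun s t =>
    `|complex.Re (dder v f (s *: v + t *: w + B)) - complex.Re (dder v f (x t0 *: v + y t0 *: w + B))| < e
    /\ `|complex.Im (dder v f (s *: v + t *: w + B)) - complex.Im (dder v f (x t0 *: v + y t0 *: w + B))| < e).
  move=> e0; have [q q0 Hq] := near2_nbhs (smooth_eps (smooth_dder sf Ev) OX e0).
  exists (Num.min q r) => [|s t]; first by rewrite lt_min q0.
  by rewrite !lt_min => /andP[sq sr] /andP[tq tr]; apply: Hq => //; apply: Hr.
split.
- rewrite cReD !cReM /= !mulr0 !subr0.
  apply: (@chain2 _ (fun s t => complex.Re (f (s *: v + t *: w + B)))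
     (fun s t => complex.Re (dder v f (s *: v + t *: w + B)))) => //.
  + exists r => // s t hs ht; have [h _] := D1 s t hs ht.
    rewrite -addrA in h; have := is_derive_line h.
    by under eq_fun do rewrite addrA; rewrite addrA.
  + by move=> e /ctsd[q q0 Hq]; exists q => // s t hs ht; case: (Hq s t hs ht).
  + have [h _] := D2; rewrite {1}reorder in h; have := is_derive_line h.
    by under eq_fun do rewrite -reorder.
- rewrite cImD !cImM /= !mulr0 !add0r.
  apply: (@chain2 _ (fun s t => complex.Im (f (s *: v + t *: w + B)))
     (fun s t => complex.Im (dder v f (s *: v + t *: w + B)))) => //.
  + exists r => // s t hs ht; have [_ h] := D1 s t hs ht.
    rewrite -addrA in h; have := is_derive_line h.
    by under eq_fun do rewrite addrA; rewrite addrA.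
  + by move=> e /ctsd[q q0 Hq]; exists q => // s t hs ht; case: (Hq s t hs ht).
  + have [_ h] := D2; rewrite {1}reorder in h; have := is_derive_line h.
    by under eq_fun do rewrite -reorder.
Qed.

End SmoothFunctions.

(** * Linearity and commutation of derivatives, locality, a coinduction principle for smoothness *)

Section SmoothClosure.
Variable R : realType.
Local Notation C := R[i].
Local Notation V := 'M[R]_(2 + 2).
Variables (E Omega : set V).
Hypothesis po : plane_open E Omega.
Implicit Types (f g : V -> C) (X v w : V).

Lemma is_derive_affine (a b t : R) : is_derive t 1 (fun u : R => u * a + b) a.
Proof.
have H : is_derive t 1 ((@id R) * cst a + cst b) a.
  apply: is_derive_eq (is_deriveD (is_deriveM (is_derive_id t 1)
    (is_derive_cst a t 1)) (is_derive_cst b t 1)) _.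
  by rewrite /GRing.scale /=; ring.
exact: H.
Qed.

(** Directional derivatives need not be linear in the direction in general; here continuity of the
    derivatives makes [cder_plane] available on the line with direction a v + b w. *)
Lemma dder_lin f X v w (a b : R) : smooth_on E Omega f -> E v -> E w -> Omega X ->
  dder (a *: v + b *: w) f X = dder v f X * a%:C%C + dder w f X * b%:C%C.
Proof.
move=> sf Ev Ew OX; apply: cder_dder; apply/cder_line.
have := @cder_plane _ _ _ f v w X (fun t => t * a + 0) (fun t => t * b + 0) a b 0 po sf Ev Ew.
rewrite !mul0r !addr0 !scale0r !add0r => /(_ OX (is_derive_affine _ _ _) (is_derive_affine _ _ _)).
rewrite /is_cder.
have P t : (t * a + 0) *: v + (t * b + 0) *: w + X = t *: (a *: v + b *: w) + X.
  by rewrite !addr0 scalerDr !scalerA.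
by under eq_fun do rewrite P; under [X in _ /\ is_derive _ _ X _]eq_fun do rewrite P.
Qed.

(** This is [mixed_partials] at (0, 0) for the restriction of f to the plane through X, separately
    for real and imaginary parts. *)
Lemma dderC f X v w : smooth_on E Omega f -> E v -> E w -> Omega X ->
  dder v (dder w f) X = dder w (dder v f) X.
Proof.
move=> sf Ev Ew OX.
have OX0 : Omega ((0 : R) *: v + (0 : R) *: w + X) by rewrite !scale0r !add0r.
have [r r0 Hr] := near2_plane po Ev Ew OX0.
have reorder s t : s *: v + t *: w + X = t *: w + (s *: v + X).
  by rewrite addrAC addrC.
have dv g (s t : R) : smooth_on E Omega g -> `|s - 0| < r -> `|t - 0| < r ->
   is_derive s 1 (fun s => complex.Re (g (s *: v + t *: w + X)))
       (complex.Re (dder v g (s *: v + t *: w + X))) /\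
   is_derive s 1 (fun s => complex.Im (g (s *: v + t *: w + X)))
       (complex.Im (dder v g (s *: v + t *: w + X))).
  move=> sg hs ht; have [h1 h2] := smooth_cder sg Ev (Hr s t hs ht).
  rewrite -addrA in h1 h2; have := conj (is_derive_line h1) (is_derive_line h2).
  by under eq_fun do rewrite addrA;
     under [X in _ /\ is_derive _ _ X _]eq_fun do rewrite addrA; rewrite addrA.
have dw g (s t : R) : smooth_on E Omega g -> `|s - 0| < r -> `|t - 0| < r ->
   is_derive t 1 (fun t => complex.Re (g (s *: v + t *: w + X)))
       (complex.Re (dder w g (s *: v + t *: w + X))) /\
   is_derive t 1 (fun t => complex.Im (g (s *: v + t *: w + X)))
       (complex.Im (dder w g (s *: v + t *: w + X))).
  move=> sg hs ht; have [h1 h2] := smooth_cder sg Ew (Hr s t hs ht).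
  rewrite reorder in h1 h2; have := conj (is_derive_line h1) (is_derive_line h2).
  by under eq_fun do rewrite -reorder;
     under [X in _ /\ is_derive _ _ X _]eq_fun do rewrite -reorder; rewrite -reorder.
have cts g : smooth_on E Omega g ->
   cts2 (fun s t => complex.Re (g (s *: v + t *: w + X))) 0 0 /\
   cts2 (fun s t => complex.Im (g (s *: v + t *: w + X))) 0 0.
  move=> sg; have aux e : 0 < e -> near2 0 0 (fun s t =>
     `|complex.Re (g (s *: v + t *: w + X)) - complex.Re (g ((0 : R) *: v + (0 : R) *: w + X))| < e /\
     `|complex.Im (g (s *: v + t *: w + X)) - complex.Im (g ((0 : R) *: v + (0 : R) *: w + X))| < e).
    move=> e0; have [q q0 Hq] := near2_nbhs (smooth_eps sg OX0 e0).
    exists (Num.min q r) => [|s t]; first by rewrite lt_min q0.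
    by rewrite !lt_min => /andP[sq sr] /andP[tq tr]; apply: Hq => //; apply: Hr.
  by split=> e /aux[q q0 Hq]; exists q => // s t hs ht; case: (Hq s t hs ht).
have svf := smooth_dder sf Ev; have swf := smooth_dder sf Ew.
have [c1 c2] := cts _ (smooth_dder svf Ew).
have [c3 c4] := cts _ (smooth_dder swf Ev).
have X0 : (0 : R) *: v + (0 : R) *: w + X = X by rewrite !scale0r !add0r.
apply: complex_eqP.
- have N1 : near2 0 0 (fun s t =>
     is_derive s 1 (fun s => complex.Re (f (s *: v + t *: w + X))) (complex.Re (dder v f (s *: v + t *: w + X)))
     /\ is_derive t 1 (fun t => complex.Re (dder v f (s *: v + t *: w + X)))
         (complex.Re (dder w (dder v f) (s *: v + t *: w + X)))).
    exists r; [exact: r0|move=> s t hs ht]; have [h _] := dv f s t sf hs ht; split; first exact: h.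
    by move=> {h}; have [h _] := dw (dder v f) s t svf hs ht; exact: h.
  have N2 : near2 0 0 (fun s t =>
     is_derive t 1 (fun t => complex.Re (f (s *: v + t *: w + X))) (complex.Re (dder w f (s *: v + t *: w + X)))
     /\ is_derive s 1 (fun s => complex.Re (dder w f (s *: v + t *: w + X)))
         (complex.Re (dder v (dder w f) (s *: v + t *: w + X)))).
    exists r; [exact: r0|move=> s t hs ht]; have [h _] := dw f s t sf hs ht; split; first exact: h.
    by move=> {h}; have [h _] := dv (dder w f) s t swf hs ht; exact: h.
  have H := mixed_partials N1 N2 c1 c3.
  by cbv beta in H; rewrite X0 in H; exact: esym H.
- have N1 : near2 0 0 (fun s t =>
     is_derive s 1 (fun s => complex.Im (f (s *: v + t *: w + X))) (complex.Im (dder v f (s *: v + t *: w + X)))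
     /\ is_derive t 1 (fun t => complex.Im (dder v f (s *: v + t *: w + X)))
         (complex.Im (dder w (dder v f) (s *: v + t *: w + X)))).
    exists r; [exact: r0|move=> s t hs ht]; have [_ h] := dv f s t sf hs ht; split; first exact: h.
    by move=> {h}; have [_ h] := dw (dder v f) s t svf hs ht; exact: h.
  have N2 : near2 0 0 (fun s t =>
     is_derive t 1 (fun t => complex.Im (f (s *: v + t *: w + X))) (complex.Im (dder w f (s *: v + t *: w + X)))
     /\ is_derive s 1 (fun s => complex.Im (dder w f (s *: v + t *: w + X)))
         (complex.Im (dder v (dder w f) (s *: v + t *: w + X)))).
    exists r; [exact: r0|move=> s t hs ht]; have [_ h] := dw f s t sf hs ht; split; first exact: h.
    by move=> {h}; have [_ h] := dv (dder w f) s t swf hs ht; exact: h.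
  have H := mixed_partials N1 N2 c2 c4.
  by cbv beta in H; rewrite X0 in H; exact: esym H.
Qed.

Lemma cder_on f g X v l : (forall Y, Omega Y -> f Y = g Y) -> E v -> Omega X ->
  is_cder f X v l -> is_cder g X v l.
Proof.
move=> fg Ev OX; apply: cder_ext; apply: filterS (near_line po Ev OX) => t; exact: fg.
Qed.

Lemma dder_on f g X v : smooth_on E Omega f -> (forall Y, Omega Y -> f Y = g Y) ->
  E v -> Omega X -> dder v f X = dder v g X.
Proof.
by move=> sf fg Ev OX; rewrite (cder_dder (cder_on fg Ev OX (smooth_cder sf Ev OX))).
Qed.

Lemma iter_dder_on f g vs : smooth_on E Omega f -> (forall Y, Omega Y -> f Y = g Y) ->
  (forall v, v \in vs -> E v) ->
  forall X, Omega X -> iter_dder vs f X = iter_dder vs g X.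
Proof.
move=> sf fg; elim: vs => [_ X|v vs IH Evs X OX]; first exact: fg.
have Evs' u : u \in vs -> E u by move=> uvs; apply: Evs; rewrite inE uvs orbT.
apply: (dder_on (smooth_iter sf Evs') (IH Evs')) => //.
by apply: Evs; rewrite mem_head.
Qed.

Definition C1_on f :=
  [/\ {within Omega, continuous (fun X => complex.Re (f X))},
      {within Omega, continuous (fun X => complex.Im (f X))} &
      forall X v, Omega X -> E v -> is_cder f X v (dder v f X)].

Lemma smooth_C1 f : smooth_on E Omega f -> C1_on f.
Proof.
move=> sf; have [c1 c2 _] := sf [::] (fun v (h : v \in [::]) => False_ind _ (notF h)).
by split => // X v OX Ev; apply: (smooth_cder sf Ev OX).
Qed.

Lemma C1_eq f g : C1_on f -> (forall X, Omega X -> f X = g X) -> C1_on g.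
Proof.
move=> [c1 c2 d] fg; split.
- by apply: subspace_eq_continuous c1 => X; rewrite inE => OX; congr complex.Re; exact: fg.
- by apply: subspace_eq_continuous c2 => X; rewrite inE => OX; congr complex.Im; exact: fg.
- move=> X v OX Ev; have h := cder_on fg Ev OX (d X v OX Ev).
  by rewrite (cder_dder h).
Qed.

(** A class of C^1 functions that is stable under differentiation, up to equality on Omega, consists
    of smooth functions. Closure properties thus need only one derivative and no count of orders. *)
Lemma smooth_coind (P : (V -> C) -> Prop) :
  (forall f, P f -> C1_on f /\ (forall v, E v ->
     exists2 g, P g & forall X, Omega X -> dder v f X = g X)) ->
  forall f, P f -> smooth_on E Omega f.
Proof.
move=> HP f Pf vs Evs.
have [g Pg Hg] : exists2 g, P g & forall X, Omega X -> iter_dder vs f X = g X.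
  elim: vs Evs => [_|v vs IH Evs]; first by exists f.
  have [u uvs|g Pg Hg] := IH; first by apply: Evs; rewrite inE uvs orbT.
  have Ev : E v by apply: Evs; rewrite mem_head.
  have [cg /(_ v Ev)[g' Pg' Hg']] := HP g Pg.
  exists g' => // X OX /=; rewrite -Hg' //; apply: cder_dder.
  apply: (@cder_on g) => // [Y OY|]; first by rewrite Hg.
  by case: cg => _ _; apply.
have [c1 c2 d] := C1_eq (HP g Pg).1 (fun X OX => esym (Hg X OX)).
split => // X v OX Ev; have [[h1 _] [h2 _]] := d X v OX Ev.
by split; [exact: h1|exact: h2].
Qed.

Lemma smooth_ext f g : smooth_on E Omega f -> (forall X, Omega X -> f X = g X) ->
  smooth_on E Omega g.
Proof.
move=> sf fg; apply: (@smooth_coind (fun g =>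
  exists2 f, smooth_on E Omega f & forall X, Omega X -> f X = g X)); last by exists f.
move=> {f sf fg} {}g [f sf fg]; split; first exact: C1_eq (smooth_C1 sf) fg.
move=> v Ev; exists (dder v g) => //; exists (dder v f); first exact: smooth_dder.
by move=> X OX; apply: dder_on.
Qed.

End SmoothClosure.

(** * Smoothness of constants, coordinates, sums, products and inverses *)

Section SmoothAlgebra.
Variable R : realType.
Local Notation C := R[i].
Local Notation V := 'M[R]_(2 + 2).
Variables (E Omega : set V).
Hypothesis po : plane_open E Omega.
Implicit Types (f g : V -> C) (X v w : V).

(** Off Omega the subspace topology is discrete and nothing has to be checked; on Omega the filter
    is the trace of the neighbourhood filter, a form to which the limit rules apply directly. *)
Lemma within_continuousP (g : V -> R) :
  {within Omega, continuous g} <->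
  (forall X, Omega X -> g @ within Omega (nbhs X) --> g X).
Proof.
pose T (F : set_system V) X := fmap g F --> g X.
split=> [cg X OX|cg X].
  exact: (eq_ind_r (T^~ X) (cg X) (nbhs_subspace_in OX)).
have [OX|nOX] := pselect (Omega X).
  exact: (eq_ind _ (T^~ X) (cg X OX) _ (nbhs_subspace_in OX)).
suff h : T (globally [set X]) X by exact: (eq_ind _ (T^~ X) h _ (nbhs_subspace_out nOX)).
by move=> A hA Y /= ->; exact: nbhs_singleton hA.
Qed.

Lemma C1_add f g : C1_on E Omega f -> C1_on E Omega g ->
  C1_on E Omega (fun X => f X + g X).
Proof.
move=> [a b c] [a' b' c']; split.
- have -> : (fun X => complex.Re (f X + g X)) =
     (fun X => complex.Re (f X)) + (fun X => complex.Re (g X)).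
    by apply/funext => X; rewrite cReD.
  exact: within_continuousD.
- have -> : (fun X => complex.Im (f X + g X)) =
     (fun X => complex.Im (f X)) + (fun X => complex.Im (g X)).
    by apply/funext => X; rewrite cImD.
  exact: within_continuousD.
- move=> X v OX Ev; have h := cderD (c X v OX Ev) (c' X v OX Ev).
  by rewrite (cder_dder h).
Qed.

Lemma C1_mul f g : C1_on E Omega f -> C1_on E Omega g ->
  C1_on E Omega (fun X => f X * g X).
Proof.
move=> [/within_continuousP a /within_continuousP b c].
move=> [/within_continuousP a' /within_continuousP b' c']; split.
- apply/within_continuousP => X OX; rewrite cReM.
  under eq_fun do rewrite cReM.
  by apply: cvgB; apply: cvgM; [exact: a|exact: a'|exact: b|exact: b'].
- apply/within_continuousP => X OX; rewrite cImM.
  under eq_fun do rewrite cImM.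
  by apply: cvgD; apply: cvgM; [exact: a|exact: b'|exact: b|exact: a'].
- move=> X v OX Ev; have h := cderM (c X v OX Ev) (c' X v OX Ev).
  by rewrite (cder_dder h).
Qed.

Lemma ReV (x : C) : complex.Re x^-1 = complex.Re x / (complex.Re x ^+ 2 + complex.Im x ^+ 2).
Proof. by case: x. Qed.
Lemma ImV (x : C) : complex.Im x^-1 = - complex.Im x / (complex.Re x ^+ 2 + complex.Im x ^+ 2).
Proof. by case: x => a b; rewrite mulNr. Qed.

Lemma C1_inv f : C1_on E Omega f -> (forall X, Omega X -> f X != 0) ->
  C1_on E Omega (fun X => (f X)^-1).
Proof.
move=> [/within_continuousP a /within_continuousP b c] f0.
have N0 X : Omega X -> complex.Re (f X) ^+ 2 + complex.Im (f X) ^+ 2 != 0.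
  move=> /f0; apply: contra; rewrite paddr_eq0 ?sqr_ge0 // !sqrf_eq0.
  by case: (f X) => x y /= /andP[/eqP -> /eqP ->].
have cN X : Omega X -> (fun Y => complex.Re (f Y) ^+ 2 + complex.Im (f Y) ^+ 2)
    @ within Omega (nbhs X) --> complex.Re (f X) ^+ 2 + complex.Im (f X) ^+ 2.
  move=> OX; rewrite !expr2; under eq_fun do rewrite !expr2.
  by apply: cvgD; apply: cvgM; [exact: a|exact: a|exact: b|exact: b].
split.
- apply/within_continuousP => X OX; rewrite ReV; under eq_fun do rewrite ReV.
  by apply: cvgM; [exact: a|apply: cvgV; [exact: N0|exact: cN]].
- apply/within_continuousP => X OX; rewrite ImV; under eq_fun do rewrite ImV.
  by apply: cvgM; [apply: cvgN; exact: b|apply: cvgV; [exact: N0|exact: cN]].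
- move=> X v OX Ev; have h := cderV (f0 X OX) (c X v OX Ev).
  by rewrite (cder_dder h).
Qed.

Definition locally_constant f := forall X, Omega X ->
  nbhs X (fun Y => Omega Y -> f Y = f X).

Lemma cder_locally_constant f X v : locally_constant f -> Omega X -> E v ->
  is_cder f X v 0.
Proof.
move=> lf OX Ev; apply: (@cder_ext _ _ (fun=> f X) f X v 0 _ (cder_cst (f X) X v)).
have := @near2_nbhs _ _ _ 0 0 v 0 X; rewrite !scale0r !add0r => /(_ _ (lf X OX))[r r0 Hr].
have := near_line po Ev OX; apply: filterS2 (nbhsx_ballx (0 : R) _ r0) => t.
rewrite -ball_normE /= sub0r normrN => tr Ot; apply/esym.
by have := Hr t 0; rewrite !subr0 normr0 scaler0 addr0; apply.
Qed.

Lemma smooth_locally_constant f : locally_constant f -> smooth_on E Omega f.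
Proof.
move: f; apply: (@smooth_coind _ _ _ po locally_constant) => f lf; split; last first.
  move=> v Ev; exists (fun=> 0) => [X OX|X OX]; first by apply: filterE => Y.
  exact: cder_dder (cder_locally_constant lf OX Ev).
split; last 1 first.
- by move=> X v OX Ev; rewrite (cder_dder (cder_locally_constant lf OX Ev));
    exact: cder_locally_constant.
- apply/within_continuousP => X OX A /nbhs_singleton hA.
  by rewrite /within /=; apply: filterS (lf X OX) => Y h OY /=; rewrite h.
- apply/within_continuousP => X OX A /nbhs_singleton hA.
  by rewrite /within /=; apply: filterS (lf X OX) => Y h OY /=; rewrite h.
Qed.

Lemma smooth_cst c : smooth_on E Omega (fun=> c).
Proof. by apply: smooth_locally_constant => X _; apply: filterE => Y. Qed.

Lemma cder_entry i j X v : is_cder (fun Y : V => (Y i j)%:C%C) X v (v i j)%:C%C.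
Proof.
apply/cder_line; split; last exact: is_derive_cst.
have := is_derive_affine (v i j) (X i j) 0.
by congr (is_derive _ _ _ _); apply/funext => t; rewrite /= !mxE.
Qed.

Lemma smooth_entry i j : smooth_on E Omega (fun Y : V => (Y i j)%:C%C).
Proof.
pose P f := smooth_on E Omega f \/ f = fun Y : V => (Y i j)%:C%C.
apply: (@smooth_coind _ _ _ po P); last by right.
move=> f [sf|->]; split.
- exact: smooth_C1.
- by move=> v Ev; exists (dder v f) => //; left; exact: smooth_dder.
- split.
  + exact: (continuous_subspaceT (@coord_continuous _ _ _ i j)).
  + exact: (continuous_subspaceT (fun X => @cst_continuous _ _ (0 : R) X)).
  + by move=> X v _ _; rewrite (cder_dder (cder_entry i j X v)); exact: cder_entry.
- move=> v Ev; exists (fun=> (v i j)%:C%C); first by left; exact: smooth_cst.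
  by move=> X _; exact: cder_dder (cder_entry i j X v).
Qed.

(** The operations are closed off together because differentiation mixes them: a product produces a
    sum of products, an inverse a product of inverses. The whole class is then stable under
    derivation and [smooth_coind] applies to it at once. *)
Inductive smooth_alg : (V -> C) -> Prop :=
| sa_smooth f : smooth_on E Omega f -> smooth_alg f
| sa_add f g : smooth_alg f -> smooth_alg g -> smooth_alg (fun X => f X + g X)
| sa_mul f g : smooth_alg f -> smooth_alg g -> smooth_alg (fun X => f X * g X)
| sa_inv f : smooth_alg f -> (forall X, Omega X -> f X != 0) ->
    smooth_alg (fun X => (f X)^-1).

Lemma smooth_alg_smooth f : smooth_alg f -> smooth_on E Omega f.
Proof.
move: f; apply: (@smooth_coind _ _ _ po smooth_alg) => f; elim=> {f} [f sf|f g _ [cf df] _ [cg dg]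
  |f g saf [cf df] sag [cg dg]|f saf [cf df] f0].
- split; first exact: smooth_C1.
  by move=> v Ev; exists (dder v f) => //; apply: sa_smooth; exact: smooth_dder.
- split; first exact: C1_add.
  move=> v Ev; have [f' sf' Hf'] := df v Ev; have [g' sg' Hg'] := dg v Ev.
  exists (fun X => f' X + g' X); first exact: sa_add.
  move=> X OX; rewrite -Hf' // -Hg' //; apply: cder_dder.
  by case: cf cg => _ _ cf [_ _ cg]; exact: (cderD (cf X v OX Ev) (cg X v OX Ev)).
- split; first exact: C1_mul.
  move=> v Ev; have [f' sf' Hf'] := df v Ev; have [g' sg' Hg'] := dg v Ev.
  exists (fun X => f' X * g X + f X * g' X).
    by apply: sa_add; apply: sa_mul.
  move=> X OX; rewrite -Hf' // -Hg' //; apply: cder_dder.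
  by case: cf cg => _ _ cf [_ _ cg]; exact: (cderM (cf X v OX Ev) (cg X v OX Ev)).
- split; first exact: C1_inv.
  move=> v Ev; have [f' sf' Hf'] := df v Ev.
  exists (fun X => -1 * f' X * (f X)^-1 * (f X)^-1).
    apply: sa_mul; last exact: sa_inv.
    apply: sa_mul; last exact: sa_inv.
    by apply: sa_mul => //; apply: sa_smooth; exact: smooth_cst.
  move=> X OX; rewrite -Hf' // mulN1r; apply: cder_dder.
  by case: cf => _ _ cf; exact: (cderV (f0 X OX) (cf X v OX Ev)).
Qed.

Lemma smooth_add f g : smooth_on E Omega f -> smooth_on E Omega g ->
  smooth_on E Omega (fun X => f X + g X).
Proof. by move=> sf sg; apply: smooth_alg_smooth; apply: sa_add; apply: sa_smooth. Qed.

Lemma smooth_mul f g : smooth_on E Omega f -> smooth_on E Omega g ->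
  smooth_on E Omega (fun X => f X * g X).
Proof. by move=> sf sg; apply: smooth_alg_smooth; apply: sa_mul; apply: sa_smooth. Qed.

Lemma smooth_inv f : smooth_on E Omega f -> (forall X, Omega X -> f X != 0) ->
  smooth_on E Omega (fun X => (f X)^-1).
Proof. by move=> sf f0; apply: smooth_alg_smooth; apply: sa_inv => //; apply: sa_smooth. Qed.

Lemma smooth_sum (I : Type) (r : seq I) (F : I -> V -> C) :
  (forall i, smooth_on E Omega (F i)) -> smooth_on E Omega (fun X => \sum_(i <- r) F i X).
Proof.
move=> sF; elim: r => [|i r IH].
  by apply: smooth_ext (smooth_cst 0) _ => // X _; rewrite big_nil.
by apply: smooth_ext (smooth_add (sF i) IH) _ => // X _; rewrite big_cons.
Qed.

Lemma dder_add f g v X : smooth_on E Omega f -> smooth_on E Omega g -> E v -> Omega X ->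
  dder v (fun X => f X + g X) X = dder v f X + dder v g X.
Proof.
by move=> sf sg Ev OX; apply: cder_dder; apply: cderD; apply: smooth_cder Ev OX.
Qed.

Lemma dder_mul f g v X : smooth_on E Omega f -> smooth_on E Omega g -> E v -> Omega X ->
  dder v (fun X => f X * g X) X = dder v f X * g X + f X * dder v g X.
Proof.
by move=> sf sg Ev OX; apply: cder_dder; apply: cderM; apply: smooth_cder Ev OX.
Qed.

Lemma dder_sum (I : Type) (r : seq I) (F : I -> V -> C) v X :
  (forall i, smooth_on E Omega (F i)) -> E v -> Omega X ->
  dder v (fun X => \sum_(i <- r) F i X) X = \sum_(i <- r) dder v (F i) X.
Proof.
move=> sF Ev OX; elim: r => [|i r IH].
  rewrite big_nil; apply: cder_dder.
  by under eq_fun do rewrite big_nil; exact: cder_cst.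
rewrite big_cons -IH; under eq_fun do rewrite big_cons.
exact: (dder_add (sF i) (smooth_sum r sF) Ev OX).
Qed.

Lemma dder_scale c f v X : smooth_on E Omega f -> E v -> Omega X ->
  dder v (fun X => c * f X) X = c * dder v f X.
Proof.
by move=> sf Ev OX; apply: cder_dder; apply: cderZ; exact: smooth_cder Ev OX.
Qed.

End SmoothAlgebra.

(** * Differential operators and jets *)

Section DifferentialOperators.
Variable R : realType.
Local Notation C := R[i].
Local Notation V := 'M[R]_(2 + 2).
Variable a : {vspace V}.
Local Notation E := [set` a].
Local Notation Omega := (areg a).
Hypothesis po : plane_open E Omega.
Implicit Types (f g phi : V -> C) (X v w : V) (T : (V -> C) -> V -> C).

(** Arbitrary finite index types let sums and Leibniz expansions of operators be indexed by disjoint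
    unions. *)
Lemma diff_opI (I : finType) T (c : I -> V -> C) (vs : I -> seq V) :
  (forall i, smooth_on E Omega (c i)) -> (forall i v, v \in vs i -> v \in a) ->
  (forall phi, smooth_on E Omega phi -> forall X, Omega X ->
     T phi X = \sum_i c i X * iter_dder (vs i) phi X) ->
  diff_op a T.
Proof.
move=> sc Evs HT; exists #|I|, (fun i => c (enum_val i)), (fun i => vs (enum_val i)).
split=> [i|i v|phi sphi X OX]; [exact: sc|exact: Evs|].
by rewrite HT // (big_enum_val (A := I) (fun i => c i X * iter_dder (vs i) phi X)).
Qed.

Lemma diff_op_smooth T phi : diff_op a T -> smooth_on E Omega phi ->
  smooth_on E Omega (T phi).
Proof.
move=> [n [c [vs [sc Evs HT]]]] sphi.
have HT' X (OX : Omega X) := esym (HT phi sphi X OX).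
apply: (smooth_ext po _ HT'); apply: (smooth_sum po) => i.
by apply: (smooth_mul po); [exact: sc|apply: smooth_iter sphi _ => v; exact: Evs].
Qed.

Lemma diff_op_mul_op g : smooth_on E Omega g -> diff_op a (mul_op g).
Proof.
move=> sg; apply: (@diff_opI unit _ (fun=> g) (fun=> [::])) => //.
by move=> phi _ X _; rewrite big_const /= card_unit /= addr0.
Qed.

Lemma diff_op_mul g T : smooth_on E Omega g -> diff_op a T ->
  diff_op a (fun phi X => g X * T phi X).
Proof.
move=> sg [n [c [vs [sc Evs HT]]]]; exists n, (fun i X => g X * c i X), vs.
split=> [i|i v|phi sphi X OX]; [exact: (smooth_mul po sg (sc i))|exact: Evs|].
by rewrite HT // mulr_sumr; apply: eq_bigr => i _; rewrite mulrA.
Qed.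

Lemma diff_op_add T1 T2 : diff_op a T1 -> diff_op a T2 -> diff_op a (add_op T1 T2).
Proof.
move=> [n [c [vs [sc Evs HT]]]] [n' [c' [vs' [sc' Evs' HT']]]].
apply: (@diff_opI ('I_n + 'I_n')%type _
  (fun i => match i with inl i => c i | inr i => c' i end)
  (fun i => match i with inl i => vs i | inr i => vs' i end)).
- by case.
- by case.
- by move=> phi sphi X OX; rewrite /add_op HT // HT' // big_sumType.
Qed.

(** Leibniz rule: each term gives one term with differentiated coefficient and one with a longer
    word, hence the doubled index type. *)
Lemma diff_op_dder v T : v \in a -> diff_op a T -> diff_op a (fun phi => dder v (T phi)).
Proof.
move=> va [n [c [vs [sc Evs HT]]]].
apply: (@diff_opI ('I_n + 'I_n)%type _
  (fun i => match i with inl i => dder v (c i) | inr i => c i end)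
  (fun i => match i with inl i => vs i | inr i => v :: vs i end)).
- by case=> i; [exact: smooth_dder (sc i) va|exact: sc].
- by case=> i u; [exact: Evs|rewrite inE => /orP[/eqP ->//|]; exact: Evs].
- move=> phi sphi X OX; rewrite big_sumType /= -big_split /=.
  have si i : smooth_on E Omega (iter_dder (vs i) phi).
    by apply: smooth_iter sphi _ => u; exact: Evs.
  have st i : smooth_on E Omega (fun X => c i X * iter_dder (vs i) phi X).
    exact: (smooth_mul po (sc i) (si i)).
  rewrite -(dder_on po (smooth_sum po (index_enum _) st)
     (fun Y OY => esym (HT phi sphi Y OY)) va OX).
  rewrite (dder_sum po (index_enum _) st va OX).
  by apply: eq_bigr => i _; rewrite (dder_mul (sc i) (si i) va OX).
Qed.

Lemma diff_op_cdder h T : rmx h \in a -> imx h \in a -> diff_op a T ->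
  diff_op a (fun phi => cdder h (T phi)).
Proof.
move=> rh ih dT; apply: (@diff_op_add (fun phi => dder (rmx h) (T phi))
   (fun phi X => 'i%C * dder (imx h) (T phi) X)); first exact: diff_op_dder.
by apply: diff_op_mul; [exact: smooth_cst|exact: diff_op_dder].
Qed.

Lemma diff_op_Lop alpha T :
  smooth_on E Omega alpha -> (forall X, Omega X -> alpha X != 0) ->
  rmx (coroot a alpha) \in a -> imx (coroot a alpha) \in a ->
  diff_op a T -> diff_op a (Lop a alpha \o T).
Proof.
move=> sal al0 rh ih dT; apply: diff_op_mul.
  apply: (smooth_inv po); first exact: (smooth_mul po (smooth_cst po 4) sal).
  by move=> X OX; rewrite mulf_neq0 ?al0 // pnatr_eq0.
apply: (@diff_op_cdder _ (fun phi Y => alpha Y * cdder (coroot a alpha) (T phi) Y)) => //.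
by apply: diff_op_mul => //; exact: diff_op_cdder.
Qed.

Lemma diff_op_id : diff_op a id.
Proof.
apply: (@diff_opI unit _ (fun=> fun=> 1) (fun=> [::])) => //.
  by move=> _; exact: smooth_cst.
by move=> phi _ X _; rewrite big_const /= card_unit /= addr0 mul1r.
Qed.

End DifferentialOperators.

(** * Operators at a point are determined by powers of functions vanishing there *)

Section Jets.
Variable R : realType.
Local Notation C := R[i].
Local Notation V := 'M[R]_(2 + 2).
Variables (E Omega : set V).
Hypothesis po : plane_open E Omega.
Variables (X : V) (OX : Omega X).
Implicit Types (f g phi : V -> C) (v w : V) (vs : seq V).

Lemma smooth_exp g N : smooth_on E Omega g -> smooth_on E Omega (fun Y => g Y ^+ N).
Proof.
move=> sg; elim: N => [|N IH]; first exact: smooth_cst.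
by apply: smooth_ext (smooth_mul po sg IH) _ => // Y _; rewrite exprS.
Qed.

Lemma dder_exp g N v Y : smooth_on E Omega g -> E v -> Omega Y ->
  dder v (fun Z => g Z ^+ N.+1) Y = N.+1%:R * g Y ^+ N * dder v g Y.
Proof.
move=> sg Ev OY; elim: N => [|N IH].
  by under [X in dder v X]eq_fun do rewrite expr1; rewrite expr0 !mul1r.
under [X in dder v X]eq_fun do rewrite exprS.
rewrite (dder_mul sg (smooth_exp N.+1 sg) Ev OY) IH [N.+2%:R]mulrSr.
by rewrite exprS; ring.
Qed.

(* The top-order symbol of a jet at a zero of [g] is read off [g ^+ N]. *)
Lemma iter_dder_exp g vs N h : smooth_on E Omega g -> g X = 0 ->
  smooth_on E Omega h -> (forall v, v \in vs -> E v) -> (size vs <= N)%N ->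
  iter_dder vs (fun Y => g Y ^+ N * h Y) X =
    if size vs == N then N`!%:R * \prod_(v <- vs) dder v g X * h X else 0.
Proof.
move=> sg g0; elim/last_ind: vs N h => [|vs v IH] N h sh Evs.
  by case: N => [|N] _ /=; rewrite ?big_nil ?fact0 ?mulr1 // g0 exprS mul0r mul0r.
have Ev : E v by apply: Evs; rewrite mem_rcons mem_head.
have Evs' u : u \in vs -> E u by move=> uvs; apply: Evs; rewrite mem_rcons inE uvs orbT.
rewrite size_rcons; case: N => // N; rewrite ltnS eqSS => sN.
rewrite /iter_dder foldr_rcons -/(iter_dder vs _).
(* The derivative of [g ^+ N.+1 * h] is [g ^+ N * h']; the extra factor [h] is in the statement to
   make this induction possible. At X the second term of [h'] drops out since [g X = 0]. *)
pose h' Y := (N.+1%:R * dder v g Y) * h Y + g Y * dder v h Y.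
have sdg := smooth_dder sg Ev; have sdh := smooth_dder sh Ev.
have sh' : smooth_on E Omega h'.
  apply: (smooth_add po); last exact: (smooth_mul po sg sdh).
  exact: (smooth_mul po (smooth_mul po (smooth_cst po _) sdg) sh).
have sgh : smooth_on E Omega (fun Y => g Y ^+ N.+1 * h Y).
  exact: (smooth_mul po (smooth_exp N.+1 sg) sh).
rewrite (iter_dder_on po (smooth_dder sgh Ev) _ Evs' OX
  (g := fun Y => g Y ^+ N * h' Y)); last first.
  move=> Y OY; rewrite (dder_mul (smooth_exp N.+1 sg) sh Ev OY) dder_exp // /h' exprS.
  ring.
rewrite IH //; case: eqP => // _.
rewrite /h' g0 mul0r addr0 -cats1 big_cat big_seq1 /= factS natrM.
  ring.
Qed.

Variables w1 w2 : V.
Hypotheses (Ew1 : E w1) (Ew2 : E w2).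
Hypothesis basisE : forall v, E v -> exists c1 c2 : R, v = c1 *: w1 + c2 *: w2.

Definition monom (N j : nat) := nseq (N - j) w1 ++ nseq j w2.

Lemma monomE N j v : v \in monom N j -> E v.
Proof. by rewrite mem_cat => /orP[] /nseqP[-> _]. Qed.

Lemma iter_dderC phi v vs Y : smooth_on E Omega phi -> E v ->
  (forall u, u \in vs -> E u) -> Omega Y ->
  dder v (iter_dder vs phi) Y = iter_dder vs (dder v phi) Y.
Proof.
move=> sphi Ev; elim: vs Y => // u vs IH Y Evs OY.
have Evs' z : z \in vs -> E z by move=> zvs; apply: Evs; rewrite inE zvs orbT.
have Eu : E u by apply: Evs; rewrite mem_head.
have si := smooth_iter sphi Evs'.
rewrite /= (dderC po si Ev Eu OY).
by apply: (dder_on po (smooth_dder si Ev) _ Eu OY) => Z OZ; exact: IH.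
Qed.

Lemma iter_monomSl n j phi Y : (j <= n)%N ->
  dder w1 (iter_dder (monom n j) phi) Y = iter_dder (monom n.+1 j) phi Y.
Proof. by move=> jn; rewrite /monom subSn. Qed.

Lemma iter_monomSr n j phi Y : smooth_on E Omega phi -> Omega Y ->
  dder w2 (iter_dder (monom n j) phi) Y = iter_dder (monom n.+1 j.+1) phi Y.
Proof.
move=> sphi OY; rewrite (iter_dderC sphi Ew2 (@monomE n j) OY).
rewrite /iter_dder -foldr_rcons /monom subSS rcons_cat.
by rewrite -cats1 -[[:: w2]]/(nseq 1 w2) -nseqD addn1.
Qed.

(* A word in E is a homogeneous polynomial in [w1] and [w2]; [p] is obtained
   from it by setting [w1 = 1]. *)
Lemma iter_dder_poly vs : (forall v, v \in vs -> E v) ->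
  exists p : {poly C}, [/\ (size p <= (size vs).+1)%N,
    forall g, smooth_on E Omega g -> dder w1 g X = 1 ->
      \prod_(v <- vs) dder v g X = p.[dder w2 g X] &
    forall phi, smooth_on E Omega phi -> forall Y, Omega Y ->
      iter_dder vs phi Y =
      \sum_(j < (size vs).+1) p`_j * iter_dder (monom (size vs) j) phi Y].
Proof.
elim: vs => [_|v vs IH Evs].
  exists 1; split; first by rewrite size_poly1.
    by move=> g _ _; rewrite big_nil hornerC.
  by move=> phi _ Y _; rewrite big_ord1 coef1 mul1r.
have Ev : E v by apply: Evs; rewrite mem_head.
have Evs' u : u \in vs -> E u by move=> uvs; apply: Evs; rewrite inE uvs orbT.
have [p [sp Hp Dp]] := IH Evs'.
have [c1 [c2 vE]] := basisE Ev.
set n := size vs in sp Dp *.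
(* Prepending the direction c1 w1 + c2 w2 multiplies the symbol by c1 + c2 T, the variable T
   standing for [w2]. *)
exists (c1%:C%C *: p + c2%:C%C *: (p * 'X)); split.
- rewrite (leq_trans (size_polyD _ _)) // geq_max.
  rewrite (leq_trans (size_scale_leq _ _)) /= ?(leq_trans sp) //.
  rewrite (leq_trans (size_scale_leq _ _)) // (leq_trans (size_polyMleq _ _)) //.
  by rewrite size_polyX (addn2 (size p)) /= ltnS.
- move=> g sg g1; rewrite big_cons (Hp g) // vE (dder_lin po _ _ sg Ew1 Ew2 OX) g1.
  rewrite hornerD !hornerZ hornerM hornerX.
  ring.
- move=> phi sphi Y OY.
  have sm j : smooth_on E Omega (iter_dder (monom n j) phi).
    exact: (smooth_iter sphi (@monomE n j)).
  have st (j : 'I_n.+1) : smooth_on E Omega (fun Y => p`_j * iter_dder (monom n j) phi Y).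
    exact: (smooth_mul po (smooth_cst po _) (sm j)).
  have si := smooth_iter sphi Evs'.
  have D u : E u -> dder u (iter_dder vs phi) Y =
      \sum_(j < n.+1) p`_j * dder u (iter_dder (monom n j) phi) Y.
    move=> Eu; rewrite (dder_on po si (Dp phi sphi) Eu OY) (dder_sum po _ st Eu OY).
    by apply: eq_bigr => j _; rewrite (dder_scale _ (sm j) Eu OY).
  rewrite /= vE (dder_lin po _ _ si Ew1 Ew2 OY) !D //.
  under [X in _ = X]eq_bigr => j _ do rewrite coefD !coefZ coefMX mulrDl.
  rewrite [RHS]big_split /=; congr (_ + _).
    rewrite [RHS]big_ord_recr /= [p`_n.+1]nth_default // mulr0 mul0r addr0 mulr_suml.
    apply: eq_bigr => j _; rewrite iter_monomSl; last by rewrite -ltnS.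
    by rewrite mulrC mulrA.
  rewrite [RHS]big_ord_recl /= mulr0 mul0r add0r mulr_suml.
  apply: eq_bigr => j _; rewrite iter_monomSr //.
  by rewrite mulrC mulrA.
Qed.

(** The natural numbers below [size p] already give more distinct roots than a nonzero p can
    have. *)
Lemma poly_eq0_horner (p : {poly C}) : (forall t, p.[t] = 0) -> p = 0.
Proof.
move=> Hp; apply/eqP; apply: contraT => p0.
have := @max_poly_roots _ p [seq i%:R | i <- iota 0 (size p)] p0.
rewrite size_map size_iota ltnn; apply => //.
  by apply/allP => _ /mapP[i _ ->]; apply/rootP.
by rewrite map_inj_uniq ?iota_uniq // => i j /eqP; rewrite eqr_nat => /eqP.
Qed.

Definition jet (L : seq (C * seq V)) phi := \sum_(l <- L) l.1 * iter_dder l.2 phi X.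

(** Induction on a strict bound for the word lengths. A combination of q and s with derivatives 1
    and t along [w1] and [w2] exists for each t, and its n-th power extracts n! times the value at t
    of the top symbol. A vanishing symbol kills the top part on every smooth function, so the
    shorter words again satisfy the hypothesis. *)
Lemma jet_determined (L : seq (C * seq V)) q s :
  (forall l, l \in L -> forall v, v \in l.2 -> E v) ->
  smooth_on E Omega q -> smooth_on E Omega s -> q X = 0 -> s X = 0 ->
  dder w1 q X * dder w2 s X - dder w2 q X * dder w1 s X != 0 ->
  (forall (x y : C) N, jet L (fun Y => (x * q Y + y * s Y) ^+ N) = 0) ->
  forall phi, smooth_on E Omega phi -> jet L phi = 0.
Proof.
move=> EL sq ss q0 s0 J0 H.
have [n hn] := ubnP (\max_(l <- L) (size l.2).+1)%N.
have {hn} : forall l, l \in L -> (size l.2 < n)%N.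
  by move=> l lL; apply: leq_trans (ltnW hn); apply: (@leq_bigmax_seq _ L xpredT (fun l => (size l.2).+1)).
elim: n L EL H => [|n IH] L EL H sL phi sphi.
  rewrite /jet big1_seq // => l /andP[_ lL]; by have := sL _ lL.
pose top l := size (l : C * seq V).2 == n.
(* Cramer's rule for the combination of q and s whose derivatives at X along [w1] and [w2] are 1 and
   t; the denominator is the nonzero Jacobian. *)
pose g t Y := (dder w2 s X - t * dder w1 s X) / (dder w1 q X * dder w2 s X - dder w2 q X * dder w1 s X) * q Y
   + (t * dder w1 q X - dder w2 q X) / (dder w1 q X * dder w2 s X - dder w2 q X * dder w1 s X) * s Y.
have sg t : smooth_on E Omega (g t).
  by apply: (smooth_add po); [exact: (smooth_mul po (smooth_cst po _) sq)
    |exact: (smooth_mul po (smooth_cst po _) ss)].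
have dg t v : E v -> dder v (g t) X = 
   (dder w2 s X - t * dder w1 s X) / (dder w1 q X * dder w2 s X - dder w2 q X * dder w1 s X) * dder v q X
   + (t * dder w1 q X - dder w2 q X) / (dder w1 q X * dder w2 s X - dder w2 q X * dder w1 s X) * dder v s X.
  move=> Ev; apply: cder_dder; apply: cderD; apply: cderZ.
    exact: (smooth_cder sq Ev OX).
  exact: (smooth_cder ss Ev OX).
have dg1 t : dder w1 (g t) X = 1 by rewrite (dg t _ Ew1); field.
have dg2 t : dder w2 (g t) X = t by rewrite (dg t _ Ew2); field.
pose Q (l : C * seq V) (p : {poly C}) := [/\ (size p <= (size l.2).+1)%N,
    forall g, smooth_on E Omega g -> dder w1 g X = 1 ->
      \prod_(v <- l.2) dder v g X = p.[dder w2 g X] &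
    forall phi, smooth_on E Omega phi -> forall Y, Omega Y ->
      iter_dder l.2 phi Y =
      \sum_(j < (size l.2).+1) p`_j * iter_dder (monom (size l.2) j) phi Y].
have exP l : exists p, l \in L -> Q l p.
  have [lL|nL] := boolP (l \in L); last by exists 0.
  by have [p Hp] := iter_dder_poly (EL l lL); exists p.
have [P HP] := boolp.choice exP.
have split psi : jet L psi = jet [seq l <- L | top l] psi + jet [seq l <- L | ~~ top l] psi.
  by rewrite /jet (bigID top) /= !big_filter.
have P0 : \sum_(l <- [seq l <- L | top l]) l.1 *: P l = 0.
  apply: poly_eq0_horner => t; rewrite horner_sum.
  have := H ((dder w2 s X - t * dder w1 s X) / (dder w1 q X * dder w2 s X - dder w2 q X * dder w1 s X))
     ((t * dder w1 q X - dder w2 q X) / (dder w1 q X * dder w2 s X - dder w2 q X * dder w1 s X)) n.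
  rewrite -/(g t) /jet => Ht.
  have E1 l : l \in L -> iter_dder l.2 (fun Y => g t Y ^+ n) X =
     if top l then n`!%:R * (P l).[t] else 0.
    move=> lL; have gX : g t X = 0 by rewrite /g q0 s0 !mulr0 addr0.
    have := iter_dder_exp (sg t) gX (smooth_cst po 1) (EL l lL) (sL l lL).
    under [X in iter_dder _ X]eq_fun do rewrite mulr1.
    move=> ->; rewrite mulr1 -/(top l); case: ifP => // _; congr (_ * _).
    by have [_ Hp _] := HP l lL; rewrite (Hp _ (sg t) (dg1 t)) dg2.
  have F0 : n`!%:R != 0 :> C by rewrite pnatr_eq0 -lt0n fact_gt0.
  apply: (mulfI F0); rewrite mulr0 mulr_sumr -[RHS]Ht big_filter big_mkcond /=.
  apply: eq_big_seq => l lL; rewrite E1 //; case: (top l); rewrite ?mulr0 //.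
  by rewrite hornerZ mulrCA.
(* All top words are rewritten in the normal words [monom n j], whose total coefficients are those
   of the vanishing polynomial. *)
have T0 psi : smooth_on E Omega psi -> jet [seq l <- L | top l] psi = 0.
  move=> spsi; transitivity (\sum_(j < n.+1)
    (\sum_(l <- [seq l <- L | top l]) l.1 *: P l)`_j * iter_dder (monom n j) psi X); last first.
    by rewrite P0 big1 // => j _; rewrite coef0 mul0r.
  under eq_bigr => j _ do rewrite coef_sum mulr_suml.
  rewrite exchange_big /=; apply: eq_big_seq => l; rewrite mem_filter => /andP[/eqP tl lL].
  have [_ _ Hp] := HP l lL; rewrite (Hp _ spsi X OX) tl mulr_sumr.
  by apply: eq_bigr => j _; rewrite coefZ mulrA.
rewrite split T0 // add0r; apply: IH => //.
- by move=> l; rewrite mem_filter => /andP[_ /EL].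
- move=> x y N.
  have sxy : smooth_on E Omega (fun Y => (x * q Y + y * s Y) ^+ N).
    apply: smooth_exp; apply: (smooth_add po).
      exact: (smooth_mul po (smooth_cst po _) sq).
    exact: (smooth_mul po (smooth_cst po _) ss).
  by have := H x y N; rewrite split (T0 _ sxy) add0r.
- move=> l; rewrite mem_filter => /andP[tl lL].
  by have := sL l lL; rewrite ltnS leq_eqVlt -/(top l) (negPf tl).
Qed.

End Jets.

(** * Cartan subspaces *)

Section DiagonalFamilies.
Variables (K : fieldType) (n : nat).
Implicit Types (A Z M P : 'M[K]_n) (d : 'rV[K]_n).

(** Some term of the Leibniz expansion of the nonzero determinant is nonzero. *)
Lemma unitmx_diagonal M : M \in unitmx -> exists s : {perm 'I_n}, forall i, M i (s i) != 0.
Proof.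
rewrite unitmxE unitfE => dM.
have [s Hs] : exists s : {perm 'I_n}, \prod_i M i (s i) != 0.
  apply/existsP; apply: contraT; rewrite negb_exists => /forallP H.
  move: dM; rewrite /determinant big1 ?eqxx // => s _.
  by have := H s; rewrite negbK => /eqP ->; rewrite mulr0.
by exists s => i; have /prodf_neq0 := Hs; apply.
Qed.

(** Source of the sign symmetry of weights: with [unitmx_diagonal], one invertible matrix that
    anticommutes with a whole diagonal family gives a single permutation negating the eigenvalues of
    every member. *)
Lemma anticommuting_diag M d i j :
  M *m diag_mx d = - (diag_mx d *m M) -> M i j != 0 -> d 0 j = - d 0 i.
Proof.
move=> /matrixP/(_ i j); rewrite mul_mx_diag mxE [RHS]mxE mul_diag_mx mxE => H M0.
by apply: (mulfI M0); rewrite H mulrN mulrC.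
Qed.

Lemma commutator_diag_delta d i j :
  diag_mx d *m delta_mx i j - delta_mx i j *m diag_mx d = (d 0 i - d 0 j) *: delta_mx i j :> 'M[K]_n.
Proof.
apply/matrixP => r c; rewrite mxE mul_diag_mx mxE [X in _ + X]mxE mul_mx_diag !mxE.
case: (eqVneq r i) => [->|]; last by rewrite !(mulr0, mul0r) oppr0 addr0.
case: (eqVneq c j) => [->|] /=; last by rewrite !(mulr0, mul0r) oppr0 addr0.
by rewrite !mulr1 mul1r.
Qed.

Lemma commutator_diag_entry d Z g i j :
  diag_mx d *m Z - Z *m diag_mx d = g *: Z -> Z i j != 0 -> g = d 0 i - d 0 j.
Proof.
move=> /matrixP/(_ i j); rewrite mxE mul_diag_mx mxE [X in _ + X]mxE mul_mx_diag !mxE => H Z0.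
by apply: (mulIf Z0); rewrite -H mulrBl [Z i j * _]mulrC.
Qed.

Lemma mx_neq0_entry Z : Z != 0 -> exists i j, Z i j != 0.
Proof.
move=> Z0; have [/existsP[i /existsP[j h]]|] := boolP [exists i, exists j, Z i j != 0].
  by exists i, j.
rewrite negb_exists => /forallP H; case/eqP: Z0; apply/matrixP => i j; rewrite mxE.
by have := H i; rewrite negb_exists => /forallP/(_ j); rewrite negbK => /eqP.
Qed.

Lemma conj_mul P A Z : P \in unitmx ->
  P *m (A *m Z) *m invmx P = (P *m A *m invmx P) *m (P *m Z *m invmx P).
Proof. by move=> Pu; rewrite !mulmxA mulmxKV. Qed.

Lemma conj_inj P A Z : P \in unitmx -> P *m A *m invmx P = P *m Z *m invmx P -> A = Z.
Proof.
move=> Pu /(congr1 (mulmx^~ P)); rewrite !mulmxKV // => /(congr1 (mulmx (invmx P))).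
by rewrite !mulKmx.
Qed.

Lemma conj_diag_comm P A Z d e : P \in unitmx -> P *m A *m invmx P = diag_mx d ->
  P *m Z *m invmx P = diag_mx e -> A *m Z = Z *m A.
Proof.
by move=> Pu HA HZ; apply: (conj_inj Pu); rewrite !conj_mul // HA HZ diag_mxC.
Qed.

Lemma conj_commutator P A Z g : P \in unitmx ->
  (A *m Z - Z *m A = g *: Z) <->
  ((P *m A *m invmx P) *m (P *m Z *m invmx P) - (P *m Z *m invmx P) *m (P *m A *m invmx P)
    = g *: (P *m Z *m invmx P)).
Proof.
move=> Pu; rewrite -!conj_mul // -mulmxBl -mulmxBr.
split=> [->|H]; first by rewrite -scalemxAr -scalemxAl.
by apply: (conj_inj Pu); rewrite H -scalemxAr -scalemxAl.
Qed.

End DiagonalFamilies.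

Section Weights.
Variable R : realType.
Local Notation C := R[i].
Local Notation V := 'M[R]_(2 + 2).
Implicit Types (X Y v : V) (P Z : 'M[C]_(2 + 2)).

Lemma cmxD X Y : cmx (X + Y) = cmx X + cmx Y.
Proof. exact: map_mxD. Qed.
Lemma cmxZ (c : R) X : cmx (c *: X) = c%:C%C *: cmx X.
Proof. exact: map_mxZ. Qed.
Lemma cmxM X Y : cmx (X *m Y) = cmx X *m cmx Y.
Proof. exact: map_mxM. Qed.
Lemma cmx_sum (I : Type) (r : seq I) (F : I -> V) :
  cmx (\sum_(i <- r) F i) = \sum_(i <- r) cmx (F i).
Proof. exact: (raddf_sum (map_mx (real_complex R))). Qed.
Lemma cmx_inj : injective (@cmx R).
Proof.
move=> X Y /matrixP H; apply/matrixP => i j; have := H i j.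
by rewrite !mxE => /complexI.
Qed.

(** Codiagonalisation applies to finite lists, so a basis of [a] is diagonalised; the off-diagonal
    entries of any other element vanish by linearity. *)
Lemma simultaneous_diagonalization (a : {vspace V}) :
  (forall X Y, X \in a -> Y \in a -> X *m Y = Y *m X) ->
  (forall X, X \in a -> diagonalizable (cmx X)) ->
  exists2 P, P \in unitmx & forall X, X \in a ->
    exists d : 'rV[C]_(2 + 2), P *m cmx X *m invmx P = diag_mx d.
Proof.
move=> comm diag.
have [|P Pu /allP HP] := (codiagonalizableP [seq cmx X | X <- vbasis a]).1.
  split=> [_ _ /mapP[X /vbasis_mem Xa ->] /mapP[Y /vbasis_mem Ya ->]|_ /mapP[X /vbasis_mem Xa ->]].
    by rewrite /comm_mx -!cmxM comm.
  exact: diag.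
exists P => // X Xa.
have D b : b \in (vbasis a : seq V) -> exists d : 'rV[C]_(2 + 2), P *m cmx b *m invmx P = diag_mx d.
  move=> bB; have /HP/diagonalizable_forPex[d Hd] : cmx b \in [seq cmx X | X <- vbasis a].
    exact: map_f.
  exists d; apply: (can_inj (mulmxK _)) => //; first exact: Pu.
  by rewrite mulmxKV //; apply: simmxPp Hd; rewrite stablemx_unit.
have offdiag i j : i != j -> (P *m cmx X *m invmx P) i j = 0.
  move=> ij; rewrite (coord_vbasis Xa) cmx_sum mulmx_sumr mulmx_suml summxE big1 // => k _.
  rewrite cmxZ -scalemxAr -scalemxAl mxE.
  have [|d ->] := D ((vbasis a)`_k); first by rewrite mem_nth // size_tuple.
  by rewrite mxE (negPf ij) mulr0n mulr0.
exists (\row_i (P *m cmx X *m invmx P) i i); apply/matrixP => i j.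
by rewrite !mxE; case: eqVneq => [->|/offdiag]; rewrite ?mulr1n // mulr0n; rewrite mxE.
Qed.

End Weights.

(** * Eigenvalues on a Cartan subspace in terms of its roots *)

Section NormalForm.
Variable R : realType.
Local Notation C := R[i].
Local Notation V := 'M[R]_(2 + 2).
Implicit Types (X Y v : V) (P Z : 'M[C]_(2 + 2)).

(** Conjugation by this matrix is the involution defining the symmetric pair; it is -1 on q. *)
Definition involution : V := block_mx 1%:M 0 0 (- 1%:M).

Lemma involution_unit : involution \in unitmx.
Proof.
suff /mulmx1_unit[] : involution *m involution = 1%:M by [].
rewrite /involution mulmx_block !(mulmx0, mul0mx, mulmx1, addr0, add0r).
by rewrite mulNmx mulmxN mulmx1 opprK -scalar_mx_block.
Qed.

Lemma involution_anticommute X : qset X -> involution *m X = - (X *m involution).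
Proof.
move=> [ul dr]; rewrite -[X]submxK ul dr /involution !mulmx_block opp_block_mx.
rewrite !(mulmx0, mul0mx, mulmx1, mul1mx, addr0, add0r, oppr0).
by rewrite mulNmx mulmxN mulmx1 mul1mx opprK.
Qed.

Lemma root_weights (a : {vspace V}) P (d : V -> 'rV[C]_(2 + 2)) gamma :
  P \in unitmx -> (forall X, X \in a -> P *m cmx X *m invmx P = diag_mx (d X)) ->
  is_root a gamma -> exists i j, forall X, X \in a -> gamma X = d X 0 i - d X 0 j.
Proof.
move=> Pu HP [_ [Z Z0 HZ]].
have [i [j Wij]] : exists i j, (P *m Z *m invmx P) i j != 0.
  apply: mx_neq0_entry; apply: contra Z0 => /eqP W0.
  rewrite -[Z](mulKmx Pu) -[P *m Z](mulmxKV Pu) W0.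
  by rewrite mul0mx mulmx0.
exists i, j => X Xa; apply: (commutator_diag_entry _ Wij).
by rewrite -HP //; apply: (conj_commutator _ _ _ Pu).1; exact: HZ.
Qed.

(** In the diagonalising basis, the matrix units at (i, j) and (s j, s i) are root vectors for the
    same root, because s negates weights. Multiplicity one makes them proportional, so s exchanges i
    and j and the root is twice a weight. *)
Lemma simple_root_weight (a : {vspace V}) P (d : V -> 'rV[C]_(2 + 2)) alpha
    (s : 'I_(2 + 2) -> 'I_(2 + 2)) :
  P \in unitmx -> (forall X, X \in a -> P *m cmx X *m invmx P = diag_mx (d X)) ->
  (forall X i, X \in a -> d X 0 (s i) = - d X 0 i) ->
  is_root a alpha -> has_multiplicity a alpha 1 ->
  exists i j, forall X, X \in a -> alpha X = 2 * d X 0 i /\ alpha X = - (2 * d X 0 j).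
Proof.
move=> Pu HP Hs ra [W HW dW].
have [i [j Hij]] := root_weights Pu HP ra.
pose Z r c : 'M[C]_(2 + 2) := invmx P *m delta_mx r c *m P.
have PZ r c : P *m Z r c *m invmx P = delta_mx r c.
  by rewrite /Z mulmxA mulmxK // mulKVmx.
have ZW r c : (forall X, X \in a -> alpha X = d X 0 r - d X 0 c) -> Z r c \in W.
  move=> Hrc; apply/HW => X Xa; apply: (conj_commutator _ _ _ Pu).2.
  by rewrite HP // PZ commutator_diag_delta Hrc.
have Z1 : Z i j \in W by exact: ZW.
have Z2 : Z (s j) (s i) \in W.
  by apply: ZW => X Xa; rewrite !Hs // opprK addrC; exact: Hij.
have Zn0 r c : Z r c != 0.
  apply/eqP => Z0; have := PZ r c; rewrite Z0 mulmx0 mul0mx => /matrixP/(_ r c).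
  by rewrite !mxE !eqxx => /eqP; rewrite eq_sym oner_eq0.
have WE : W = <[Z i j]>%VS.
  apply/esym/eqP; rewrite eqEdim dim_vline Zn0 dW leqnn andbT.
  by apply/subvP => _ /vlineP[k ->]; exact: (memvZ k Z1).
move: Z2; rewrite WE => /vlineP[k Ek].
have : delta_mx (s j) (s i) = k *: delta_mx i j :> 'M[C]_(2 + 2).
  by rewrite -!PZ Ek -scalemxAr -scalemxAl.
move=> /matrixP/(_ (s j) (s i)); rewrite !mxE !eqxx /=.
case: (eqVneq (s j) i) => [sj|_]; last first.
  by move=> /eqP; rewrite mulr0 oner_eq0.
case: (eqVneq (s i) j) => [si _|_]; last first.
  by move=> /eqP; rewrite mulr0 oner_eq0.
exists i, j => X Xa; rewrite Hij //; have := Hs X i Xa; rewrite si => ->.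
by split; ring.
Qed.

Definition alpha_row (a1 a2 : C) : 'rV[C]_(2 + 2) :=
  \row_r [:: a1 / 2; - a1 / 2; a2 / 2; - a2 / 2]`_r.

(** The two roots of multiplicity one supply the weights alpha_1/2, -alpha_1/2, alpha_2/2,
    -alpha_2/2. Their four indices are distinct, hence exhaust the diagonal, and the rows of P are
    reordered accordingly. *)
Lemma cartan_normal_form (a : {vspace V}) (alpha1 alpha2 : V -> C) :
  cartan_subspace a -> positive_roots a alpha1 alpha2 ->
  exists2 P, P \in unitmx & forall X, X \in a ->
    P *m cmx X *m invmx P = diag_mx (alpha_row (alpha1 X) (alpha2 X)).
Proof.
move=> [[aq comm diag] _] [[Hroot _ _ _] [m1 m2] _].
have [P Pu HP] := simultaneous_diagonalization comm diag.
pose d X : 'rV[C]_(2 + 2) := \row_i (P *m cmx X *m invmx P) i i.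
have {}HP X : X \in a -> P *m cmx X *m invmx P = diag_mx (d X).
  move=> /HP[e He]; rewrite He; congr diag_mx; apply/rowP => i.
  by rewrite mxE He mxE eqxx mulr1n.
have [s Hs] : exists s : {perm 'I_(2 + 2)}, forall X i, X \in a -> d X 0 (s i) = - d X 0 i.
  pose M := P *m cmx involution *m invmx P.
  have Mu : M \in unitmx.
    rewrite !unitmx_mul Pu unitmx_inv Pu andbT /=.
    by rewrite map_unitmx involution_unit.
  have [s sM] := unitmx_diagonal Mu; exists s => X i Xa.
  apply: (anticommuting_diag _ (sM i)); rewrite -HP // -!conj_mul // -!cmxM.
  rewrite involution_anticommute; last exact: aq.
  by rewrite /cmx map_mxN mulmxN mulNmx.
have r1 : is_root a alpha1 by apply: Hroot; left; left; left.
have r2 : is_root a alpha2 by apply: Hroot; left; left; right.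
have [X1 X1a b1] : exists2 X, X \in a & beta1 alpha1 alpha2 X != 0.
  by have [] : is_root a (beta1 alpha1 alpha2) by apply: Hroot; left; right.
have [X2 X2a b2] : exists2 X, X \in a & beta2 alpha1 alpha2 X != 0.
  by have [] : is_root a (beta2 alpha1 alpha2) by apply: Hroot; right.
have [[Y1 Y1a a1] _] := r1; have [[Y2 Y2a a2] _] := r2.
have [i [j ij]] := simple_root_weight Pu HP Hs r1 m1.
have [k [l kl]] := simple_root_weight Pu HP Hs r2 m2.
have half (x y : C) : x = 2 * y -> y = x / 2 by move=> ->; rewrite mulrC mulKf ?pnatr_eq0.
have halfN (x y : C) : x = - (2 * y) -> y = - x / 2 by move=> ->; rewrite opprK mulrC mulKf ?pnatr_eq0.
have di X : X \in a -> d X 0 i = alpha1 X / 2 by move=> /ij[/half].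
have dj X : X \in a -> d X 0 j = - alpha1 X / 2 by move=> /ij[_ /halfN].
have dk X : X \in a -> d X 0 k = alpha2 X / 2 by move=> /kl[/half].
have dl X : X \in a -> d X 0 l = - alpha2 X / 2 by move=> /kl[_ /halfN].
have n2 : (2 : C) != 0 by rewrite pnatr_eq0.
have eq2 (x y : C) : x / 2 = y / 2 -> x = y by move=> h; apply: (mulIf (invr_neq0 n2)).
have self (x : C) : x = - x -> x = 0.
  by move=> h; apply: (mulfI n2); rewrite mulr0 mulr_natl mulr2n {2}h subrr.
(* A coincidence of two indices would make one of alpha_1, alpha_2, beta_1, beta_2 vanish
   identically on [a], but each of them is a root. *)
have u4 : uniq [:: i; j; k; l].
  rewrite /= !inE !negb_or -!andbA andbT.
  repeat (apply/andP; split); apply/eqP => e.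
  - move: a1; have := di _ Y1a; rewrite e dj // => /eq2 h.
    by rewrite [alpha1 Y1]self ?eqxx // -[LHS]h.
  - move: b1; have := di _ X1a; rewrite e dk // => /eq2 h.
    by rewrite /beta1 h subrr mul0r eqxx.
  - move: b2; have := di _ X2a; rewrite e dl // => /eq2 h.
    by rewrite /beta2 -h addNr mul0r eqxx.
  - move: b2; have := dj _ X2a; rewrite e dk // => /eq2 h.
    by rewrite /beta2 h subrr mul0r eqxx.
  - move: b1; have := dj _ X1a; rewrite e dl // => /eq2 /oppr_inj h.
    by rewrite /beta1 h subrr mul0r eqxx.
  - move: a2; have := dk _ Y2a; rewrite e dl // => /eq2 h.
    by rewrite [alpha2 Y2]self ?eqxx // -[LHS]h.
pose f (r : 'I_(2 + 2)) := nth i [:: i; j; k; l] r.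
have f_inj : injective f.
  by move=> r c /eqP; rewrite nth_uniq // => /eqP/val_inj.
have Pu' : row_perm (perm f_inj) P \in unitmx.
  by rewrite row_permE unitmx_mul unitmx_perm Pu.
exists (row_perm (perm f_inj) P) => // X Xa.
apply: (can_inj (mulmxK Pu')); rewrite mulmxKV // [in LHS]row_permE -mulmxA -row_permE.
have -> : P *m cmx X = diag_mx (d X) *m P by rewrite -HP // mulmxKV.
apply/matrixP => r c; rewrite [LHS]mxE !mul_diag_mx 2!mxE permE.
rewrite [row_perm _ _ _ _]mxE permE; congr (_ * _).
rewrite /f [RHS]mxE; case: r => [[|[|[|[|//]]]] hr] /=.
- by rewrite -di.
- by rewrite -dj.
- by rewrite -dk.
- by rewrite -dl.
Qed.

End NormalForm.

(** * The invariants *)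

Section Invariants.
Variable R : realType.
Local Notation C := R[i].
Local Notation V := 'M[R]_(2 + 2).
Implicit Types (X Y v : V) (E Omega : set V).

Lemma Qf_cmx X : Qf (cmx X) = (Qf X)%:C%C.
Proof.
rewrite /Qf -cmxM /cmx -[in LHS](rmorph_nat (real_complex R) 2) -fmorphV /=.
by rewrite trace_map_mx rmorphM.
Qed.

Lemma Sf_cmx X : Sf (cmx X) = (Sf X)%:C%C.
Proof. exact: det_map_mx. Qed.

Lemma real_complex_S0 (q s : R) :
  (q ^+ 2 - 4 * s)%:C%C = q%:C%C ^+ 2 - 4 * s%:C%C :> C.
Proof. by rewrite rmorphB rmorphXn rmorphM (rmorph_nat (real_complex R) 4). Qed.

Lemma smooth_prod E Omega (I : Type) (r : seq I) (F : I -> V -> C) :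
  plane_open E Omega -> (forall i, smooth_on E Omega (F i)) ->
  smooth_on E Omega (fun X => \prod_(i <- r) F i X).
Proof.
move=> po sF; elim: r => [|i r IH].
  by apply: (smooth_ext po (smooth_cst po 1)) => X _; rewrite big_nil.
by apply: (smooth_ext po (smooth_mul po (sF i) IH)) => X _; rewrite big_cons.
Qed.

Lemma smooth_cmx_entry E Omega i j : plane_open E Omega ->
  smooth_on E Omega (fun X => cmx X i j).
Proof.
by move=> po; apply: (smooth_ext po (smooth_entry po i j)) => X _; rewrite mxE.
Qed.

Lemma smooth_Qf E Omega : plane_open E Omega ->
  smooth_on E Omega (fun X => (Qf X)%:C%C).
Proof.
move=> po.
have s : smooth_on E Omega (fun X => 2^-1 * \sum_i \sum_j (cmx X i j * cmx X j i)).
  apply: (smooth_mul po (smooth_cst po _)); apply: (smooth_sum po) => i.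
  apply: (smooth_sum po) => j.
  exact: (smooth_mul po (smooth_cmx_entry i j po) (smooth_cmx_entry j i po)).
apply: (smooth_ext po s) => X _; rewrite -Qf_cmx /Qf /mxtrace; congr (_ * _).
by apply: eq_bigr => i _; rewrite mxE.
Qed.

Lemma smooth_Sf E Omega : plane_open E Omega ->
  smooth_on E Omega (fun X => (Sf X)%:C%C).
Proof.
move=> po.
have s : smooth_on E Omega (fun X => \sum_(s : 'S_(2 + 2)) ((-1) ^+ s * \prod_i cmx X i (s i))).
  apply: (smooth_sum po) => s; apply: (smooth_mul po (smooth_cst po _)).
  by apply: (smooth_prod _ po) => i; exact: smooth_cmx_entry.
by apply: (smooth_ext po s) => X _; rewrite -Sf_cmx.
Qed.

Lemma smooth_S0f E Omega : plane_open E Omega ->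
  smooth_on E Omega (fun X => (S0f X)%:C%C).
Proof.
move=> po.
have s := smooth_add po (smooth_mul po (smooth_Qf po) (smooth_Qf po))
  (smooth_mul po (smooth_cst po (-4)) (smooth_Sf po)).
apply: (smooth_ext po s) => X _.
by rewrite /S0f real_complex_S0 mulNr expr2.
Qed.

Lemma plane_open_subspace E (U : set V) : linear_set E -> open U -> plane_open E (E `&` U).
Proof. by move=> lE oU; split => //; exists U. Qed.

(** Continuity of S S0 is read off its smoothness on the full matrix space. *)
Lemma open_regular : open [set X : V | Sf X * S0f X != 0].
Proof.
have po : plane_open (@setT V) setT.
  by split=> //; exists setT; [exact: openT|rewrite setTI].
have s := smooth_mul po (smooth_Sf po) (smooth_S0f po).
have [c _ _] := smooth_C1 s.
have cE : (fun X => complex.Re ((Sf X)%:C%C * (S0f X)%:C%C)) = (fun X : V => Sf X * S0f X).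
  by apply/funext => X; rewrite cReM /= mulr0 subr0.
rewrite {}cE in c.
have {}c (X : V) : {for X, continuous (fun X => Sf X * S0f X)}.
  move=> A hA; have := (within_continuousP _ _).1 c X I A hA.
  by apply: (@filterS _ (nbhs X)) => Y; apply.
have -> : [set X : V | Sf X * S0f X != 0] =
    (fun X => Sf X * S0f X) @^-1` [set x | x != 0] by [].
apply: open_comp => [X _|].
  exact: (c X).
exact: open_neq.
Qed.

Lemma plane_open_qset : plane_open (@qset R) (@qset R).
Proof.
split; last by exists setT; [exact: openT|rewrite setIT].
move=> c X Y [u1 d1] [u2 d2].
have ulE : ulsubmx (c *: X + Y) = c *: ulsubmx X + ulsubmx Y :> 'M[R]_2.
  by apply/matrixP => i j; rewrite !mxE.
have drE : drsubmx (c *: X + Y) = c *: drsubmx X + drsubmx Y :> 'M[R]_2.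
  by apply/matrixP => i j; rewrite !mxE.
by split; rewrite ?ulE ?drE ?u1 ?u2 ?d1 ?d2 scaler0 addr0.
Qed.

Lemma plane_open_qreg : plane_open (@qset R) (@qreg R).
Proof.
apply: (plane_open_subspace (proj1 plane_open_qset) open_regular).
Qed.

Lemma plane_open_areg (a : {vspace V}) : [set` a] `<=` @qset R -> plane_open [set` a] (areg a).
Proof.
move=> aq; have -> : areg a = [set` a] `&` [set X : V | Sf X * S0f X != 0].
  by apply/seteqP; split=> X [Xa Xr]; split=> //; [case: Xr|split => //; exact: aq].
apply: plane_open_subspace open_regular => c X Y Xa Ya.
by apply: memvD => //; apply: memvZ.
Qed.

End Invariants.

(** * Basis, invariants and coroots of a Cartan subspace in normal form *)

Section CartanSubspace.
Variable R : realType.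
Local Notation C := R[i].
Local Notation V := 'M[R]_(2 + 2).
Variables (a : {vspace V}) (ha : cartan_subspace a) (a1 a2 : V -> C).
Variables (P : 'M[C]_(2 + 2)) (Pu : P \in unitmx).
Hypothesis HP : forall X, X \in a ->
  P *m cmx X *m invmx P = diag_mx (alpha_row (a1 X) (a2 X)).
Implicit Types (X Y v : V).

(** The root functions are controlled only on [a]. This form is linear on all matrices and agrees
    with [a1] and [a2] there for the indices [k1] and [k2]; the 2 undoes the halves in
    [alpha_row]. *)
Definition weight (k : 'I_(2 + 2)) (X : V) : C := 2 * (P *m cmx X *m invmx P) k k.

Lemma weight_lin k (c : R) X Y : weight k (c *: X + Y) = c%:C%C * weight k X + weight k Y.
Proof.
rewrite /weight cmxD cmxZ mulmxDr mulmxDl -scalemxAr -scalemxAl mxE [X in X + _]mxE.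
by ring.
Qed.

Lemma smooth_weight E Omega k : plane_open E Omega -> smooth_on E Omega (weight k).
Proof.
move=> po.
have s : smooth_on E Omega (fun X => 2 * \sum_j (\sum_i P k i * cmx X i j) * invmx P j k).
  apply: (smooth_mul po (smooth_cst po _)); apply: (smooth_sum po) => j.
  apply: (smooth_mul po _ (smooth_cst po _)); apply: (smooth_sum po) => i.
  exact: (smooth_mul po (smooth_cst po _) (smooth_cmx_entry i j po)).
apply: (smooth_ext po s) => X _; rewrite /weight; congr (_ * _).
by rewrite mxE; apply: eq_bigr => j _; rewrite mxE.
Qed.

Definition k1 : 'I_(2 + 2) := @Ordinal 4 0 isT.
Definition k2 : 'I_(2 + 2) := @Ordinal 4 2 isT.

Lemma a1E X : X \in a -> a1 X = weight k1 X.
Proof. by move=> Xa; rewrite /weight HP // !mxE eqxx mulr1n /= mulrC divfK ?pnatr_eq0. Qed.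

Lemma a2E X : X \in a -> a2 X = weight k2 X.
Proof. by move=> Xa; rewrite /weight HP // !mxE eqxx mulr1n /= mulrC divfK ?pnatr_eq0. Qed.

Lemma a_qset : [set` a] `<=` @qset R.
Proof. by case: ha => -[]. Qed.

Let po : plane_open [set` a] (areg a) := plane_open_areg a_qset.

Lemma a1_lin (c : R) X Y : X \in a -> Y \in a -> a1 (c *: X + Y) = c%:C%C * a1 X + a1 Y.
Proof.
by move=> Xa Ya; rewrite !a1E ?weight_lin // memvD // memvZ.
Qed.

Lemma a2_lin (c : R) X Y : X \in a -> Y \in a -> a2 (c *: X + Y) = c%:C%C * a2 X + a2 Y.
Proof.
by move=> Xa Ya; rewrite !a2E ?weight_lin // memvD // memvZ.
Qed.

Lemma areg_a X : areg a X -> X \in a. Proof. by case. Qed.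

Lemma smooth_a1 : smooth_on [set` a] (areg a) a1.
Proof. by apply: (smooth_ext po (smooth_weight k1 po)) => X /areg_a Xa; rewrite a1E. Qed.

Lemma smooth_a2 : smooth_on [set` a] (areg a) a2.
Proof. by apply: (smooth_ext po (smooth_weight k2 po)) => X /areg_a Xa; rewrite a2E. Qed.

Lemma cder_linear (f : V -> C) X v :
  (forall t : R, f (t *: v + X) = t%:C%C * f v + f X) -> is_cder f X v (f v).
Proof.
move=> fl; apply/cder_line; split; under eq_fun do rewrite fl.
  under eq_fun do rewrite cReD cReM /= mul0r subr0; exact: is_derive_affine.
under eq_fun do rewrite cImD cImM /= mul0r addr0; exact: is_derive_affine.
Qed.

Lemma cder_a1 X v : X \in a -> v \in a -> is_cder a1 X v (a1 v).
Proof. by move=> Xa va; apply: cder_linear => t; rewrite a1_lin. Qed.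

Lemma cder_a2 X v : X \in a -> v \in a -> is_cder a2 X v (a2 v).
Proof. by move=> Xa va; apply: cder_linear => t; rewrite a2_lin. Qed.

Lemma trace_conj (A : 'M[C]_(2 + 2)) : \tr (P *m A *m invmx P) = \tr A.
Proof. by rewrite mxtrace_mulC mulKmx. Qed.

Lemma omega_a X Y : X \in a -> Y \in a ->
  omega (cmx X) (cmx Y) = (a1 X * a1 Y + a2 X * a2 Y) / 4.
Proof.
move=> Xa Ya; rewrite /omega -trace_conj conj_mul // !HP // mulmx_diag mxtrace_diag.
rewrite !big_ord_recl big_ord0 !mxE /=.
by field.
Qed.

Lemma Qf_a X : X \in a -> (Qf X)%:C%C = (a1 X ^+ 2 + a2 X ^+ 2) / 4.
Proof. by move=> Xa; rewrite -Qf_cmx -[LHS]/(omega (cmx X) (cmx X)) omega_a // !expr2. Qed.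

Lemma Sf_a X : X \in a -> (Sf X)%:C%C = a1 X ^+ 2 * a2 X ^+ 2 / 16.
Proof.
move=> Xa; rewrite -Sf_cmx /Sf.
have -> : \det (cmx X) = \det (P *m cmx X *m invmx P).
  by rewrite !det_mulmx mulrAC -det_mulmx mulmxV // det1 mul1r.
by rewrite HP // det_diag !big_ord_recl big_ord0 !mxE /=; field.
Qed.

Lemma S0f_a X : X \in a -> (S0f X)%:C%C = (beta1 a1 a2 X * beta2 a1 a2 X) ^+ 2.
Proof.
by move=> Xa; rewrite /S0f real_complex_S0 Qf_a // Sf_a // /beta1 /beta2; field.
Qed.

Lemma areg_neq0 X : areg a X -> [/\ a1 X != 0, a2 X != 0 & a1 X ^+ 2 - a2 X ^+ 2 != 0].
Proof.
move=> [Xa [_ r0]].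
have rC (x : R) : x != 0 -> x%:C%C != 0 :> C by move=> x0; rewrite fmorph_eq0.
move: r0; rewrite mulf_eq0 negb_or => /andP[/rC s0 /rC t0].
move: s0; rewrite (Sf_a Xa) mulf_eq0 negb_or mulf_eq0 negb_or !sqrf_eq0 -andbA => /and3P[x1 x2 _].
move: t0; rewrite (S0f_a Xa) sqrf_eq0 mulf_eq0 negb_or /beta1 /beta2 => /andP[].
rewrite mulf_eq0 negb_or => /andP[b1 _]; rewrite mulf_eq0 negb_or => /andP[b2 _].
by split => //; rewrite subr_sqr mulf_neq0.
Qed.

(** The cube is again block off-diagonal and is diagonalised by the same P, so adjoining it keeps
    the space abelian and semisimple; maximality then leaves no room. An odd power is needed to stay
    in q. *)
Lemma cube_mem X : X \in a -> X *m X *m X \in a.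
Proof.
move=> Xa; have [[aq comm _] max] := ha.
have aD Z : Z \in (a + <[X *m X *m X]>)%VS ->
    exists2 d : 'rV[C]_(2 + 2), P *m cmx Z *m invmx P = diag_mx d & qset Z.
  move=> /memv_addP[Y Ya [_ /vlineP[c ->] ->]].
  exists (alpha_row (a1 Y) (a2 Y) + c%:C%C *: \row_i (alpha_row (a1 X) (a2 X)) 0 i ^+ 3).
    rewrite cmxD cmxZ mulmxDr mulmxDl HP // -scalemxAr -scalemxAl !cmxM !conj_mul // HP //.
    rewrite !mulmx_diag linearD linearZ /=; congr (_ + _ *: diag_mx _).
    by apply/rowP => i; rewrite !mxE !exprS expr0 mulr1 mulrA.
  rewrite addrC; apply: (proj1 (plane_open_qset R)); last exact: aq.
  have [ul dr] := aq X Xa; rewrite -[X]submxK ul dr !mulmx_block.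
  by rewrite !(mulmx0, mul0mx, addr0, add0r); split; rewrite ?block_mxKul ?block_mxKdr.
have <- : (a + <[X *m X *m X]>)%VS = a.
  apply: max; last exact: addvSl.
  split=> [Z /aD[]//|Y Z /aD[d Hd _] /aD[e He _]|Z /aD[d Hd _]].
    by apply: cmx_inj; rewrite !cmxM; exact: conj_diag_comm Pu Hd He.
  exists P => //; apply/diagonalizable_forPex; exists d.
  by apply/(simmxP Pu); rewrite -Hd mulmxKV.
by apply: (subvP (addvSr _ _)); rewrite memv_line.
Qed.

Lemma a_cube X : X \in a ->
  a1 (X *m X *m X) = a1 X ^+ 3 / 4 /\ a2 (X *m X *m X) = a2 X ^+ 3 / 4.
Proof.
move=> Xa; have H := HP (cube_mem Xa).
rewrite !cmxM !conj_mul // HP // !mulmx_diag in H.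
have n2 : (2 : C) != 0 by rewrite pnatr_eq0.
have half (x y : C) : x / 2 = y -> x = 2 * y by move=> <-; rewrite mulrC divfK.
split.
  move/matrixP/(_ k1 k1): H; rewrite !mxE eqxx !mulr1n /= => /esym/half ->; by field.
move/matrixP/(_ k2 k2): H; rewrite !mxE eqxx !mulr1n /= => /esym/half ->; by field.
Qed.

(** Cramer's rule for the values of the two roots on X and X^3. The eigenvalue A/2 becomes A^3/8 on
    the cube, so the root takes the value A^3/4. *)
Lemma vandermonde_solve (A B y1 y2 : C) : A != 0 -> B != 0 -> A ^+ 2 - B ^+ 2 != 0 ->
  exists z1 z2, z1 * A + z2 * (A ^+ 3 / 4) = y1 /\ z1 * B + z2 * (B ^+ 3 / 4) = y2.
Proof.
move=> A0 B0 AB; exists ((y2 * A ^+ 3 - y1 * B ^+ 3) / (A * B * (A ^+ 2 - B ^+ 2))).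
exists (4 * (y1 * B - y2 * A) / (A * B * (A ^+ 2 - B ^+ 2))).
by split; field; rewrite A0 B0 AB.
Qed.

Lemma cartan_basis X0 Y : areg a X0 -> Y \in a ->
  exists c1 c2 : R, Y = c1 *: X0 + c2 *: (X0 *m X0 *m X0).
Proof.
move=> r0 Ya; have Xa := areg_a r0; have [A0 B0 AB] := areg_neq0 r0.
have [z1 [z2 [E1 E2]]] := vandermonde_solve (a1 Y) (a2 Y) A0 B0 AB.
have [C1 C2] := a_cube Xa.
(* The coefficients are found over the complex numbers; the three matrices being real, the real
   parts satisfy the same relation. *)
exists (complex.Re z1), (complex.Re z2).
have H : cmx Y = z1 *: cmx X0 + z2 *: cmx (X0 *m X0 *m X0).
  apply: (conj_inj Pu); rewrite mulmxDr mulmxDl -!scalemxAr -!scalemxAl !HP ?cube_mem //.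
  rewrite -!linearZ -linearD /=; congr diag_mx; apply/rowP => i; rewrite !mxE C1 C2 -E1 -E2.
  by case: i => [[|[|[|[|//]]]] hi] /=; field.
apply/matrixP => i j; move/matrixP/(_ i j)/(congr1 (@complex.Re R)): H.
by rewrite !mxE cReD !cReM /= !mulr0 !subr0.
Qed.

(** The complex-linear extension of a form from [a] to its complexification. *)
Definition complexify (f : V -> C) (h : 'M[C]_(2 + 2)) := f (rmx h) + 'i%C * f (imx h).

Lemma cmx_rmx_imx (h : 'M[C]_(2 + 2)) : h = cmx (rmx h) + 'i%C *: cmx (imx h).
Proof. by apply/matrixP => i j; rewrite !mxE; exact: complexE. Qed.

Lemma omega_complexify h X : rmx h \in a -> imx h \in a -> X \in a ->
  omega h (cmx X) = (complexify a1 h * a1 X + complexify a2 h * a2 X) / 4.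
Proof.
move=> rh ih Xa; rewrite {1}(cmx_rmx_imx h) /omega mulmxDl -scalemxAl mxtraceD mxtraceZ mulrDr mulrCA.
rewrite -/(omega (cmx (rmx h)) (cmx X)) -/(omega (cmx (imx h)) (cmx X)) !omega_a //.
by rewrite /complexify; field.
Qed.

Lemma complexify_exists X0 (t1 t2 : C) : areg a X0 ->
  exists h, [/\ rmx h \in a, imx h \in a, complexify a1 h = t1 & complexify a2 h = t2].
Proof.
move=> r0; have Xa := areg_a r0; have [A0 B0 AB] := areg_neq0 r0.
have [z1 [z2 [E1 E2]]] := vandermonde_solve t1 t2 A0 B0 AB.
have Ca := cube_mem Xa; have [C1 C2] := a_cube Xa; set Y := X0 *m X0 *m X0 in Ca C1 C2.
pose h := z1 *: cmx X0 + z2 *: cmx Y.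
have rE : rmx h = complex.Re z1 *: X0 + complex.Re z2 *: Y.
  by apply/matrixP => i j; rewrite !mxE cReD !cReM /= !mulr0 !subr0.
have iE : imx h = complex.Im z1 *: X0 + complex.Im z2 *: Y.
  by apply/matrixP => i j; rewrite !mxE cImD !cImM /= !mulr0 !add0r.
have lin0 (c : R) Z : Z \in a -> a1 (c *: Z) = c%:C%C * a1 Z /\ a2 (c *: Z) = c%:C%C * a2 Z.
  move=> Za; have z1' : a1 0 = 0.
    by have := a1_lin (-1) Za Za; rewrite scaleN1r addNr => ->; rewrite rmorphN rmorph1 mulN1r addNr.
  have z2' : a2 0 = 0.
    by have := a2_lin (-1) Za Za; rewrite scaleN1r addNr => ->; rewrite rmorphN rmorph1 mulN1r addNr.
  rewrite -[c *: Z]addr0 a1_lin ?mem0v // a2_lin ?mem0v //.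
  by rewrite z1' z2' !addr0.
have za (c : R) Z : Z \in a -> c *: Z \in a by exact: memvZ.
exists h; rewrite /complexify rE iE !memvD ?za //; split=> //.
  rewrite !a1_lin ?za // !(lin0 _ Y Ca).1 -E1 C1 {3}(complexE z1) {3}(complexE z2).
  by rewrite /=; ring.
rewrite !a2_lin ?za // !(lin0 _ Y Ca).2 -E2 C2 {3}(complexE z1) {3}(complexE z2).
by rewrite /=; ring.
Qed.

(** Makes the choice in [coroot] harmless: a suitable vector exists, and pairing with X0 and X0^3
    determines its root coordinates. As [omega] is a quarter of the product form in these
    coordinates, alpha_1 and alpha_2 correspond to (4, 0) and (0, 4). *)
Lemma corootP X0 (alpha : V -> C) (t1 t2 : C) : areg a X0 ->
  (forall X, X \in a -> alpha X = (t1 * a1 X + t2 * a2 X) / 4) ->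
  [/\ rmx (coroot a alpha) \in a, imx (coroot a alpha) \in a,
      complexify a1 (coroot a alpha) = t1 & complexify a2 (coroot a alpha) = t2].
Proof.
move=> r0 Hal; have [h [rh ih e1 e2]] := complexify_exists t1 t2 r0.
have [rk ik Hk] : [set h | [/\ rmx h \in a, imx h \in a &
    forall X, X \in a -> omega h (cmx X) = alpha X]] (coroot a alpha).
  apply: xgetPex; exists h; split=> // X Xa.
  by rewrite omega_complexify // e1 e2 Hal.
move: (coroot a alpha) rk ik Hk => k rk ik Hk.
have Xa := areg_a r0; have [A0 B0 AB] := areg_neq0 r0.
have Ca := cube_mem Xa; have [C1 C2] := a_cube Xa.
have := Hk _ Ca; rewrite Hal // omega_complexify // C1 C2.
have := Hk _ Xa; rewrite Hal // omega_complexify //.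
move: (a1 X0) (a2 X0) (complexify a1 k) (complexify a2 k) A0 B0 AB => A B s1 s2 A0 B0 AB H1 H3.
have n4 : (4 : C) != 0 by rewrite pnatr_eq0.
have G1 : (s1 - t1) * A + (s2 - t2) * B = 0.
  apply: (mulIf (invr_neq0 n4)); rewrite mul0r.
  by transitivity ((s1 * A + s2 * B) / 4 - (t1 * A + t2 * B) / 4); [field|rewrite H1 subrr].
have G3 : (s1 - t1) * A ^+ 3 + (s2 - t2) * B ^+ 3 = 0.
  apply: (mulIf (invr_neq0 n4)); apply: (mulIf (invr_neq0 n4)); rewrite !mul0r.
  transitivity ((s1 * (A ^+ 3 / 4) + s2 * (B ^+ 3 / 4)) / 4 - (t1 * (A ^+ 3 / 4) + t2 * (B ^+ 3 / 4)) / 4).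
    by field.
  by rewrite H3 subrr.
split => //; apply/eqP; rewrite -subr_eq0; apply/eqP.
  apply: (mulIf A0); apply: (mulIf AB); rewrite !mul0r.
  transitivity (((s1 - t1) * A ^+ 3 + (s2 - t2) * B ^+ 3) - B ^+ 2 * ((s1 - t1) * A + (s2 - t2) * B)).
    by ring.
  by rewrite G1 G3 mulr0 subr0.
apply: (mulIf B0); apply: (mulIf AB); rewrite !mul0r.
transitivity (A ^+ 2 * ((s1 - t1) * A + (s2 - t2) * B) - ((s1 - t1) * A ^+ 3 + (s2 - t2) * B ^+ 3)).
  by ring.
by rewrite G1 G3 mulr0 subr0.
Qed.

End CartanSubspace.

(** * Functions of the invariants *)

Section TwoByTwo.
Variable K : comUnitRingType.
Implicit Types A B M : 'M[K]_2.

Lemma ord2_1 : lift ord0 ord0 = 1 :> 'I_2.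
Proof. exact: val_inj. Qed.

Lemma mx2P A B : A 0 0 = B 0 0 -> A 0 1 = B 0 1 -> A 1 0 = B 1 0 -> A 1 1 = B 1 1 -> A = B.
Proof.
move=> e00 e01 e10 e11; apply/matrixP => i j.
have two (k : 'I_2) : k = 0 \/ k = 1.
  by case: k => [[|[|//]]] hk; [left|right]; apply: val_inj.
by case: (two i) => ->; case: (two j) => ->.
Qed.

Lemma mulmx2 A B i j : (A *m B) i j = A i 0 * B 0 j + A i 1 * B 1 j.
Proof. by rewrite mxE !big_ord_recl big_ord0 addr0 ord2_1. Qed.

Lemma trace2 A : \tr A = A 0 0 + A 1 1.
Proof. by rewrite /mxtrace !big_ord_recl big_ord0 addr0 ord2_1. Qed.

Lemma det2 A : \det A = A 0 0 * A 1 1 - A 0 1 * A 1 0.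
Proof.
have e : lift (1 : 'I_2) ord0 = 0 :> 'I_2 by exact: val_inj.
rewrite (expand_det_row _ ord0) !big_ord_recl big_ord0 addr0 ord2_1 /cofactor !det_mx11 !mxE.
by rewrite ord2_1 e expr0 expr1 mul1r mulN1r mulrN.
Qed.

Lemma det_antidiag (U W : 'M[K]_2) : \det (block_mx 0 U W 0) = \det U * \det W.
Proof.
(* The last three factors multiply to the block rotation with rows (0, 1) and (-1, 0) and have
   determinant 1; the sign on W disappears because the blocks have even size. *)
have -> : block_mx 0 U W 0 = block_mx U 0 0 (- W) *m
    (block_mx 1%:M 1%:M 0 1%:M *m (block_mx 1%:M 0 (- 1%:M) 1%:M *m block_mx 1%:M 1%:M 0 1%:M)).
  rewrite !mulmx_block !(mulmx0, mul0mx, mulmx1, mul1mx, addr0, add0r, mulmxN, mulNmx).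
  by rewrite !(subrr, addNr, opprK, addr0, add0r, mulmxN, mulmx1, mulmx0, oppr0).
rewrite !det_mulmx !det_ublock det_lblock !det1 !mulr1; congr (_ * _).
by rewrite -scaleN1r detZ sqrrN expr1n mul1r.
Qed.

Lemma Qf_antidiag (U W : 'M[K]_2) : (2 : K) \is a GRing.unit ->
  Qf (block_mx 0 U W 0) = \tr (U *m W).
Proof.
move=> u2; rewrite /Qf mulmx_block !(mul0mx, mulmx0, add0r, addr0) mxtrace_block.
rewrite [\tr (W *m U)]mxtrace_mulC; move: (\tr _) => t.
have -> : t + t = 2 * t by rewrite mulr_natl mulr2n.
by rewrite mulKr.
Qed.

Definition companion (t d : K) : 'M[K]_2 :=
  \matrix_(i, j) (if i == 0 then (j == 1)%:R else if j == 0 then - d else t).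

Lemma companion00 t d : companion t d 0 0 = 0. Proof. by rewrite mxE. Qed.
Lemma companion01 t d : companion t d 0 1 = 1. Proof. by rewrite mxE. Qed.
Lemma companion10 t d : companion t d 1 0 = - d. Proof. by rewrite mxE. Qed.
Lemma companion11 t d : companion t d 1 1 = t. Proof. by rewrite mxE. Qed.
Definition companionE := (companion00, companion01, companion10, companion11).

(* The rows of [krylov M x y] are [r] and [r *m M], for [r] the row (x, y). *)
Definition krylov M (x y : K) : 'M[K]_2 :=
  \matrix_(i, j) (if i == 0 then if j == 0 then x else y
    else x * M 0 j + y * M 1 j).

Lemma krylov00 M x y : krylov M x y 0 0 = x. Proof. by rewrite mxE. Qed.
Lemma krylov01 M x y : krylov M x y 0 1 = y. Proof. by rewrite mxE. Qed.
Lemma krylov1 M x y j : krylov M x y 1 j = x * M 0 j + y * M 1 j. Proof. by rewrite mxE. Qed.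
Definition krylovE := (krylov00, krylov01, krylov1).

(** Cayley-Hamilton applied to the row (x, y). *)
Lemma krylov_companion M x y : krylov M x y *m M = companion (\tr M) (\det M) *m krylov M x y.
Proof.
by apply: mx2P; rewrite !mulmx2 !companionE !krylovE ?trace2 ?det2; ring.
Qed.

End TwoByTwo.

(** The first basis row fails only if [M 0 1 = 0], the second only if [M 1 0 = 0]; then M is
    diagonal with distinct entries and the sum of the two rows is cyclic. *)
Lemma cyclic_vector (F : fieldType) (M : 'M[F]_2) : (\tr M) ^+ 2 - 4 * \det M != 0 ->
  exists x y, krylov M x y \in unitmx.
Proof.
move=> d0; have [b0|b0] := eqVneq (M 0 1) 0; last first.
  by exists 1, 0; rewrite unitmxE unitfE det2 !krylovE !mul0r subr0 !addr0 !mul1r.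
have [c0|c0] := eqVneq (M 1 0) 0; last first.
  by exists 0, 1; rewrite unitmxE unitfE det2 !krylovE !mul0r !add0r !mul1r oppr_eq0.
exists 1, 1; rewrite unitmxE unitfE det2 !krylovE !mul1r b0 c0 addr0 add0r.
apply: contra d0 => /eqP e; apply/eqP.
by transitivity ((M 1 1 - M 0 0) ^+ 2); [rewrite trace2 det2 b0; ring|rewrite e expr0n].
Qed.

(** * A slice for the action of H on regular elements *)

Section Slice.
Variable R : realType.
Local Notation C := R[i].
Local Notation V := 'M[R]_(2 + 2).
Implicit Types (X v : V) (U W : 'M[R]_2).

Definition qmx U W : V := block_mx 0 U W 0.

Lemma qset_qmx U W : qset (qmx U W).
Proof. by rewrite /qset /= /qmx block_mxKul block_mxKdr. Qed.

Lemma qsetE X : qset X -> X = qmx (ursubmx X) (dlsubmx X).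
Proof. by move=> [ul dr]; rewrite -[LHS]submxK ul dr. Qed.

Lemma Qf_qmx U W : Qf (qmx U W) = \tr (U *m W).
Proof.
by apply: Qf_antidiag; rewrite unitfE pnatr_eq0.
Qed.

Lemma Sf_qmx U W : Sf (qmx U W) = \det U * \det W.
Proof. exact: det_antidiag. Qed.

(** A section of the pair of invariants: the companion matrix has trace t and determinant d. *)
Definition slice (t d : R) : V := qmx (companion t d) 1%:M.

Lemma invariant_slice (f : V -> C) X : H_invariant f -> qreg X ->
  f X = f (slice (Qf X) (Sf X)).
Proof.
move=> Hf [Xq]; have := qsetE Xq; set U := ursubmx X; set W := dlsubmx X => XE.
rewrite {1}XE mulf_eq0 negb_or => /andP[S0 D0].
have Wu : W \in unitmx.
  by rewrite unitmxE unitfE; apply: contra S0 => /eqP W0; rewrite Sf_qmx W0 mulr0.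
have {}D0 : \tr (U *m W) ^+ 2 - 4 * \det (U *m W) != 0.
  by move: D0; rewrite XE /S0f Qf_qmx Sf_qmx det_mulmx.
have [x [y Au]] := cyclic_vector D0; set A := krylov (U *m W) x y in Au.
(* This choice turns the lower block into B W A^-1 = 1 and the upper one into A U W A^-1, which is
   the companion matrix of U W. The discriminant of U W is S0, hence the cyclic row. *)
pose B := A *m invmx W.
have Bu : B \in unitmx by rewrite unitmx_mul Au unitmx_inv.
rewrite -(Hf A B Au Bu X Xq); congr f.
have gu : block_mx A 0 0 B \in unitmx.
  by rewrite unitmxE det_ublock unitrM -!unitmxE Au Bu.
apply: (can_inj (mulmxK gu)); rewrite mulmxKV // XE Qf_qmx Sf_qmx /slice /qmx !mulmx_block.
rewrite !(mul0mx, mulmx0, add0r, addr0, mul1mx) -det_mulmx; congr block_mx.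
  by rewrite /B mulmxA -krylov_companion -/A !mulmxA mulmxK.
by rewrite /B mulmxKV.
Qed.

End Slice.

(** * Coordinates on q and first and second derivatives of the invariants *)

Section QCoordinates.
Variable R : realType.
Local Notation C := R[i].
Local Notation V := 'M[R]_(2 + 2).
Implicit Types (X Y u v : V) (i j k l : 'I_2).

Definition cu i j X : C := (X (lshift 2 i) (rshift 2 j))%:C%C.
Definition cw i j X : C := (X (rshift 2 i) (lshift 2 j))%:C%C.
Definition EU i j : V := qmx (delta_mx i j) 0.
Definition EW i j : V := qmx 0 (delta_mx i j).

Lemma cu_EU i j k l : cu i j (EU k l) = ((i == k) && (j == l))%:R.
Proof. by rewrite /cu block_mxEur mxE (rmorph_nat (real_complex R)). Qed.
Lemma cw_EU i j k l : cw i j (EU k l) = 0.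
Proof. by rewrite /cw block_mxEdl mxE. Qed.
Lemma cu_EW i j k l : cu i j (EW k l) = 0.
Proof. by rewrite /cu block_mxEur mxE. Qed.
Lemma cw_EW i j k l : cw i j (EW k l) = ((i == k) && (j == l))%:R.
Proof. by rewrite /cw block_mxEdl mxE (rmorph_nat (real_complex R)). Qed.

Lemma I2_01 : (0 == 1 :> 'I_2) = false. Proof. by []. Qed.
Lemma I2_10 : (1 == 0 :> 'I_2) = false. Proof. by []. Qed.
Definition coordE := (cu_EU, cw_EU, cu_EW, cw_EW, eqxx, I2_01, I2_10).

Lemma qset_EU i j : qset (EU i j). Proof. exact: qset_qmx. Qed.
Lemma qset_EW i j : qset (EW i j). Proof. exact: qset_qmx. Qed.

(* [U] and [W] are the off-diagonal blocks of X, [du] and [dw] their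
   determinants; [qc] and [sc] are Q and S.  [f1 X v] is the derivative of [f]
   at X along v, and [s2 X v u] that of [s1 ^~ v] along u. *)
Definition du X := cu 0 0 X * cu 1 1 X - cu 0 1 X * cu 1 0 X.
Definition dw X := cw 0 0 X * cw 1 1 X - cw 0 1 X * cw 1 0 X.
Definition qc X := cu 0 0 X * cw 0 0 X + cu 0 1 X * cw 1 0 X
  + cu 1 0 X * cw 0 1 X + cu 1 1 X * cw 1 1 X.
Definition sc X := du X * dw X.

Lemma Qf_coord X : qset X -> (Qf X)%:C%C = qc X.
Proof.
move=> /qsetE {1}->; rewrite Qf_qmx trace2 !mulmx2 !rmorphD !rmorphM !mxE /qc /cu /cw.
by rewrite !addrA.
Qed.

Lemma Sf_coord X : qset X -> (Sf X)%:C%C = sc X.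
Proof.
by move=> /qsetE {1}->; rewrite Sf_qmx !det2 rmorphM !rmorphB !rmorphM !mxE.
Qed.

Definition du1 X v := cu 0 0 v * cu 1 1 X + cu 0 0 X * cu 1 1 v
  - (cu 0 1 v * cu 1 0 X + cu 0 1 X * cu 1 0 v).
Definition dw1 X v := cw 0 0 v * cw 1 1 X + cw 0 0 X * cw 1 1 v
  - (cw 0 1 v * cw 1 0 X + cw 0 1 X * cw 1 0 v).
Definition q1 X v := cu 0 0 v * cw 0 0 X + cu 0 0 X * cw 0 0 v
  + (cu 0 1 v * cw 1 0 X + cu 0 1 X * cw 1 0 v)
  + (cu 1 0 v * cw 0 1 X + cu 1 0 X * cw 0 1 v)
  + (cu 1 1 v * cw 1 1 X + cu 1 1 X * cw 1 1 v).
Definition s1 X v := du1 X v * dw X + du X * dw1 X v.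
Definition s2 X v u := du1 u v * dw X + du1 X v * dw1 X u
  + (du1 X u * dw1 X v + du X * dw1 u v).

Lemma cder_cu i j X v : is_cder (cu i j) X v (cu i j v).
Proof. exact: cder_entry. Qed.
Lemma cder_cw i j X v : is_cder (cw i j) X v (cw i j v).
Proof. exact: cder_entry. Qed.

Lemma cder_du X v : is_cder du X v (du1 X v).
Proof. by apply: cderB; apply: cderM; exact: cder_cu. Qed.
Lemma cder_dw X v : is_cder dw X v (dw1 X v).
Proof. by apply: cderB; apply: cderM; exact: cder_cw. Qed.
Lemma cder_qc X v : is_cder qc X v (q1 X v).
Proof.
by apply: cderD; [apply: cderD; [apply: cderD|]|]; apply: cderM;
  (exact: cder_cu || exact: cder_cw).
Qed.
Lemma cder_sc X v : is_cder sc X v (s1 X v).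
Proof. by apply: cderM; [exact: cder_du|exact: cder_dw]. Qed.

Lemma cder_du1 X v u : is_cder (fun Y => du1 Y v) X u (du1 u v).
Proof.
apply: cder_eq; first by apply: cderB; apply: cderD; apply: cderM; (exact: cder_cst || exact: cder_cu).
by rewrite /du1; ring.
Qed.
Lemma cder_dw1 X v u : is_cder (fun Y => dw1 Y v) X u (dw1 u v).
Proof.
apply: cder_eq; first by apply: cderB; apply: cderD; apply: cderM; (exact: cder_cst || exact: cder_cw).
by rewrite /dw1; ring.
Qed.
Lemma cder_q1 X v u : is_cder (fun Y => q1 Y v) X u (q1 u v).
Proof.
apply: cder_eq.
  by apply: cderD; [apply: cderD; [apply: cderD|]|]; apply: cderD; apply: cderM;
    (exact: cder_cst || exact: cder_cu || exact: cder_cw).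
by rewrite /q1; ring.
Qed.
Lemma cder_s1 X v u : is_cder (fun Y => s1 Y v) X u (s2 X v u).
Proof.
by apply: cderD; apply: cderM; (exact: cder_du1 || exact: cder_dw1 || exact: cder_du || exact: cder_dw).
Qed.

End QCoordinates.

(** * Second and fourth order operators on functions of the invariants *)

Section ChainRule.
Variable R : realType.
Local Notation C := R[i].
Local Notation V := 'M[R]_(2 + 2).
Implicit Types (X Y u v : V) (F : nat -> nat -> V -> C) (i j : nat).

(* [F i j] behaves as the derivative of order (i, j) of a function of the
   invariants, evaluated at (Q, S). *)
Definition chain_family F := forall i j X v, qset X -> qset v ->
  is_cder (F i j) X v (F i.+1 j X * q1 X v + F i j.+1 X * s1 X v).

Let po := plane_open_qset R.

Lemma chain_cder2 F i j X v u : chain_family F -> qset X -> qset v -> qset u ->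
  is_cder (dder v (F i j)) X u
    ((F i.+2 j X * q1 X u + F i.+1 j.+1 X * s1 X u) * q1 X v + F i.+1 j X * q1 u v
    + ((F i.+1 j.+1 X * q1 X u + F i j.+2 X * s1 X u) * s1 X v + F i j.+1 X * s2 X v u)).
Proof.
move=> HF Xq vq uq.
apply: (cder_on po (f := fun Y => F i.+1 j Y * q1 Y v + F i j.+1 Y * s1 Y v)) => //.
  by move=> Y Yq; rewrite (cder_dder (HF i j Y v Yq vq)).
by apply: cderD; apply: cderM; [exact: HF|exact: cder_q1|exact: HF|exact: cder_s1].
Qed.

Lemma chain_dder2 F i j X v u : chain_family F -> qset X -> qset v -> qset u ->
  dder u (dder v (F i j)) X =
    (F i.+2 j X * q1 X u + F i.+1 j.+1 X * s1 X u) * q1 X v + F i.+1 j X * q1 u v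
    + ((F i.+1 j.+1 X * q1 X u + F i j.+2 X * s1 X u) * s1 X v + F i j.+1 X * s2 X v u).
Proof. by move=> HF Xq vq uq; apply: cder_dder; exact: chain_cder2. Qed.

(** The operator tr(d_U d_W) in the coordinates (Q, S). The term 4 F_Q counts the four products in Q
    = tr(U W). *)
Definition radial_Q F X := qc X * F 2 0 X + 4 * sc X * F 1 1 X + qc X * sc X * F 0 2 X
  + 4 * F 1 0 X + qc X * F 0 1 X.

Lemma chain_laplacian F X : chain_family F -> qset X ->
  dder (EW R 0 0) (dder (EU R 0 0) (F 0 0)) X + dder (EW R 1 0) (dder (EU R 0 1) (F 0 0)) X
  + dder (EW R 0 1) (dder (EU R 1 0) (F 0 0)) X + dder (EW R 1 1) (dder (EU R 1 1) (F 0 0)) X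
  = radial_Q F X.
Proof.
move=> HF Xq; rewrite !(chain_dder2 0 0 HF Xq (qset_EU _ _ _) (qset_EW _ _ _)).
rewrite /radial_Q /s2 /s1 /q1 /du1 /dw1 /sc /qc /du /dw !coordE /=.
by ring.
Qed.

(** For F a function of (Q, S), this is the (i, j) derivative of F_QQ + Q F_QS + S F_SS + 2 F_S, the
    cofactor of det W in det(d_U) F. Differentiating the coefficients Q and S contributes i + j to
    the factor of the last term. *)
Definition det_jet F i j X := F i.+2 j X + qc X * F i.+1 j.+1 X + sc X * F i j.+2 X
  + (i + j + 2)%:R * F i j.+1 X.

Lemma chain_det_jet F : chain_family F -> chain_family (det_jet F).
Proof.
move=> HF i j X v Xq vq; apply: cder_eq.
  apply: cderD; [apply: cderD; [apply: cderD|]|].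
  - exact: HF.
  - by apply: cderM; [exact: cder_qc|exact: HF].
  - by apply: cderM; [exact: cder_sc|exact: HF].
  - by apply: cderM; [exact: cder_cst|exact: HF].
rewrite /det_jet; have -> : (i.+1 + j + 2)%:R = (i + j + 2)%:R + 1 :> C.
  by rewrite natr1 !addSn.
have -> : (i + j.+1 + 2)%:R = (i + j + 2)%:R + 1 :> C.
  by rewrite natr1 (addnS i) addSn.
by ring.
Qed.

Lemma chain_detU F X : chain_family F -> qset X ->
  dder (EU R 0 0) (dder (EU R 1 1) (F 0 0)) X - dder (EU R 0 1) (dder (EU R 1 0) (F 0 0)) X
  = dw X * det_jet F 0 0 X.
Proof.
move=> HF Xq; rewrite !(chain_dder2 0 0 HF Xq (qset_EU _ _ _) (qset_EU _ _ _)).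
rewrite /det_jet /s2 /s1 /q1 /du1 /dw1 /sc /qc /du /dw !coordE /=.
by ring.
Qed.

Lemma cder2_dwM F X v u : chain_family F -> qset X -> qset v -> qset u ->
  dder u (dder v (fun Y => dw Y * F 0 0 Y)) X =
   dw1 u v * F 0 0 X + dw1 X v * (F 1 0 X * q1 X u + F 0 1 X * s1 X u)
   + (dw1 X u * (F 1 0 X * q1 X v + F 0 1 X * s1 X v)
   + dw X * ((F 2 0 X * q1 X u + F 1 1 X * s1 X u) * q1 X v + F 1 0 X * q1 u v
    + ((F 1 1 X * q1 X u + F 0 2 X * s1 X u) * s1 X v + F 0 1 X * s2 X v u))).
Proof.
move=> HF Xq vq uq; apply: cder_dder.
apply: (cder_on po (f := fun Y => dw1 Y v * F 0 0 Y + dw Y * (F 1 0 Y * q1 Y v + F 0 1 Y * s1 Y v))) => //.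
  by move=> Y Yq; apply/esym/cder_dder/cderM; [exact: cder_dw|exact: HF].
apply: cderD; apply: cderM; [exact: cder_dw1|exact: HF|exact: cder_dw|].
by apply: cderD; apply: cderM; [exact: HF|exact: cder_q1|exact: HF|exact: cder_s1].
Qed.

(** The second stage, det(d_W) applied to det W times a function of the invariants; the constant
    term is det(d_W) det W = 2. *)
Definition radial_S F X := sc X * F 2 0 X + qc X * sc X * F 1 1 X + sc X ^+ 2 * F 0 2 X
  + qc X * F 1 0 X + 4 * sc X * F 0 1 X + 2 * F 0 0 X.

Lemma chain_detW F X : chain_family F -> qset X ->
  dder (EW R 0 0) (dder (EW R 1 1) (fun Y => dw Y * F 0 0 Y)) X
  - dder (EW R 0 1) (dder (EW R 1 0) (fun Y => dw Y * F 0 0 Y)) X = radial_S F X.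
Proof.
move=> HF Xq; rewrite !(cder2_dwM HF Xq (qset_EW _ _ _) (qset_EW _ _ _)).
rewrite /radial_S /s2 /s1 /q1 /du1 /dw1 /sc /qc /du /dw !coordE /=.
by ring.
Qed.

Definition slice1 : V := qmx (delta_mx 1 1) 0.
Definition slice2 : V := qmx (- delta_mx 1 0) 0.
Definition slice0 : V := qmx (delta_mx 0 1) 1%:M.

Lemma sliceE (t d : R) : slice t d = t *: slice1 + d *: slice2 + slice0.
Proof.
rewrite /slice /slice1 /slice2 /slice0 /qmx !scale_block_mx !add_block_mx.
rewrite !scaler0 !addr0 !add0r; congr block_mx.
by apply: mx2P; rewrite !mxE /=; ring.
Qed.

Lemma qset_slice (t d : R) : qset (slice t d). Proof. exact: qset_qmx. Qed.

(** The (i, j) partial derivative of the function sending (t, d) to [f (slice t d)], evaluated at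
    the invariants of X. *)
Definition slice_jet (f : V -> C) i j X :=
  iter_dder (nseq i slice1 ++ nseq j slice2) f (slice (Qf X) (Sf X)).

Lemma slice_word i j v : v \in nseq i slice1 ++ nseq j slice2 -> qset v.
Proof. by rewrite mem_cat => /orP[] /nseqP[-> _]; exact: qset_qmx. Qed.

(** The slice is an affine plane, so moving X along v moves the evaluation point along a curve in
    that plane with coordinates Q and S, and [cder_plane] applies. *)
Lemma chain_slice_jet f : smooth_on (@qset R) (@qset R) f -> chain_family (slice_jet f).
Proof.
move=> sf i j X v Xq vq.
pose g := iter_dder (nseq i slice1 ++ nseq j slice2) f.
have sg : smooth_on (@qset R) (@qset R) g by exact: (smooth_iter sf (@slice_word i j)).
(* [cder_plane] wants real curves, whereas [q1] and [s1] are complex-valued; derivatives of real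
   functions are real. *)
have real (p : V -> R) l : is_cder (fun Y => (p Y)%:C%C) X v l ->
    is_derive (0 : R) 1 (fun t : R => p (t *: v + X)) (complex.Re l) /\ l = (complex.Re l)%:C%C.
  move=> h; have /cder_line[h1 _] := h; split; first exact: h1.
  have [_ h2] := h; apply: complex_eqP => //=.
  exact: (is_derive_uniq h2 (is_derive_cst 0 X v)).
have hq : is_cder (fun Y => (Qf Y)%:C%C) X v (q1 X v).
  by apply: (cder_on po _ vq Xq (cder_qc X v)) => Y Yq; rewrite Qf_coord.
have hs : is_cder (fun Y => (Sf Y)%:C%C) X v (s1 X v).
  by apply: (cder_on po _ vq Xq (cder_sc X v)) => Y Yq; rewrite Sf_coord.
have [dq eq] := real _ _ hq; have [ds es] := real _ _ hs.
have q1' : qset slice1 by exact: qset_qmx.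
have q2' : qset slice2 by exact: qset_qmx.
have XE : slice (Qf ((0 : R) *: v + X)) (Sf ((0 : R) *: v + X)) = slice (Qf X) (Sf X).
  by rewrite scale0r add0r.
have := @cder_plane _ _ _ g slice1 slice2 slice0 _ _ _ _ 0 po sg q1' q2' _ dq ds.
rewrite -sliceE XE -eq -es => /(_ (qset_slice _ _)) H.
have -> : slice_jet f i.+1 j X = dder slice1 g (slice (Qf X) (Sf X)) by [].
have -> : slice_jet f i j.+1 X = dder slice2 g (slice (Qf X) (Sf X)).
  rewrite /g (iter_dderC po sf q2' (@slice_word i j) (qset_slice _ _)).
  rewrite /iter_dder -foldr_rcons rcons_cat.
  by rewrite -cats1 -[[:: slice2]]/(nseq 1 slice2) -nseqD addn1.
apply/cder_line; move: H; rewrite /is_cder.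
have P t : Qf (t *: v + X) *: slice1 + Sf (t *: v + X) *: slice2 + slice0 = 
  slice (Qf (t *: v + X)) (Sf (t *: v + X)) by rewrite sliceE.
under eq_fun do rewrite P; under [X in _ /\ is_derive _ _ X _]eq_fun do rewrite P.
by [].
Qed.

End ChainRule.

(** * The operators attached to Q and S as explicit iterated derivatives *)

Section ConstantCoefficients.
Variable R : realType.
Local Notation C := R[i].
Local Notation V := 'M[R]_(2 + 2).
Local Notation Q := (@qset R).
Implicit Types (X Y u v : V) (f : V -> C) (p : mpoly nq C) (ks : seq 'I_nq).

Let po := plane_open_qset R.

Lemma iter_dder_cat (s t : seq V) f : iter_dder (s ++ t) f = iter_dder s (iter_dder t f).
Proof. by rewrite /iter_dder foldr_cat. Qed.

(** [dpoly] lists the directions of a monomial in the order of the index type, which is not the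
    order in which the factors are written. *)
Lemma iter_dder_perm (s t : seq V) f X : smooth_on Q Q f -> perm_eq s t ->
  (forall v, v \in s -> Q v) -> Q X -> iter_dder s f X = iter_dder t f X.
Proof.
move=> sf; elim: s t X => [|v s IH] t X.
  by rewrite perm_sym => /perm_nilP ->.
move=> st Qs Xq; have vt : v \in t by rewrite -(perm_mem st) mem_head.
have Qv : Q v by apply: Qs; rewrite mem_head.
have Qs' u : u \in s -> Q u by move=> us; apply: Qs; rewrite inE us orbT.
have /rot_to[k t' tE] := vt.
have [t1 [t2 tE']] : exists t1 t2, t = t1 ++ v :: t2.
  by case/splitPr: vt => t1 t2; exists t1, t2.
subst t; have st' : perm_eq s (t1 ++ t2).
  by rewrite -(perm_cons v) (perm_trans st) // perm_catC /= perm_cons perm_catC.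
have Q12 u : u \in t1 ++ t2 -> Q u by rewrite -(perm_mem st'); exact: Qs'.
have Q1 u : u \in t1 -> Q u by move=> h; apply: Q12; rewrite mem_cat h.
have Q2 u : u \in t2 -> Q u by move=> h; apply: Q12; rewrite mem_cat h orbT.
rewrite iter_dder_cat /= -(iter_dderC po (smooth_iter sf Q2) Qv Q1 Xq) -iter_dder_cat.
apply: (dder_on po (smooth_iter sf Qs') _ Qv Xq) => Y Yq.
exact: (IH _ Y st' Qs' Yq).
Qed.

(** The origin of 4 = 2^2 and 16 = 2^4: every dual direction carries a factor 2. *)
Lemma iter_dder_double (vs : seq V) f X : smooth_on Q Q f ->
  (forall v, v \in vs -> Q v) -> Q X ->
  iter_dder [seq 2 *: v | v <- vs] f X = 2 ^+ size vs * iter_dder vs f X.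
Proof.
move=> sf; elim: vs X => [|v vs IH] X Qs Xq; first by rewrite /= mul1r.
have Qv : Q v by apply: Qs; rewrite mem_head.
have Qs' u : u \in vs -> Q u by move=> us; apply: Qs; rewrite inE us orbT.
have si := smooth_iter sf Qs'.
have s2 := smooth_mul po (smooth_cst po (2 ^+ size vs)) si.
rewrite /= -(dder_on po (v := 2 *: v) s2 _ _ Xq); last 2 first.
- by move=> Y Yq; rewrite IH.
- rewrite -[2 *: v]addr0; apply: (proj1 po) => //.
  by split; apply/matrixP => i j; rewrite !mxE.
have -> : 2 *: v = 2 *: v + (0 : R) *: v by rewrite scale0r addr0.
rewrite (dder_lin po _ _ s2 Qv Qv Xq) mulr0 addr0 (dder_scale _ si Qv Xq).
by rewrite (rmorph_nat (real_complex R) 2) /= exprS; ring.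
Qed.

Definition mword (m : multinom nq) : seq V :=
  flatten [seq nseq (m k) (coord_dir R k) | k <- enum 'I_nq].

(** Enlarging the support by zero coefficients puts several polynomials over one common list, where
    additivity is termwise. *)
Lemma dpoly_supp p (s : seq (multinom nq)) f X : uniq s -> {subset msupp p <= s} ->
  dpoly p f X = \sum_(m <- s) mcoeff m p * iter_dder (mword m) f X.
Proof.
move=> us sub; rewrite [RHS](bigID (mem (msupp p))) /= [X in _ + X]big1 ?addr0; last first.
  by move=> m /memN_msupp_eq0 ->; rewrite mul0r.
rewrite -big_filter; apply: perm_big; apply: uniq_perm; rewrite ?msupp_uniq ?filter_uniq //.
by move=> m; rewrite mem_filter; case: (boolP (m \in msupp p)) => [/sub ->|].
Qed.

Lemma dpolyD p q f X : dpoly (p + q) f X = dpoly p f X + dpoly q f X.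
Proof.
pose s := undup (msupp p ++ msupp q ++ msupp (p + q)).
have us : uniq s by exact: undup_uniq.
rewrite !(@dpoly_supp _ s) // -?big_split /=.
- by apply: eq_bigr => m _; rewrite mcoeffD mulrDl.
- by move=> m h; rewrite mem_undup !mem_cat h ?orbT.
- by move=> m h; rewrite mem_undup !mem_cat h ?orbT.
- by move=> m h; rewrite mem_undup !mem_cat h ?orbT.
Qed.

Lemma dpolyN p f X : dpoly (- p) f X = - dpoly p f X.
Proof.
pose s := undup (msupp p ++ msupp (- p)).
have us : uniq s by exact: undup_uniq.
rewrite !(@dpoly_supp _ s) // -?sumrN.
- by apply: eq_bigr => m _; rewrite mcoeffN mulNr.
- by move=> m h; rewrite mem_undup !mem_cat h ?orbT.
- by move=> m h; rewrite mem_undup !mem_cat h ?orbT.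
Qed.

Lemma dpoly_sum4 p1 p2 p3 p4 f X : dpoly (p1 + p2 + p3 + p4) f X =
  dpoly p1 f X + dpoly p2 f X + dpoly p3 f X + dpoly p4 f X.
Proof. by rewrite !dpolyD. Qed.

Lemma dpoly_det4 p1 p2 p3 p4 f X : dpoly (p1 - p2 - (p3 - p4)) f X =
  dpoly p1 f X - dpoly p2 f X - (dpoly p3 f X - dpoly p4 f X).
Proof. by rewrite !(dpolyD, dpolyN). Qed.

Lemma scale_sum4 (c x1 x2 x3 x4 y1 y2 y3 y4 : C) :
  x1 = c * y1 -> x2 = c * y2 -> x3 = c * y3 -> x4 = c * y4 ->
  x1 + x2 + x3 + x4 = c * (y1 + y2 + y3 + y4).
Proof. by move=> -> -> -> ->; rewrite !mulrDr. Qed.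

Lemma scale_det4 (c x1 x2 x3 x4 y1 y2 y3 y4 : C) :
  x1 = c * y1 -> x2 = c * y2 -> x3 = c * y3 -> x4 = c * y4 ->
  x1 - x2 - (x3 - x4) = c * (y1 - y2 - (y3 - y4)).
Proof. by move=> -> -> -> ->; rewrite !mulrBr. Qed.

Definition mnm_of ks : multinom nq := foldr (fun k m => mnm_add (mnm1 k) m) (@mnm0 nq) ks.
Definition monomial ks : mpoly nq C := foldr (fun k p => mpolyX C (mnm1 k) * p) 1 ks.

Lemma monomialE ks : monomial ks = mpolyX C (mnm_of ks).
Proof. by elim: ks => [|k ks IH] /=; [rewrite mpolyX0|rewrite mpolyXD IH]. Qed.

Lemma mnm_ofE ks k : mnm_of ks k = count_mem k ks.
Proof. by elim: ks => [|l ks IH] /=; [rewrite mnm0E|rewrite mnmDE mnm1E IH]. Qed.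

Lemma dpoly_monomial ks f X : uniq ks -> smooth_on Q Q f -> Q X ->
  (forall k, k \in ks -> Q (coord_dir R k)) ->
  dpoly (monomial ks) f X = iter_dder [seq coord_dir R k | k <- ks] f X.
Proof.
move=> uk sf Xq Qk; rewrite /dpoly monomialE msuppX big_seq1 mcoeffX eqxx mul1r.
have pe : perm_eq [seq coord_dir R k | k <- ks]
    (flatten [seq nseq (mnm_of ks k) (coord_dir R k) | k <- enum 'I_nq]).
  have -> : flatten [seq nseq (mnm_of ks k) (coord_dir R k) | k <- enum 'I_nq] =
      [seq coord_dir R k | k <- [seq k <- enum 'I_nq | k \in ks]].
    elim: (enum 'I_nq) => //= k s ->; rewrite mnm_ofE count_uniq_mem //.
    by case: (k \in ks).
  apply: perm_map; apply: uniq_perm; [exact: uk|exact/filter_uniq/enum_uniq|].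
  by move=> k; rewrite mem_filter mem_enum andbT.
by apply/esym/(iter_dder_perm sf pe) => // v /mapP[k /Qk h ->].
Qed.

Definition kU (i j : 'I_2) : 'I_nq := lshift (2 * 2) (mxvec_index i j).
Definition kW (i j : 'I_2) : 'I_nq := rshift (2 * 2) (mxvec_index i j).

(** The trace pairing matches the U block with the transposed W block, and the 2 compensates the
    half in [omega]; thus a coordinate of U acts as a derivative in W. *)
Lemma coord_dir_kU i j : coord_dir R (kU i j) = 2 *: EW R j i.
Proof.
rewrite /coord_dir /kU -[lshift _ _]/(unsplit (inl _)) unsplitK vec_mx_delta trmx_delta.
by rewrite /EW /qmx scale_block_mx !scaler0.
Qed.

Lemma coord_dir_kW i j : coord_dir R (kW i j) = 2 *: EU R j i.
Proof.
rewrite /coord_dir /kW -[rshift _ _]/(unsplit (inr _)) unsplitK vec_mx_delta trmx_delta.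
by rewrite /EU /qmx scale_block_mx !scaler0.
Qed.

Lemma mxvec_index_inj (i j k l : 'I_2) :
  (mxvec_index i j == mxvec_index k l) = (i == k) && (j == l).
Proof.
apply/eqP/andP => [h|[/eqP -> /eqP ->] //].
have := congr1 (fun q => vec_mx (delta_mx 0 q : 'rV[R]_(2 * 2)) k l) h.
rewrite !vec_mx_delta !mxE !eqxx /= [k == i]eq_sym [l == j]eq_sym.
by case: (i == k); case: (j == l) => // /eqP; rewrite eq_sym oner_eq0.
Qed.

Lemma kUU i j k l : (kU i j == kU k l) = (i == k) && (j == l).
Proof. by rewrite (inj_eq (@lshift_inj _ _)) mxvec_index_inj. Qed.
Lemma kWW i j k l : (kW i j == kW k l) = (i == k) && (j == l).
Proof. by rewrite (inj_eq (@rshift_inj _ _)) mxvec_index_inj. Qed.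
Lemma kUW i j k l : (kU i j == kW k l) = false.
Proof. exact: eq_lrshift. Qed.

Lemma qset_double v : Q v -> Q (2 *: v).
Proof. by move=> [h1 h2]; rewrite -[_ *: v]addr0; apply: (proj1 po) => //; split; apply/matrixP => i j; rewrite !mxE. Qed.

Lemma generic_qE : generic_q R = block_mx 0 (\matrix_(i, j) mpolyX C (mnm1 (kU i j)))
  (\matrix_(i, j) mpolyX C (mnm1 (kW i j))) 0.
Proof.
rewrite /generic_q; congr block_mx; apply/matrixP => i j; rewrite !mxE //.
Qed.

Lemma unit2_mpoly : (2 : mpoly nq C) \is a GRing.unit.
Proof.
rewrite -(rmorph_nat (mpolyC nq (R := C)) 2); apply: rmorph_unit.
by rewrite unitfE pnatr_eq0.
Qed.

(** The trailing factors 1 reproduce the unfolded [monomial]. The expansion is kept over an abstract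
    ring, away from the polynomial structure. *)
Lemma monomial_trace (K : pzRingType) (a b c d e f g h : K) :
  a * b + c * d + (e * f + g * h) = a * (b * 1) + c * (d * 1) + e * (f * 1) + g * (h * 1).
Proof. by rewrite !mulr1 !addrA. Qed.

Lemma monomial_det (K : comPzRingType) (a b c d e f g h : K) :
  (a * b - c * d) * (e * f - g * h) =
  a * (b * (e * (f * 1))) - a * (b * (h * (g * 1)))
  - (d * (c * (e * (f * 1))) - d * (c * (h * (g * 1)))).
Proof. by rewrite [c * d]mulrC [g * h]mulrC mulrBl !mulrBr !mulr1 !mulrA. Qed.

Lemma Qf_generic : Qf (generic_q R) = monomial [:: kU 0 0; kW 0 0] + monomial [:: kU 0 1; kW 1 0]
  + monomial [:: kU 1 0; kW 0 1] + monomial [:: kU 1 1; kW 1 1].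
Proof.
rewrite generic_qE (Qf_antidiag _ _ unit2_mpoly) trace2 !mulmx2 !mxE.
exact: monomial_trace.
Qed.

Lemma Sf_generic : Sf (generic_q R) =
  monomial [:: kU 0 0; kU 1 1; kW 0 0; kW 1 1] - monomial [:: kU 0 0; kU 1 1; kW 1 0; kW 0 1]
  - (monomial [:: kU 1 0; kU 0 1; kW 0 0; kW 1 1] - monomial [:: kU 1 0; kU 0 1; kW 1 0; kW 0 1]).
Proof.
rewrite generic_qE /Sf det_antidiag !det2 !mxE.
exact: monomial_det.
Qed.

Lemma dpoly_Qf f X : smooth_on Q Q f -> Q X ->
  dpoly (Qf (generic_q R)) f X = 4 *
  (dder (EW R 0 0) (dder (EU R 0 0) f) X + dder (EW R 1 0) (dder (EU R 0 1) f) X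
  + dder (EW R 0 1) (dder (EU R 1 0) f) X + dder (EW R 1 1) (dder (EU R 1 1) f) X).
Proof.
move=> sf Xq; rewrite Qf_generic dpoly_sum4.
have two i j k l : dpoly (monomial [:: kU i j; kW k l]) f X =
    4 * dder (EW R j i) (dder (EU R l k) f) X.
  rewrite dpoly_monomial //= ?inE ?kUW //.
    rewrite coord_dir_kU coord_dir_kW.
    have := iter_dder_double (vs := [:: EW R j i; EU R l k]) sf _ Xq.
    rewrite /= expr2 -natrM => -> // v.
    by rewrite !inE => /orP[/eqP ->|/eqP ->]; exact: qset_qmx.
  move=> m; rewrite !inE => /orP[/eqP ->|/eqP ->]; rewrite ?coord_dir_kU ?coord_dir_kW;
    exact/qset_double/qset_qmx.
exact: (scale_sum4 (two 0 0 0 0) (two 0 1 1 0) (two 1 0 0 1) (two 1 1 1 1)).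
Qed.

(** det X = det U det W becomes a composition of two second order operators, each of which can be
    applied separately to functions of the invariants. *)
Lemma dpoly_Sf f X : smooth_on Q Q f -> Q X ->
  dpoly (Sf (generic_q R)) f X = 16 *
  (dder (EW R 0 0) (dder (EW R 1 1) (fun Y => dder (EU R 0 0) (dder (EU R 1 1) f) Y
      - dder (EU R 0 1) (dder (EU R 1 0) f) Y)) X
  - dder (EW R 0 1) (dder (EW R 1 0) (fun Y => dder (EU R 0 0) (dder (EU R 1 1) f) Y
      - dder (EU R 0 1) (dder (EU R 1 0) f) Y)) X).
Proof.
move=> sf Xq; rewrite Sf_generic dpoly_det4.
have four i j k l i' j' k' l' : uniq [:: kU i j; kU k l; kW i' j'; kW k' l'] ->
    dpoly (monomial [:: kU i j; kU k l; kW i' j'; kW k' l']) f X =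
    16 * dder (EW R j i) (dder (EW R l k) (dder (EU R j' i') (dder (EU R l' k') f))) X.
  move=> u4; rewrite dpoly_monomial //=.
    rewrite !coord_dir_kU !coord_dir_kW.
    have := iter_dder_double (vs := [:: EW R j i; EW R l k; EU R j' i'; EU R l' k']) sf _ Xq.
    rewrite /= -natrX => -> // v.
    by rewrite !inE => /or4P[] /eqP ->; exact: qset_qmx.
  move=> m; rewrite !inE => /or4P[] /eqP ->; rewrite ?coord_dir_kU ?coord_dir_kW;
    exact/qset_double/qset_qmx.
have u4 i j k l i' j' k' l' : (i == k) && (j == l) = false -> (i' == k') && (j' == l') = false ->
    uniq [:: kU i j; kU k l; kW i' j'; kW k' l'].
  by move=> h1 h2; rewrite /= !inE kUU kWW !kUW h1 h2.
have QU i j : Q (EU R i j) by exact: qset_qmx.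
have QW i j : Q (EW R i j) by exact: qset_qmx.
have su i j k l : smooth_on Q Q (dder (EU R i j) (dder (EU R k l) f)).
  exact: smooth_dder (smooth_dder sf (QU k l)) (QU i j).
have lin i j k l : dder (EW R i j) (dder (EW R k l) (fun Y => dder (EU R 0 0) (dder (EU R 1 1) f) Y
      - dder (EU R 0 1) (dder (EU R 1 0) f) Y)) X =
    dder (EW R i j) (dder (EW R k l) (dder (EU R 0 0) (dder (EU R 1 1) f))) X
    - dder (EW R i j) (dder (EW R k l) (dder (EU R 0 1) (dder (EU R 1 0) f))) X.
  set g := dder (EU R 0 0) _; set h := dder (EU R 0 1) _.
  have sg : smooth_on Q Q g by exact: su.
  have sh : smooth_on Q Q h by exact: su.
  have sgh : smooth_on Q Q (fun Y => g Y - h Y).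
    apply: (smooth_ext po (smooth_add po sg (smooth_mul po (smooth_cst po (-1)) sh))) => Y _.
    by rewrite mulN1r.
  apply: cder_dder.
  apply: (cder_on po (f := fun Y => dder (EW R k l) g Y - dder (EW R k l) h Y)) => //.
    move=> Y Yq; apply/esym/cder_dder/cderB.
      exact: (smooth_cder sg (QW k l) Yq).
    exact: (smooth_cder sh (QW k l) Yq).
  apply: cderB.
    exact: (smooth_cder (smooth_dder sg (QW k l)) (QW i j) Xq).
  exact: (smooth_cder (smooth_dder sh (QW k l)) (QW i j) Xq).
apply: (etrans _ (congr2 (fun x y => 16 * (x - y)) (esym (lin 0 0 1 1)) (esym (lin 0 1 1 0)))).
apply: (scale_det4 (four 0 0 1 1 0 0 1 1 _) (four 0 0 1 1 1 0 0 1 _)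
  (four 1 0 0 1 0 0 1 1 _) (four 1 0 0 1 1 0 0 1 _)); exact: u4.
Qed.

End ConstantCoefficients.

(** * The two operators on invariant functions at regular points *)

Section InvariantFunctions.
Variable R : realType.
Local Notation C := R[i].
Local Notation V := 'M[R]_(2 + 2).
Local Notation Q := (@qset R).
Variables (f : V -> C) (sf : smooth_on Q Q f) (Hf : H_invariant f).

Let po := plane_open_qset R.
Let po' := plane_open_qreg R.

Lemma qreg_qset : @qreg R `<=` Q. Proof. by move=> X []. Qed.

Lemma smooth_qreg (g : V -> C) : smooth_on Q Q g -> smooth_on Q (@qreg R) g.
Proof. by apply: smooth_sub => //; exact: qreg_qset. Qed.

Lemma slice_jetE X : qreg X -> f X = slice_jet f 0 0 X.
Proof. exact: invariant_slice. Qed.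

(** An invariant f agrees with its slice jet only on the regular set; that set being open in q,
    derivatives agree as well. *)
Lemma dder2_qreg (g h : V -> C) u v X : smooth_on Q Q g ->
  (forall Y, qreg Y -> g Y = h Y) -> Q u -> Q v -> qreg X ->
  dder u (dder v g) X = dder u (dder v h) X.
Proof.
move=> sg gh uq vq Xr.
have H w : w \in [:: u; v] -> Q w by rewrite !inE => /orP[] /eqP ->.
exact: (iter_dder_on po' (smooth_qreg sg) gh H Xr).
Qed.

Lemma scaled_sum4_eq (c x1 x2 x3 x4 y1 y2 y3 y4 : C) :
  x1 = y1 -> x2 = y2 -> x3 = y3 -> x4 = y4 ->
  c * (x1 + x2 + x3 + x4) = c * (y1 + y2 + y3 + y4).
Proof. by move=> -> -> -> ->. Qed.

Lemma scaled_diff_eq (c x1 x2 y1 y2 : C) :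
  x1 = y1 -> x2 = y2 -> c * (x1 - x2) = c * (y1 - y2).
Proof. by move=> -> ->. Qed.

Lemma diff_eq (x1 x2 y1 y2 : C) : x1 = y1 -> x2 = y2 -> x1 - x2 = y1 - y2.
Proof. by move=> -> ->. Qed.

Lemma dpoly_Qf_radial X : qreg X ->
  dpoly (Qf (generic_q R)) f X = 4 * radial_Q (slice_jet f) X.
Proof.
move=> Xr; have Xq := qreg_qset Xr.
have D i j k l := dder2_qreg sf slice_jetE (qset_EW R i j) (qset_EU R k l) Xr.
apply: (etrans (dpoly_Qf sf Xq)).
apply: (etrans _ (congr1 (fun z : C => 4 * z) (chain_laplacian (chain_slice_jet sf) Xq))).
exact: (scaled_sum4_eq 4 (D 0 0 0 0) (D 1 0 0 1) (D 0 1 1 0) (D 1 1 1 1)).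
Qed.

Lemma dpoly_Sf_radial X : qreg X ->
  dpoly (Sf (generic_q R)) f X = 16 * radial_S (det_jet (slice_jet f)) X.
Proof.
move=> Xr; have Xq := qreg_qset Xr.
have HF := chain_slice_jet sf.
pose g Y := dder (EU R 0 0) (dder (EU R 1 1) f) Y - dder (EU R 0 1) (dder (EU R 1 0) f) Y.
have s1' : smooth_on Q Q (dder (EU R 0 0) (dder (EU R 1 1) f)).
  exact: smooth_dder (smooth_dder sf (qset_EU R 1 1)) (qset_EU R 0 0).
have s2' : smooth_on Q Q (dder (EU R 0 1) (dder (EU R 1 0) f)).
  exact: smooth_dder (smooth_dder sf (qset_EU R 1 0)) (qset_EU R 0 1).
have sg : smooth_on Q Q g.
  apply: (smooth_ext po (smooth_add po s1' (smooth_mul po (smooth_cst po (-1)) s2'))) => Y _.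
  by rewrite mulN1r.
have gE Y : qreg Y -> g Y = dw Y * det_jet (slice_jet f) 0 0 Y.
  move=> Yr; apply: (etrans _ (chain_detU HF (qreg_qset Yr))).
  have D i j k l := dder2_qreg sf slice_jetE (qset_EU R i j) (qset_EU R k l) Yr.
  exact: (diff_eq (D 0 0 1 1) (D 0 1 1 0)).
have D i j k l := dder2_qreg sg gE (qset_EW R i j) (qset_EW R k l) Xr.
apply: (etrans (dpoly_Sf sf Xq)).
apply: (etrans _ (congr1 (fun z : C => 16 * z) (chain_detW (chain_det_jet HF) Xq))).
exact: (scaled_diff_eq 16 (D 0 0 1 1) (D 0 1 1 0)).
Qed.

End InvariantFunctions.

(** * Radial parts *)

Section RadialCoordinates.
Variable R : realType.
Local Notation C := R[i].
Local Notation V := 'M[R]_(2 + 2).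
Variables (a : {vspace V}) (a1 a2 : V -> C).
Hypothesis aq : [set` a] `<=` @qset R.
Hypothesis cder1 : forall X v, X \in a -> v \in a -> is_cder a1 X v (a1 v).
Hypothesis cder2 : forall X v, X \in a -> v \in a -> is_cder a2 X v (a2 v).
Implicit Types (X Y v : V) (G H : V -> C).

Let po : plane_open [set` a] (areg a) := plane_open_areg aq.

Definition cu1 X := a1 X * a1 X / 4.
Definition cu2 X := a2 X * a2 X / 4.

Hypothesis qcE : forall X, X \in a -> qc X = cu1 X + cu2 X.
Hypothesis scE : forall X, X \in a -> sc X = cu1 X * cu2 X.

(* [G1] and [G2] are the partial derivatives of [G] with respect to the
   eigenvalues [cu1] and [cu2] of UV. *)
Definition has_partials G G1 G2 := forall X v, areg a X -> v \in a ->
  is_cder G X v (G1 X * (a1 X * a1 v / 2) + G2 X * (a2 X * a2 v / 2)).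

Lemma partials_cst c : has_partials (fun=> c) (fun=> 0) (fun=> 0).
Proof. by move=> X v _ _; apply: (cder_eq (cder_cst c X v)); rewrite !mul0r addr0. Qed.

Lemma partials_add G G1 G2 H H1 H2 : has_partials G G1 G2 -> has_partials H H1 H2 ->
  has_partials (fun X => G X + H X) (fun X => G1 X + H1 X) (fun X => G2 X + H2 X).
Proof.
move=> hG hH X v Xr va; apply: (cder_eq (cderD (hG X v Xr va) (hH X v Xr va))).
by rewrite !mulrDl addrACA.
Qed.

Lemma partials_sub G G1 G2 H H1 H2 : has_partials G G1 G2 -> has_partials H H1 H2 ->
  has_partials (fun X => G X - H X) (fun X => G1 X - H1 X) (fun X => G2 X - H2 X).
Proof.
move=> hG hH X v Xr va; apply: (cder_eq (cderB (hG X v Xr va) (hH X v Xr va))).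
by rewrite !mulrBl opprD addrACA.
Qed.

Lemma partials_mul G G1 G2 H H1 H2 : has_partials G G1 G2 -> has_partials H H1 H2 ->
  has_partials (fun X => G X * H X) (fun X => G1 X * H X + G X * H1 X)
    (fun X => G2 X * H X + G X * H2 X).
Proof.
move=> hG hH X v Xr va; apply: (cder_eq (cderM (hG X v Xr va) (hH X v Xr va))).
move: (a1 X * a1 v / 2) (a2 X * a2 v / 2) => x y.
by ring.
Qed.

Lemma partials_cu1 : has_partials cu1 (fun=> 1) (fun=> 0).
Proof.
move=> X v [Xa _] va.
have h := cderM (cderM (cder1 Xa va) (cder1 Xa va)) (cder_cst (4^-1) X v).
by apply: (cder_eq h); field.
Qed.

Lemma partials_cu2 : has_partials cu2 (fun=> 0) (fun=> 1).
Proof.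
move=> X v [Xa _] va.
have h := cderM (cderM (cder2 Xa va) (cder2 Xa va)) (cder_cst (4^-1) X v).
by apply: (cder_eq h); field.
Qed.

Lemma partials_on G H G1 G2 : (forall X, areg a X -> G X = H X) ->
  has_partials G G1 G2 -> has_partials H G1 G2.
Proof. by move=> GH hG X v Xr va; apply: (cder_on po GH va Xr); exact: hG. Qed.

(** Change of variables Q = u_1 + u_2, S = u_1 u_2: the derivative in u_1 is F_Q + u_2 F_S, and
    symmetrically. *)
Lemma partials_chain F i j : chain_family F ->
  has_partials (F i j) (fun X => F i.+1 j X + cu2 X * F i j.+1 X)
    (fun X => F i.+1 j X + cu1 X * F i j.+1 X).
Proof.
move=> HF X v Xr va; have [Xa _] := Xr.
apply: (cder_eq (HF i j X v (aq Xa) (aq va))).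
have hq : has_partials (@qc R) _ _ := partials_on (fun Y Yr => esym (qcE (areg_a Yr))) (partials_add partials_cu1 partials_cu2).
have hs : has_partials (@sc R) _ _ := partials_on (fun Y Yr => esym (scE (areg_a Yr))) (partials_mul partials_cu1 partials_cu2).
rewrite (cder_uniq (cder_qc X v) (hq X v Xr va)) (cder_uniq (cder_sc X v) (hs X v Xr va)).
move: (a1 X * a1 v / 2) (a2 X * a2 v / 2) => x y.
by ring.
Qed.

Lemma cdder_partials h G G1 G2 X : rmx h \in a -> imx h \in a ->
  has_partials G G1 G2 -> areg a X ->
  cdder h G X = G1 X * (a1 X * complexify a1 h / 2) + G2 X * (a2 X * complexify a2 h / 2).
Proof.
move=> rh ih hG Xr; rewrite /cdder (cder_dder (hG X _ Xr rh)) (cder_dder (hG X _ Xr ih)).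
by rewrite /complexify; ring.
Qed.

Definition is_coroot (alpha : V -> C) (t1 t2 : C) :=
  [/\ rmx (coroot a alpha) \in a, imx (coroot a alpha) \in a,
      complexify a1 (coroot a alpha) = t1 & complexify a2 (coroot a alpha) = t2].

Lemma Lop_partials1 G G1 G2 G11 G12 X : is_coroot a1 4 0 ->
  has_partials G G1 G2 -> has_partials G1 G11 G12 -> areg a X -> a1 X != 0 ->
  Lop a a1 G X = 4 * (cu1 X * G11 X + G1 X).
Proof.
move=> [rh ih e1 e2] hG hG1 Xr n1; rewrite /Lop.
(* The coroot (4, 0) differentiates [G] to 2 alpha_1 G1, and 2 alpha_1^2 = 8 u_1. *)
have kE Y : areg a Y -> 8 * (cu1 Y * G1 Y) = a1 Y * cdder (coroot a a1) G Y.
  by move=> Yr; rewrite (cdder_partials rh ih hG Yr) e1 e2 /cu1; field.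
have hk := partials_on kE (partials_mul (partials_cst 8) (partials_mul partials_cu1 hG1)).
by rewrite (cdder_partials rh ih hk Xr) e1 e2; field.
Qed.

Lemma Lop_partials2 G G1 G2 G21 G22 X : is_coroot a2 0 4 ->
  has_partials G G1 G2 -> has_partials G2 G21 G22 -> areg a X -> a2 X != 0 ->
  Lop a a2 G X = 4 * (cu2 X * G22 X + G2 X).
Proof.
move=> [rh ih e1 e2] hG hG2 Xr n2; rewrite /Lop.
have kE Y : areg a Y -> 8 * (cu2 Y * G2 Y) = a2 Y * cdder (coroot a a2) G Y.
  by move=> Yr; rewrite (cdder_partials rh ih hG Yr) e1 e2 /cu2; field.
have hk := partials_on kE (partials_mul (partials_cst 8) (partials_mul partials_cu2 hG2)).
by rewrite (cdder_partials rh ih hk Xr) e1 e2; field.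
Qed.

Hypothesis co1 : is_coroot a1 4 0.
Hypothesis co2 : is_coroot a2 0 4.
Hypothesis a1n0 : forall X, areg a X -> a1 X != 0.
Hypothesis a2n0 : forall X, areg a X -> a2 X != 0.
Variables (F : nat -> nat -> V -> C) (HF : chain_family F) (G : V -> C).
Hypothesis GE : forall X, areg a X -> G X = (cu1 X - cu2 X) * F 0 0 X.

(** The two partial derivatives are existential variables of the goal; they are synthesised by
    recursion on the shape of the function. *)
Ltac partials := cbv beta;
  lazymatch goal with
  | |- has_partials (fun _ => ?c) _ _ => exact: (partials_cst c)
  | |- has_partials (fun X => cu1 X) _ _ => exact: partials_cu1
  | |- has_partials cu1 _ _ => exact: partials_cu1
  | |- has_partials (fun X => cu2 X) _ _ => exact: partials_cu2
  | |- has_partials cu2 _ _ => exact: partials_cu2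
  | |- has_partials (fun X => F ?i ?j X) _ _ => exact: (partials_chain i j HF)
  | |- has_partials (F ?i ?j) _ _ => exact: (partials_chain i j HF)
  | |- has_partials (fun X => @GRing.add _ (@?A X) (@GRing.opp _ (@?B X))) _ _ =>
      eapply (@partials_sub A _ _ B _ _); [partials|partials]
  | |- has_partials (fun X => @GRing.add _ (@?A X) (@?B X)) _ _ =>
      eapply (@partials_add A _ _ B _ _); [partials|partials]
  | |- has_partials (fun X => @GRing.mul _ (@?A X) (@?B X)) _ _ =>
      eapply (@partials_mul A _ _ B _ _); [partials|partials]
  end.

Lemma radial_sum X : areg a X ->
  Lop a a1 G X + Lop a a2 G X = (cu1 X - cu2 X) * (4 * radial_Q F X).
Proof.
move=> Xr.
have hG := partials_on (fun Y Yr => esym (GE Yr)) (partials_mul (partials_sub partials_cu1 partials_cu2) (partials_chain 0 0 HF)).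
have -> : Lop a a1 G X = 4 * (cu1 X * (2 * (F 1 0 X + cu2 X * F 0 1 X)
   + (cu1 X - cu2 X) * (F 2 0 X + 2 * cu2 X * F 1 1 X + cu2 X ^+ 2 * F 0 2 X))
   + (F 0 0 X + (cu1 X - cu2 X) * (F 1 0 X + cu2 X * F 0 1 X))).
  etransitivity; first by eapply (Lop_partials1 co1 hG); [partials|exact: Xr|exact: a1n0].
  by cbv beta; ring.
have -> : Lop a a2 G X = 4 * (cu2 X * (- 2 * (F 1 0 X + cu1 X * F 0 1 X)
   + (cu1 X - cu2 X) * (F 2 0 X + 2 * cu1 X * F 1 1 X + cu1 X ^+ 2 * F 0 2 X))
   + (- F 0 0 X + (cu1 X - cu2 X) * (F 1 0 X + cu1 X * F 0 1 X))).
  etransitivity; first by eapply (Lop_partials2 co2 hG); [partials|exact: Xr|exact: a2n0].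
  by cbv beta; ring.
rewrite /radial_Q (qcE (areg_a Xr)) (scE (areg_a Xr)).
by ring.
Qed.

Lemma radial_prod X : areg a X ->
  Lop a a1 (Lop a a2 G) X = (cu1 X - cu2 X) * (16 * radial_S (det_jet F) X).
Proof.
move=> Xr.
have hG := partials_on (fun Y Yr => esym (GE Yr)) (partials_mul (partials_sub partials_cu1 partials_cu2) (partials_chain 0 0 HF)).
(* [M] is L_{alpha_2} G in closed form, with products in place of powers so that [partials] can
   differentiate it for the outer operator. *)
pose M Y := 4 * (cu2 Y * ((cu1 Y - cu2 Y) * (F 2 0 Y + 2 * cu1 Y * F 1 1 Y + cu1 Y * cu1 Y * F 0 2 Y)
     - 2 * (F 1 0 Y + cu1 Y * F 0 1 Y))
   + ((cu1 Y - cu2 Y) * (F 1 0 Y + cu1 Y * F 0 1 Y) - F 0 0 Y)).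
have ME Y : areg a Y -> M Y = Lop a a2 G Y.
  move=> Yr; apply/esym; etransitivity.
    by eapply (Lop_partials2 co2 hG); [partials|exact: Yr|exact: a2n0].
  by rewrite /M; ring.
eassert (hM : has_partials (Lop a a2 G) _ _).
  by eapply (partials_on ME); rewrite /M; partials.
etransitivity; first by eapply (Lop_partials1 co1 hM); [partials|exact: Xr|exact: a1n0].
rewrite /radial_S /det_jet (qcE (areg_a Xr)) (scE (areg_a Xr)).
cbv beta.
by ring.
Qed.

End RadialCoordinates.

(** * Operators commuting with locally constant factors *)

Section LocallyConstantFactors.
Variable R : realType.
Local Notation C := R[i].
Local Notation V := 'M[R]_(2 + 2).
Variable a : {vspace V}.
Local Notation E := [set` a].
Local Notation Omega := (areg a).
Hypothesis po : plane_open E Omega.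
Implicit Types (psi s alpha : V -> C) (X Y v : V) (T : (V -> C) -> V -> C).

(* delta and beta1 beta2 agree up to a sign that is only locally constant. *)
Definition commutes_locally_constant T := forall s psi psi',
  locally_constant Omega s -> smooth_on E Omega psi ->
  (forall Y, Omega Y -> s Y * psi Y = psi' Y) ->
  forall X, Omega X -> T psi' X = s X * T psi X.

Lemma cdder_locally_constant h : rmx h \in a -> imx h \in a ->
  commutes_locally_constant (cdder h).
Proof.
move=> rh ih s psi psi' ls spsi H X OX.
have D v : v \in a -> dder v psi' X = s X * dder v psi X.
  move=> va; apply: cder_dder; apply: (cder_on po H va OX).
  apply: cder_eq; first exact: (cderM (cder_locally_constant po ls OX va) (smooth_cder spsi va OX)).
  by rewrite mul0r add0r.
by rewrite /cdder !D //; ring.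
Qed.

Lemma Lop_locally_constant alpha : smooth_on E Omega alpha ->
  rmx (coroot a alpha) \in a -> imx (coroot a alpha) \in a ->
  commutes_locally_constant (Lop a alpha).
Proof.
move=> sal rh ih s psi psi' ls spsi H X OX; rewrite /Lop.
have sc : smooth_on E Omega (cdder (coroot a alpha) psi).
  exact: (diff_op_smooth po (diff_op_cdder po rh ih (diff_op_id po)) spsi).
rewrite (cdder_locally_constant rh ih ls (smooth_mul po sal sc) _ OX).
  by rewrite mulrCA.
by move=> Y OY; rewrite (cdder_locally_constant rh ih ls spsi H OY) mulrCA.
Qed.

Lemma comp_locally_constant T T' : diff_op a T' ->
  commutes_locally_constant T -> commutes_locally_constant T' ->
  commutes_locally_constant (T \o T').
Proof.
move=> dT' cT cT' s psi psi' ls spsi H X OX /=.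
apply: (cT s (T' psi) _ ls (diff_op_smooth po dT' spsi) _ X OX) => Y OY.
by rewrite (cT' s psi psi' ls spsi H Y OY).
Qed.

Lemma add_locally_constant T T' :
  commutes_locally_constant T -> commutes_locally_constant T' ->
  commutes_locally_constant (add_op T T').
Proof.
move=> cT cT' s psi psi' ls spsi H X OX; rewrite /add_op.
by rewrite (cT s psi psi' ls spsi H X OX) (cT' s psi psi' ls spsi H X OX) mulrDr.
Qed.

(** With s = d / b locally constant, T passes s in T(s b phi), and the s coming out cancels against
    the one in 1 / d. *)
Lemma conj_op_locally_constant T (d b : V -> C) : commutes_locally_constant T ->
  smooth_on E Omega b -> (forall X, Omega X -> b X != 0) ->
  (forall X, Omega X -> d X != 0) ->
  locally_constant Omega (fun X => d X / b X) ->
  eq_op_on a (conj_op d T) (conj_op b T).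
Proof.
move=> cT sb b0 d0 ls phi sphi X OX; rewrite /conj_op /= /mul_op.
rewrite (cT _ _ _ ls (smooth_mul po sb sphi) _ X OX); last first.
  by move=> Y OY; rewrite mulrA divfK ?b0.
by rewrite mulrA; congr (_ * _); field; rewrite b0 ?d0.
Qed.

End LocallyConstantFactors.

(** * Comparison of delta with a smooth square root of S0 *)

Section Delta.
Variable R : realType.
Local Notation C := R[i].
Local Notation V := 'M[R]_(2 + 2).
Implicit Types X Y : V.

Lemma delta_sqr X : delta X ^+ 2 = (S0f X)%:C%C.
Proof.
rewrite /delta; case: ifP => S0.
  by rewrite -rmorphXn /= sqr_sqrtr.
have {}S0 : S0f X < 0 by rewrite ltNge S0.
apply: complex_eqP; rewrite expr2 ?cReM ?cImM /= ?mul0r ?mulr0 ?addr0 //.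
by rewrite sub0r -expr2 sqr_sqrtr // ltr0_norm // opprK.
Qed.

(** [p] is the real or imaginary part, whichever [delta] makes positive. The value [p b'] is too
    close to [p b] to change sign, so the same sign relates d to b and d' to b'. *)
Lemma sign_transfer (p : C -> R) (d b d' b' : C) : (forall z, p (- z) = - p z) ->
  0 < p d -> 0 < p d' -> b != 0 -> b' != 0 -> d = b \/ d = - b -> d' = b' \/ d' = - b' ->
  `|p b' - p b| < `|p b| -> d' / b' = d / b.
Proof.
move=> pN pd pd' b0 b0' [e|e] [e'|e']; subst d d'; rewrite ?mulNr ?mulfV //.
  rewrite (gtr0_norm pd) ltr_norml ltrBrDr addNr => /andP[h _].
  by move: pd'; rewrite pN oppr_gt0 ltNge ltW.
have pb : p b < 0 by move: pd; rewrite pN oppr_gt0.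
rewrite (ltr0_norm pb) ltr_norml ltrBlDr addNr => /andP[_ h].
by move: pd'; rewrite ltNge ltW.
Qed.

(** S0 has no zero on the regular set and keeps its sign nearby, so the same clause in the
    definition of [delta] applies near X; there [sign_transfer] uses the real part if S0 is
    positive, the imaginary part if negative. *)
Lemma delta_locally_constant (a : {vspace V}) (b : V -> C) :
  plane_open [set` a] (areg a) -> smooth_on [set` a] (areg a) b ->
  (forall X, areg a X -> b X ^+ 2 = (S0f X)%:C%C) ->
  locally_constant (areg a) (fun X => delta X / b X).
Proof.
move=> po sb bE X Xr.
have n0 Y : areg a Y -> S0f Y != 0.
  by move=> [_ [_]]; rewrite mulf_eq0 negb_or => /andP[].
have b0 Y : areg a Y -> b Y != 0.
  move=> Yr; have := n0 Y Yr; apply: contra => /eqP bY.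
  by have := bE Y Yr; rewrite bY expr0n /= => /esym/eqP; rewrite fmorph_eq0.
have two Y : areg a Y -> delta Y = b Y \/ delta Y = - b Y.
  move=> Yr; have : delta Y ^+ 2 == b Y ^+ 2 by rewrite bE // delta_sqr.
  by rewrite eqf_sqr => /orP[] /eqP ->; [left|right].
have dpos Y : 0 < S0f Y -> 0 < complex.Re (delta Y).
  by move=> Y0; rewrite /delta ltW //= sqrtr_gt0.
have dneg Y : S0f Y < 0 -> 0 < complex.Im (delta Y).
  by move=> Y0; rewrite /delta leNgt Y0 /= sqrtr_gt0 normr_gt0 lt_eqF.
have S0near e : 0 < e -> nbhs X (fun Y => areg a Y -> `|S0f Y - S0f X| < e).
  move=> e0; apply: filterS (smooth_eps (smooth_S0f po) Xr e0) => Y H Yr.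
  by have [] := H Yr.
have ReN (z : C) : complex.Re (- z) = - complex.Re z by case: z.
have ImN (z : C) : complex.Im (- z) = - complex.Im z by case: z.
have [S0pos|S0neg|/eqP] := ltgtP 0 (S0f X); last by rewrite eq_sym (negPf (n0 X Xr)).
- have pb : complex.Re (b X) != 0.
    have := dpos X S0pos; have [->|->] := two X Xr; first by move=> h; rewrite gt_eqF.
    by rewrite ReN oppr_gt0 => h; rewrite lt_eqF.
  have pb' : 0 < `|complex.Re (b X)| by rewrite normr_gt0.
  apply: filterS2 (S0near _ S0pos) (smooth_eps sb Xr pb') => Y h1 h2 Yr.
  have [h3 _] := h2 Yr.
  apply: (sign_transfer ReN _ _ (b0 X Xr) (b0 Y Yr) (two X Xr) (two Y Yr) h3).
    exact: dpos.
  by apply: dpos; have := h1 Yr; rewrite ltr_norml ltrBrDr addNr => /andP[].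
- have pb : complex.Im (b X) != 0.
    have := dneg X S0neg; have [->|->] := two X Xr; first by move=> h; rewrite gt_eqF.
    by rewrite ImN oppr_gt0 => h; rewrite lt_eqF.
  have pb' : 0 < `|complex.Im (b X)| by rewrite normr_gt0.
  have S0neg' : 0 < - S0f X by rewrite oppr_gt0.
  apply: filterS2 (S0near _ S0neg') (smooth_eps sb Xr pb') => Y h1 h2 Yr.
  have [_ h3] := h2 Yr.
  apply: (sign_transfer ImN _ _ (b0 X Xr) (b0 Y Yr) (two X Xr) (two Y Yr) h3).
    exact: dneg.
  by apply: dneg; have := h1 Yr; rewrite ltr_norml ltrBlDr addNr => /andP[].
Qed.

End Delta.

(** * Uniqueness of radial parts *)

Section RadialParts.
Variable R : realType.
Local Notation C := R[i].
Local Notation V := 'M[R]_(2 + 2).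
Variables (a : {vspace V}) (ha : cartan_subspace a) (a1 a2 : V -> C).
Variables (P : 'M[C]_(2 + 2)) (Pu : P \in unitmx).
Hypothesis HP : forall X, X \in a ->
  P *m cmx X *m invmx P = diag_mx (alpha_row (a1 X) (a2 X)).
Implicit Types (X Y v : V) (T D : (V -> C) -> V -> C).

Let po : plane_open [set` a] (areg a) := plane_open_areg (a_qset ha).

Lemma Qf_H_conj (g X : V) : g \in unitmx -> Qf (g *m X *m invmx g) = Qf X.
Proof.
by move=> gu; rewrite /Qf -conj_mul // mxtrace_mulC mulKmx.
Qed.

Lemma Sf_H_conj (g X : V) : g \in unitmx -> Sf (g *m X *m invmx g) = Sf X.
Proof.
by move=> gu; rewrite /Sf !det_mulmx mulrAC -det_mulmx mulmxV // det1 mul1r.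
Qed.

Lemma block_diag_unit (A B : 'M[R]_2) : A \in unitmx -> B \in unitmx ->
  block_mx A 0 0 B \in unitmx.
Proof. by move=> Au Bu; rewrite unitmxE det_ublock unitrM -!unitmxE Au Bu. Qed.

Lemma smooth_a_of_qset f : smooth_on (@qset R) (@qset R) f -> smooth_on [set` a] (areg a) f.
Proof.
apply: smooth_sub; first exact: a_qset.
by move=> X [_ []].
Qed.

Definition centered (p : V -> R) X Y : C := (p Y)%:C%C - (p X)%:C%C.

(** With A and B the values of the two roots at X, the determinant along X and X^3 is -A^2 B^2 (A^2
    - B^2)^2 / 64, whose factors are nonzero exactly by regularity. *)
Lemma invariant_jacobian X : areg a X ->
  dder X (centered (@Qf _) X) X * dder (X *m X *m X) (centered (@Sf _) X) X
  - dder (X *m X *m X) (centered (@Qf _) X) X * dder X (centered (@Sf _) X) X != 0.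
Proof.
move=> Xr; have Xa := areg_a Xr; have [n1 n2 n12] := areg_neq0 Pu HP Xr.
have Ca := cube_mem ha Pu HP Xa; have [C1 C2] := a_cube ha Pu HP Xa.
have dq v : v \in a -> dder v (centered (@Qf _) X) X = (a1 X * a1 v + a2 X * a2 v) / 2.
  move=> va; apply: cder_dder.
  have h1 := cder_a1 HP Xa va; have h2 := cder_a2 HP Xa va.
  have h := cderB (cderM (cderD (cderM h1 h1) (cderM h2 h2)) (cder_cst (4^-1) X v))
     (cder_cst (Qf X)%:C%C X v).
  apply: (cder_eq (cder_on po _ va Xr h)); last by field.
  by move=> Y Yr; rewrite /centered (Qf_a Pu HP (areg_a Yr)).
have ds v : v \in a -> dder v (centered (@Sf _) X) X = (a1 X * a2 X ^+ 2 * a1 v + a1 X ^+ 2 * a2 X * a2 v) / 8.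
  move=> va; apply: cder_dder.
  have h1 := cder_a1 HP Xa va; have h2 := cder_a2 HP Xa va.
  have h := cderB (cderM (cderM (cderM h1 h1) (cderM h2 h2)) (cder_cst (16^-1) X v))
     (cder_cst (Sf X)%:C%C X v).
  apply: (cder_eq (cder_on po _ va Xr h)); last by field.
  by move=> Y Yr; rewrite /centered (Sf_a Pu HP (areg_a Yr)).
rewrite !dq // !ds // C1 C2.
move: (a1 X) (a2 X) n1 n2 n12 => A B n1 n2 n12.
have -> : (A * A + B * B) / 2 * ((A * B ^+ 2 * (A ^+ 3 / 4) + A ^+ 2 * B * (B ^+ 3 / 4)) / 8) -
   (A * (A ^+ 3 / 4) + B * (B ^+ 3 / 4)) / 2 * ((A * B ^+ 2 * A + A ^+ 2 * B * B) / 8)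
   = - (A ^+ 2 * B ^+ 2 * (A ^+ 2 - B ^+ 2) ^+ 2 / 64) by field.
by rewrite oppr_eq0 !mulf_neq0 ?expf_neq0 // invr_neq0 // pnatr_eq0.
Qed.

(** Powers of combinations of the centred invariants are smooth and H-invariant on q, so T and T'
    both act on them as D. The difference, with coefficients frozen at X, is then a jet that
    [jet_determined] annihilates. *)
Lemma radial_part_uniq D T T' :
  satisfies_radial a D T -> satisfies_radial a D T' -> eq_op_on a T' T.
Proof.
move=> [[n [c [vs [sc Evs HT]]]] HD] [[n' [c' [vs' [sc' Evs' HT']]]] HD'] phi sphi X Xr.
pose L := [seq (c' i X, vs' i) | i <- index_enum 'I_n'] ++ [seq (- c i X, vs i) | i <- index_enum 'I_n].
have jetL psi : smooth_on [set` a] (areg a) psi -> jet X L psi = T' psi X - T psi X.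
  move=> spsi; rewrite HT // HT' // /jet big_cat !big_map /= -sumrN; congr (_ + _).
  by apply: eq_bigr => i _; rewrite mulNr.
apply/eqP; rewrite -subr_eq0 -jetL //; apply/eqP.
have Xa := areg_a Xr.
pose q := centered (@Qf _) X; pose s := centered (@Sf _) X.
have sub (p : V -> C) E Om c0 : plane_open E Om -> smooth_on E Om p -> smooth_on E Om (fun Y => p Y - c0).
  move=> poE sp; apply: (smooth_ext poE (smooth_add poE sp (smooth_cst poE (- c0)))) => Y _.
  by [].
have sq E Om : plane_open E Om -> smooth_on E Om q by move=> poE; apply: sub => //; exact: smooth_Qf.
have ss E Om : plane_open E Om -> smooth_on E Om s by move=> poE; apply: sub => //; exact: smooth_Sf.
apply: (jet_determined po Xr Xa (cube_mem ha Pu HP Xa) _ _ (sq _ _ po) (ss _ _ po) _ _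
   (invariant_jacobian Xr)) => //.
- by move=> v va; exact: (cartan_basis ha Pu HP Xr va).
- move=> l; rewrite mem_cat => /orP[] /mapP[i _ ->] v; [exact: Evs'|exact: Evs].
- by rewrite /q /centered subrr.
- by rewrite /s /centered subrr.
- move=> x y N; have pq := plane_open_qset R.
  have sg : smooth_on (@qset R) (@qset R) (fun Y => (x * q Y + y * s Y) ^+ N).
    apply: (smooth_exp pq); apply: (smooth_add pq).
      exact: (smooth_mul pq (smooth_cst pq x) (sq _ _ pq)).
    exact: (smooth_mul pq (smooth_cst pq y) (ss _ _ pq)).
  have ig : H_invariant (fun Y => (x * q Y + y * s Y) ^+ N).
    move=> A B Au Bu Y _; have gu := block_diag_unit Au Bu.
    by rewrite /q /s /centered Qf_H_conj // Sf_H_conj.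
  by rewrite jetL ?(HD _ sg ig X Xr) ?(HD' _ sg ig X Xr) ?subrr //; exact: smooth_a_of_qset.
Qed.

End RadialParts.

(** * The vacuous case of a subspace without regular points *)

Section EmptyRegularSet.
Variables (R : realType) (a : {vspace 'M[R]_(2 + 2)}).
Hypothesis a0 : forall X, ~ areg a X.

Lemma eq_op_on_empty T T' : eq_op_on a T T'.
Proof. by move=> phi _ X /a0. Qed.

Lemma radial_part_empty D T : radial_part a D T.
Proof.
split; last by move=> T' _; exact: eq_op_on_empty.
split; last by move=> f _ _ X /a0.
exists 0%N, (fun=> fun=> 0), (fun=> [::]).
by split=> [[]|[]|phi _ X /a0].
Qed.

End EmptyRegularSet.

(** * Both radial parts when a regular point exists *)

Section MainComputation.
Variable R : realType.
Local Notation C := R[i].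
Local Notation V := 'M[R]_(2 + 2).
Variables (a : {vspace V}) (ha : cartan_subspace a) (a1 a2 : V -> C).
Variables (P : 'M[C]_(2 + 2)) (Pu : P \in unitmx).
Hypothesis HP : forall X, X \in a ->
  P *m cmx X *m invmx P = diag_mx (alpha_row (a1 X) (a2 X)).
Variables (X0 : V) (X0r : areg a X0).
Implicit Types (X Y v : V).

Let po : plane_open [set` a] (areg a) := plane_open_areg (a_qset ha).
Let b X := beta1 a1 a2 X * beta2 a1 a2 X.
Let Lsum := add_op (Lop a a1) (Lop a a2).
Let Lprod := Lop a a1 \o Lop a a2.

Let co1 : is_coroot a a1 a2 a1 4 0.
Proof.
by apply: (corootP ha Pu HP X0r) => X _; rewrite mul0r addr0 mulrC mulKf // pnatr_eq0.
Qed.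

Let co2 : is_coroot a a1 a2 a2 0 4.
Proof.
by apply: (corootP ha Pu HP X0r) => X _; rewrite mul0r add0r mulrC mulKf // pnatr_eq0.
Qed.

Let a1n0 X : areg a X -> a1 X != 0. Proof. by move=> /(areg_neq0 Pu HP)[]. Qed.
Let a2n0 X : areg a X -> a2 X != 0. Proof. by move=> /(areg_neq0 Pu HP)[]. Qed.
Let smooth1 := smooth_a1 ha HP.
Let smooth2 := smooth_a2 ha HP.

Let bE X : b X = cu1 a1 X - cu2 a2 X.
Proof. by rewrite /b /beta1 /beta2 /cu1 /cu2; field. Qed.

Let b_neq0 X : areg a X -> b X != 0.
Proof.
move=> Xr; have [_ _ h] := areg_neq0 Pu HP Xr.
have -> : b X = (a1 X ^+ 2 - a2 X ^+ 2) / 4 by rewrite bE /cu1 /cu2; field.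
by rewrite mulf_neq0 // invr_neq0 // pnatr_eq0.
Qed.

Let smooth_b : smooth_on [set` a] (areg a) b.
Proof.
have h := smooth_add po (smooth_mul po (smooth_mul po smooth1 smooth1) (smooth_cst po (4^-1)))
  (smooth_mul po (smooth_mul po smooth2 smooth2) (smooth_cst po (- 4^-1))).
by apply: (smooth_ext po h) => X _; rewrite bE /cu1 /cu2 mulrN.
Qed.

Let b_sqr X : areg a X -> b X ^+ 2 = (S0f X)%:C%C.
Proof. by move=> Xr; rewrite (S0f_a Pu HP (areg_a Xr)). Qed.

Let delta_const : locally_constant (areg a) (fun X => delta X / b X) :=
  delta_locally_constant po smooth_b b_sqr.

Let delta_neq0 X : areg a X -> delta X != 0.
Proof.
move=> Xr; rewrite -sqrf_eq0 delta_sqr -b_sqr // sqrf_eq0; exact: b_neq0.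
Qed.

(** The case definition gives no direct access to smoothness; delta is instead a locally constant
    factor times the smooth function b. *)
Let smooth_delta : smooth_on [set` a] (areg a) (@delta R).
Proof.
apply: (smooth_ext po (smooth_mul po (smooth_locally_constant po delta_const) smooth_b)) => X Xr.
by rewrite divfK // b_neq0.
Qed.

Let diff_op_L1 T : diff_op a T -> diff_op a (Lop a a1 \o T).
Proof. by move=> h; case: co1 => r i _ _; exact: (diff_op_Lop po smooth1 a1n0 r i h). Qed.

Let diff_op_L2 T : diff_op a T -> diff_op a (Lop a a2 \o T).
Proof. by move=> h; case: co2 => r i _ _; exact: (diff_op_Lop po smooth2 a2n0 r i h). Qed.

Let smooth_delta_inv : smooth_on [set` a] (areg a) (fun X => (delta X)^-1) :=
  smooth_inv po smooth_delta delta_neq0.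

Let diff_op_sum : diff_op a (conj_op (@delta R) Lsum).
Proof.
apply: (diff_op_mul po smooth_delta_inv).
have h := diff_op_mul_op smooth_delta.
exact: (diff_op_add (diff_op_L1 h) (diff_op_L2 h)).
Qed.

Let diff_op_prod : diff_op a (conj_op (@delta R) Lprod).
Proof.
apply: (diff_op_mul po smooth_delta_inv).
exact: (diff_op_L1 (diff_op_L2 (diff_op_mul_op smooth_delta))).
Qed.

Let const_L1 : commutes_locally_constant a (Lop a a1).
Proof. by case: co1 => r i _ _; exact: (Lop_locally_constant po smooth1 r i). Qed.

Let const_L2 : commutes_locally_constant a (Lop a a2).
Proof. by case: co2 => r i _ _; exact: (Lop_locally_constant po smooth2 r i). Qed.

Lemma conj_delta_sum : eq_op_on a (conj_op (@delta R) Lsum) (conj_op b Lsum).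
Proof.
exact: (conj_op_locally_constant po (add_locally_constant const_L1 const_L2)
  smooth_b b_neq0 delta_neq0 delta_const).
Qed.

Lemma conj_delta_prod : eq_op_on a (conj_op (@delta R) Lprod) (conj_op b Lprod).
Proof.
have dL2 : diff_op a (Lop a a2) := diff_op_L2 (diff_op_id po).
exact: (conj_op_locally_constant po (comp_locally_constant po dL2 const_L1 const_L2)
  smooth_b b_neq0 delta_neq0 delta_const).
Qed.

Let qcE X : X \in a -> qc X = cu1 a1 X + cu2 a2 X.
Proof.
move=> Xa; rewrite -Qf_coord; last exact: (a_qset ha).
by rewrite (Qf_a Pu HP Xa) /cu1 /cu2; field.
Qed.

Let scE X : X \in a -> sc X = cu1 a1 X * cu2 a2 X.
Proof.
move=> Xa; rewrite -Sf_coord; last exact: (a_qset ha).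
by rewrite (Sf_a Pu HP Xa) /cu1 /cu2; field.
Qed.

Section InvariantFunction.
Variables (f : V -> C) (sf : smooth_on (@qset R) (@qset R) f) (Hf : H_invariant f).

Let GE X : areg a X -> mul_op b f X = (cu1 a1 X - cu2 a2 X) * slice_jet f 0 0 X.
Proof. by move=> [_ Xr]; rewrite /mul_op bE (slice_jetE Hf Xr). Qed.

Let HF := chain_slice_jet sf.
Let c1 := fun X v Xa va => @cder_a1 _ _ _ _ _ HP X v Xa va.
Let c2 := fun X v Xa va => @cder_a2 _ _ _ _ _ HP X v Xa va.

(** On the regular set b f is (u_1 - u_2) times the slice jet of f, so the factor u_1 - u_2 produced
    by [radial_sum] is cancelled by the outer 1 / b. *)
Lemma conj_b_sum X : areg a X -> conj_op b Lsum f X = dpoly (Qf (generic_q R)) f X.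
Proof.
move=> Xr; have [_ Xq] := Xr; rewrite (dpoly_Qf_radial sf Hf Xq).
transitivity ((b X)^-1 * (Lop a a1 (mul_op b f) X + Lop a a2 (mul_op b f) X)); first by [].
rewrite (radial_sum (a_qset ha) c1 c2 qcE scE co1 co2 a1n0 a2n0 HF GE Xr).
by rewrite -bE mulKf // b_neq0.
Qed.

Lemma conj_b_prod X : areg a X -> conj_op b Lprod f X = dpoly (Sf (generic_q R)) f X.
Proof.
move=> Xr; have [_ Xq] := Xr; rewrite (dpoly_Sf_radial sf Hf Xq).
transitivity ((b X)^-1 * Lop a a1 (Lop a a2 (mul_op b f)) X); first by [].
rewrite (radial_prod (a_qset ha) c1 c2 qcE scE co1 co2 a1n0 a2n0 HF GE Xr).
by rewrite -bE mulKf // b_neq0.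
Qed.

End InvariantFunction.

Lemma radial_part_sum : radial_part a (dpoly (Qf (generic_q R))) (conj_op (@delta R) Lsum).
Proof.
have h : satisfies_radial a (dpoly (Qf (generic_q R))) (conj_op (@delta R) Lsum).
  split; first exact: diff_op_sum.
  move=> f sf Hf X Xr.
  by rewrite (conj_delta_sum (smooth_a_of_qset ha sf) Xr) conj_b_sum.
by split => // T' hT'; exact: (radial_part_uniq ha Pu HP h hT').
Qed.

Lemma radial_part_prod : radial_part a (dpoly (Sf (generic_q R))) (conj_op (@delta R) Lprod).
Proof.
have h : satisfies_radial a (dpoly (Sf (generic_q R))) (conj_op (@delta R) Lprod).
  split; first exact: diff_op_prod.
  move=> f sf Hf X Xr.
  by rewrite (conj_delta_prod (smooth_a_of_qset ha sf) Xr) conj_b_prod.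
by split => // T' hT'; exact: (radial_part_uniq ha Pu HP h hT').
Qed.

End MainComputation.

Theorem proposition4p1p1 (R : realType) (a : {vspace 'M[R]_(2 + 2)})
    (ha : cartan_subspace a)
    (alpha1 alpha2 : 'M[R]_(2 + 2) -> R[i])
    (hroots : positive_roots a alpha1 alpha2) :
  let b := fun X => beta1 alpha1 alpha2 X * beta2 alpha1 alpha2 X in
  let Lsum := add_op (Lop a alpha1) (Lop a alpha2) in
  let Lprod := Lop a alpha1 \o Lop a alpha2 in
  [/\ radial_part a (dpoly (Qf (generic_q R))) (conj_op (@delta R) Lsum),
      eq_op_on a (conj_op (@delta R) Lsum) (conj_op b Lsum),
      radial_part a (dpoly (Sf (generic_q R))) (conj_op (@delta R) Lprod) &
      eq_op_on a (conj_op (@delta R) Lprod) (conj_op b Lprod)].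
Proof.
(* A regular point is required to identify the coroots through the basis X0, X0^3; without one, all
   assertions concern an empty set. *)
move=> b Lsum Lprod; have [[X0 X0r]|nr] := pselect (exists X, areg a X).
  have [P Pu HP] := cartan_normal_form ha hroots.
  split; [exact: (radial_part_sum ha Pu HP X0r)|exact: (conj_delta_sum ha Pu HP X0r)
    |exact: (radial_part_prod ha Pu HP X0r)|exact: (conj_delta_prod ha Pu HP X0r)].
have a0 X : ~ areg a X by move=> Xr; apply: nr; exists X.
by split; (exact: radial_part_empty || exact: eq_op_on_empty).
Qed.
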